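(* Let $\mathbb{P}$ be a finite quantum space and let $\mathbb{O}$ be a compact quantum space such that $C(\mathbb{O})$ is separable. Then the embedding $\mathbb{S}_{\mathbb{P},\mathbb{O}}\subset C(\mathbb{M}_{\mathbb{P},\mathbb{O}})$ has the strong extension property: for every (unital) C*-algebra $B$ and every unital completely positive map $\psi\colon\mathbb{S}_{\mathbb{P},\mathbb{O}}\to B$ there exists a unital completely positive map $\eta\colon C(\mathbb{M}_{\mathbb{P},\mathbb{O}})\to B$ extending $\psi$.
   Context: A quantum space $\mathbb{X}$ is an object of the category dual to the category of C*-algebras; the corresponding C*-algebra is denoted $C_0(\mathbb{X})$, or $C(\mathbb{X})$ when it is unital. $\mathbb{X}$ is compact if $C(\mathbb{X})$ is unital and finite if $C(\mathbb{X})$ is finite-dimensional. For C*-algebras $A,B$, $\mathrm{Mor}(A,B)$ is the set of non-degenerate $*$-homomorphisms from $A$ to the multiplier algebra $M(B)$ (unital $*$-homomorphisms $A\to B$ if both are unital). $\otimes$ is the minimal tensor product. For $\mathbb{P}$ finite and $\mathbb{O}$ compact, $(C(\mathbb{M}_{\mathbb{P},\mathbb{O}}),\boldsymbol{\Phi}_{\mathbb{P},\mathbb{O}})$ denotes the (existing, unique up to isomorphism) pair consisting of a unital C*-algebra and a unital $*$-homomorphism $\boldsymbol{\Phi}_{\mathbb{P},\mathbb{O}}\colon C(\mathbb{O})\to C(\mathbb{P})\otimes C(\mathbb{M}_{\mathbb{P},\mathbb{O}})$ with the universal property: for every quantum space $\mathbb{X}$ and every $\Psi\in\mathrm{Mor}(C(\mathbb{O}),C(\mathbb{P})\otimes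 C_0(\mathbb{X}))$ there is a unique $\Lambda\in\mathrm{Mor}(C(\mathbb{M}_{\mathbb{P},\mathbb{O}}),C_0(\mathbb{X}))$ with $\Psi=(\mathrm{id}\otimes\Lambda)\circ\boldsymbol{\Phi}_{\mathbb{P},\mathbb{O}}$. The C*-algebra $C(\mathbb{M}_{\mathbb{P},\mathbb{O}})$ is generated by the slices $(\omega\otimes\mathrm{id})\boldsymbol{\Phi}_{\mathbb{P},\mathbb{O}}(a)$, $a\in C(\mathbb{O})$, $\omega\in C(\mathbb{P})^*$, and $\mathbb{S}_{\mathbb{P},\mathbb{O}}\subset C(\mathbb{M}_{\mathbb{P},\mathbb{O}})$ is the operator system defined as the closed linear span of these slices. *)

(* Defs.v *)
From HB Require Import structures.
From mathcomp Require Import all_boot all_order all_algebra.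
From mathcomp Require Import complex.
From mathcomp Require Import all_classical all_reals all_analysis.

Set Implicit Arguments.
Unset Strict Implicit.
Unset Printing Implicit Defensive.

Import Order.TTheory GRing.Theory Num.Theory.
Import numFieldNormedType.Exports.

Local Open Scope classical_set_scope.
Local Open Scope ring_scope.
Local Open Scope complex_scope.

Reserved Notation "x ** y" (at level 40, left associativity).

(* Complex C*-algebras, not necessarily unital; the zero algebra is allowed.
   The scalars are [R[i]], so the norm takes its (nonnegative real) values in
   [R[i]]. *)
HB.mixin Record CompleteNormedModule_isCStarAlgebra (R : realType) A
    of CompleteNormedModule R[i] A := {
  cmul : A -> A -> A;
  adj : A -> A;
  cmulA : associative cmul;
  cmul_linearl : forall y : A, linear (fun x => cmul x y);
  cmul_linearr : forall x : A, linear (cmul x);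
  adj_antilinear : forall (k : R[i]) (x y : A),
    adj (k *: x + y) = Num.conj k *: adj x + adj y;
  adjM : forall x y : A, adj (cmul x y) = cmul (adj y) (adj x);
  adjK : involutive adj;
  ler_norm_cmul : forall x y : A, `|cmul x y| <= `|x| * `|y|;
  cstar_identity : forall x : A, `|cmul (adj x) x| = `|x| ^+ 2
}.

#[short(type="cstarAlgType")]
HB.structure Definition CStarAlgebra (R : realType) :=
  {A of CompleteNormedModule_isCStarAlgebra R A & CompleteNormedModule R[i] A}.

HB.mixin Record CStarAlgebra_isUnital (R : realType) A of CStarAlgebra R A := {
  cone : A;
  cmul1x : left_id cone (@cmul R A);
  cmulx1 : right_id cone (@cmul R A)
}.

#[short(type="unitalCStarAlgType")]
HB.structure Definition UnitalCStarAlgebra (R : realType) :=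
  {A of CStarAlgebra_isUnital R A & CStarAlgebra R A}.

Notation "x ** y" := (cmul x y) : ring_scope.

Section LinearAlgebra.
Variables (K : numFieldType) (V : lmodType K).

Definition lin_span (D : set V) : set V :=
  [set x | exists (n : nat) (c : 'I_n -> K) (s : 'I_n -> V),
     (forall i, D (s i)) /\ x = \sum_(i < n) c i *: s i].

Definition lin_indep (n : nat) (v : 'I_n -> V) : Prop :=
  forall c : 'I_n -> K, \sum_(i < n) c i *: v i = 0 -> forall i, c i = 0.

Definition finite_dimensional : Prop :=
  exists (n : nat) (e : 'I_n -> V), forall x : V,
    exists c : 'I_n -> K, x = \sum_(i < n) c i *: e i.

End LinearAlgebra.

Arguments finite_dimensional {K} V.

Definition separable (T : topologicalType) : Prop :=
  exists D : set T, countable D /\ dense D.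

Definition star_hom (R : realType) (A B : cstarAlgType R) (f : A -> B) : Prop :=
  [/\ linear f, {morph f : x y / x ** y} & {morph f : x / adj x}].

Definition unital_star_hom (R : realType) (A B : unitalCStarAlgType R)
    (f : A -> B) : Prop :=
  star_hom f /\ f cone = cone.

(* The multiplier algebra M(A), as the *-algebra of double centralizers (L, R)
   of A. Linearity and boundedness of L and R follow from [multP] because A is
   a C*-algebra. *)
Record multiplier (R : realType) (A : cstarAlgType R) := Multiplier {
  lmult : A -> A;
  rmult : A -> A;
  multP : forall x y : A, x ** lmult y = rmult x ** y
}.

Section MultiplierOperations.
Variables (R : realType) (A : cstarAlgType R).
Implicit Types m : multiplier A.

Fact mult_linear_subproof (k : R[i]) m1 m2 (x y : A) :
  x ** (k *: lmult m1 y + lmult m2 y) = (k *: rmult m1 x + rmult m2 x) ** y.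
Proof. by rewrite cmul_linearr cmul_linearl !multP. Qed.

Definition mult_linear (k : R[i]) m1 m2 : multiplier A :=
  Multiplier (mult_linear_subproof k m1 m2).

Fact mult_mul_subproof m1 m2 (x y : A) :
  x ** lmult m1 (lmult m2 y) = rmult m2 (rmult m1 x) ** y.
Proof. by rewrite !multP. Qed.

Definition mult_mul m1 m2 : multiplier A :=
  Multiplier (mult_mul_subproof m1 m2).

Fact mult_adj_subproof m (x y : A) :
  x ** adj (rmult m (adj y)) = adj (lmult m (adj x)) ** y.
Proof.
by rewrite -{1}[x]adjK -adjM -multP adjM adjK.
Qed.

Definition mult_adj m : multiplier A := Multiplier (mult_adj_subproof m).

End MultiplierOperations.

(* Mor(A, B); the last clause is non-degeneracy. *)
Definition is_mor (R : realType) (A B : cstarAlgType R)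
    (f : A -> multiplier B) : Prop :=
  [/\ forall (k : R[i]) (x y : A), f (k *: x + y) = mult_linear k (f x) (f y),
      forall x y : A, f (x ** y) = mult_mul (f x) (f y),
      forall x : A, f (adj x) = mult_adj (f x)
    & dense (lin_span [set b : B | exists x y, b = lmult (f x) y])].

(* [tau] exhibits the algebraic tensor product of A and B as a *-subalgebra of
   T (spanned by the [tau a b]); its restricted norm is then a C*-norm. *)
Definition star_tensor (R : realType) (A B T : cstarAlgType R)
    (tau : A -> B -> T) : Prop :=
  [/\ (forall b, linear (fun a => tau a b)) /\ (forall a, linear (tau a)),
      forall a a' b b', tau a b ** tau a' b' = tau (a ** a') (b ** b'),
      forall a b, adj (tau a b) = tau (adj a) (adj b)
    & forall (n : nat) (a : 'I_n -> A) (b : 'I_n -> B), lin_indep a ->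
        \sum_(i < n) tau (a i) (b i) = 0 -> forall i, b i = 0].

(* [(T, tau)] is the minimal tensor product: the completion of the algebraic
   tensor product for its least C*-norm. *)
Definition min_tensor (R : realType) (A B T : cstarAlgType R)
    (tau : A -> B -> T) : Prop :=
  [/\ star_tensor tau,
      dense (lin_span [set t : T | exists a b, t = tau a b])
    & forall (T' : cstarAlgType R) (tau' : A -> B -> T'), star_tensor tau' ->
        forall (n : nat) (a : 'I_n -> A) (b : 'I_n -> B),
          `|\sum_(i < n) tau (a i) (b i)| <= `|\sum_(i < n) tau' (a i) (b i)|].

(* [F] is the morphism id (x) f in Mor(P (x) A, P (x) B), where [f] is in
   Mor(A, B). *)
Definition id_tensor_mor (R : realType) (P A B PA PB : cstarAlgType R)
    (tauA : P -> A -> PA) (tauB : P -> B -> PB)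
    (f : A -> multiplier B) (F : PA -> multiplier PB) : Prop :=
  is_mor F /\
  forall p q a b,
    lmult (F (tauA p a)) (tauB q b) = tauB (p ** q) (lmult (f a) b).

(* The universal property of (C(M_{P,O}), Phi_{P,O}), with [T] the tensor
   product of [P] and [M]. As [O] and [P (x) M] are unital, Phi is a unital
   *-homomorphism; X may be non-compact. *)
Definition universal_quantum_maps (R : realType)
    (P O M T : unitalCStarAlgType R) (tau : P -> M -> T) (Phi : O -> T)
    : Prop :=
  [/\ min_tensor tau, unital_star_hom Phi
    & forall (X TX : cstarAlgType R) (tauX : P -> X -> TX), min_tensor tauX ->
        forall Psi : O -> multiplier TX, is_mor Psi ->
          exists! Lambda : M -> multiplier X,
            is_mor Lambda /\
            exists2 idLambda : T -> multiplier TX,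
              id_tensor_mor tau tauX Lambda idLambda &
              Psi = idLambda \o Phi].

(* [F] is the slice map omega (x) id on P (x) A. *)
Definition slice_map (R : realType) (P A T : cstarAlgType R)
    (tau : P -> A -> T) (omega : P -> R[i]^o) (F : T -> A) : Prop :=
  [/\ linear F, continuous F & forall p a, F (tau p a) = omega p *: a].

Definition slices (R : realType) (P O M T : cstarAlgType R)
    (tau : P -> M -> T) (Phi : O -> T) : set M :=
  [set s | exists (omega : P -> R[i]^o) (F : T -> M) (a : O),
     [/\ linear omega, continuous omega, slice_map tau omega F
       & s = F (Phi a)]].

Definition slice_system (R : realType) (P O M T : cstarAlgType R)
    (tau : P -> M -> T) (Phi : O -> T) : set M :=
  closure (lin_span (slices tau Phi)).

(* [x] is positive in the C*-algebra of n by n matrices over A, i.e. x = y* y *)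
Definition mx_positive (R : realType) (A : cstarAlgType R) (n : nat)
    (x : 'M[A]_n) : Prop :=
  exists y : 'M[A]_n, forall i j, x i j = \sum_(k < n) adj (y k i) ** y k j.

(* [psi] is a unital completely positive map on the operator system [S] of A;
   its values outside [S] are irrelevant. *)
Definition ucp_on (R : realType) (A B : unitalCStarAlgType R) (S : set A)
    (psi : A -> B) : Prop :=
  [/\ forall (k : R[i]) (x y : A), S x -> S y ->
        psi (k *: x + y) = k *: psi x + psi y,
      psi cone = cone
    & forall (n : nat) (x : 'M[A]_n), (forall i j, S (x i j)) ->
        mx_positive x -> mx_positive (map_mx psi x)].

Definition strong_extension_property (R : realType)
    (A : unitalCStarAlgType R) (S : set A) : Prop :=
  forall (B : unitalCStarAlgType R) (psi : A -> B), ucp_on S psi ->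
    exists eta : A -> B, ucp_on setT eta /\ forall s, S s -> eta s = psi s.

(* Main.v *)
From Stdlib Require Ncring Ncring_tac.
Require Import Defs.
From HB Require Import structures.
From mathcomp Require Import all_boot all_order all_algebra.
From mathcomp Require Import complex.
From mathcomp Require Import all_classical all_reals all_analysis.
From mathcomp Require Import lra ring.

(* Elements of P (x) A are matrices over A: P acts on itself by left
   multiplication, and the trace of this action gives P orthonormal bases.
   Applying psi entrywise turns Phi into a completely positive map beta from O
   to matrices over B. Its Stinespring module over B, taken twice, gives a
   C*-algebra X, a vector w, a representation r of O in X, and a partial
   isometry s in P (x) X with s^2 = 0, initial projection 1 (x) |w><w| and
   s^* (1 (x) r) s = (id (x) psi) Phi. The unitary exchanging the initial and the
   final space of s conjugates 1 (x) r into a *-homomorphism Pi : O -> P (x) X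
   whose compression to w is (id (x) psi) Phi. By the universal property
   Pi = (id (x) L) Phi with L : M -> X, and <w, L(.) w> extends psi.
   C*-algebras of operators on a module are obtained without completing the
   module, as limits of the forms <x, T y> for adjointable T. *)

Set Implicit Arguments.
Unset Strict Implicit.
Unset Printing Implicit Defensive.

Import Order.TTheory GRing.Theory Num.Theory.
Import numFieldNormedType.Exports.

Local Open Scope classical_set_scope.
Local Open Scope ring_scope.
Local Open Scope complex_scope.

(** * C*-algebras from complete data *)

(** An arbitrary [B] has no injectivity to offer, so [M] is reached only through its universal
    property, which takes *-homomorphisms with values in P (x) X, whereas compressing 1 (x) r by s
    is not multiplicative. Over Hilbert modules the complements of the initial and final projections
    of s need not be isomorphic, so s need not extend to a unitary. The second copy makes the two
    projections orthogonal, and 1 - s s^* - s^* s + s + s^* is then unitary. It lies in P (x) X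
    because s = \sum_i u_i^* (x) s_i is a finite sum. The identity \sum_j u_j u_j^* = 1 gives both
    the initial projection of s and the recovery of an element of P from its matrix. The norm of [T]
    is known only as the least C*-norm; comparing it with a concrete one requires that injective
    *-homomorphisms do not decrease norms. This and the positivity of y^* y are derived from the
    norm axioms without spectra: a self-adjoint a counts as positive when |t - a| <= t for some t >=
    0. *)

Section LinearMaps.
Variables (K : pzRingType) (U V : lmodType K) (f : U -> V).
Hypothesis fL : linear f.
Lemma linD x y : f (x + y) = f x + f y.
Proof. by have := fL 1 x y; rewrite !scale1r. Qed.
Lemma lin0 : f 0 = 0.
Proof. by apply: (@addIr _ (f 0)); rewrite -linD !add0r. Qed.
Lemma linZ k x : f (k *: x) = k *: f x.
Proof. by have := fL k x 0; rewrite lin0 !addr0. Qed.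
Lemma linB x y : f (x - y) = f x - f y.
Proof. by rewrite linD -scaleN1r linZ scaleN1r. Qed.
Lemma lin_sum I (r : seq I) (G : I -> U) : f (\sum_(j <- r) G j) = \sum_(j <- r) f (G j).
Proof. by elim/big_rec2: _ => [|j y z _ <-]; rewrite ?lin0 ?linD. Qed.
End LinearMaps.

Lemma normc_ge0 (R : realType) (k : R[i]) : 0 <= Normc.normc k.
Proof. by case: k => a b; exact: sqrtr_ge0. Qed.

Lemma gtc0P (R : realType) (e : R[i]) : 0 < e -> exists2 r : R, 0 < r & e = r%:C.
Proof.
case: e => a b; rewrite ltcE /= => /andP[/eqP -> a0]; exists a => //.
Qed.

Lemma invn_lt (R : realType) (e : R) : 0 < e ->
  exists N, forall n, (N <= n)%N -> (n.+1%:R)^-1 < e.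
Proof.
move=> e0; have [N HN] := ltr_add_invr e0.
exists N => n Nn; move: HN; rewrite add0r; apply: le_lt_trans.
by rewrite lef_pV2 ?posrE ?ltr0n // ler_nat.
Qed.

(** Real-valued norms and sequential completeness are what the constructions below deliver directly;
    [Wrapper] turns such data into an instance of the library structures. *)
Record cstarData (R : realType) := CStarData {
  cd_sort :> lmodType R[i];
  cd_norm : cd_sort -> R;
  cd_mul : cd_sort -> cd_sort -> cd_sort;
  cd_adj : cd_sort -> cd_sort;
  cd_one : cd_sort;
  cd_normD : forall x y, cd_norm (x + y) <= cd_norm x + cd_norm y;
  cd_normZ : forall (k : R[i]) x, cd_norm (k *: x) = Normc.normc k * cd_norm x;
  cd_norm0 : forall x, cd_norm x = 0 -> x = 0;
  cd_mulA : associative cd_mul;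
  cd_mull : forall y, linear (cd_mul^~ y);
  cd_mulr : forall x, linear (cd_mul x);
  cd_adjL : forall (k : R[i]) x y,
    cd_adj (k *: x + y) = Num.conj k *: cd_adj x + cd_adj y;
  cd_adjM : forall x y, cd_adj (cd_mul x y) = cd_mul (cd_adj y) (cd_adj x);
  cd_adjK : involutive cd_adj;
  cd_normM : forall x y, cd_norm (cd_mul x y) <= cd_norm x * cd_norm y;
  cd_cstar : forall x, cd_norm (cd_mul (cd_adj x) x) = cd_norm x ^+ 2;
  cd_mul1x : left_id cd_one cd_mul;
  cd_mulx1 : right_id cd_one cd_mul;
  cd_complete : forall u : nat -> cd_sort,
    (forall e, 0 < e -> exists N, forall m n, (N <= m)%N -> (N <= n)%N ->
       cd_norm (u m - u n) <= e) ->
    exists l, forall e, 0 < e -> exists N, forall n, (N <= n)%N ->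
       cd_norm (u n - l) <= e }.

(** A fresh head symbol on which the instances below are keyed. *)
Definition cstar_of (R : realType) (D : cstarData R) : Type := cd_sort D.

Section Wrapper.
Variables (R : realType) (D : cstarData R).
HB.instance Definition _ := GRing.Lmodule.copy (cstar_of D) (cd_sort D).
Let N (x : cstar_of D) : R[i] := (cd_norm x)%:C.

Fact cstar_of_normD x y : N (x + y) <= N x + N y.
Proof. by rewrite /N -rmorphD lecR cd_normD. Qed.
Fact cstar_of_normZ (k : R[i]) x : N (k *: x) = `|k| * N x.
Proof. by rewrite /N [_ *: _]/(k *: (x : cd_sort D)) cd_normZ rmorphM. Qed.
Fact cstar_of_norm0 x : N x = 0 -> x = 0.
Proof. by move=> /complexI /cd_norm0. Qed.
HB.instance Definition _ :=
  Lmodule_isNormed.Build R[i] (cstar_of D) cstar_of_normD cstar_of_normZ cstar_of_norm0.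

Lemma cstar_of_normE (x : cstar_of D) : `|x| = (cd_norm x)%:C.
Proof. by []. Qed.

(** A Cauchy filter contains a ball of radius 1/(n+1) for every n. Any two of these balls meet
    because the filter is proper, so their centres form a Cauchy sequence, whose limit is the limit
    of the filter. *)
Fact cstar_of_complete (F : set_system (cstar_of D)) :
  ProperFilter F -> cauchy F -> cvg F.
Proof.
move=> FF cF.
have ex (n : nat) : exists x : cstar_of D, F (ball x (n.+1%:R^-1 : R)%:C).
  by apply: ((cauchyP F).1 cF); rewrite ltcR invr_gt0.
have [x xF] := choice ex.
have near_x m n : cd_norm (x m - x n) < m.+1%:R^-1 + n.+1%:R^-1.
  have [y [ym yn]] := @filter_ex _ F _ _ (filterI (xF m) (xF n)).
  move: ym yn; rewrite -!ball_normE /ball_ /= => ym yn.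
  rewrite -ltcR rmorphD /= -cstar_of_normE.
  have -> : x m - x n = (x m - y) - (x n - y) by rewrite opprB addrA subrK.
  by rewrite (le_lt_trans (ler_normB _ _)) // ltrD.
have [|l lim_l] := @cd_complete R D x.
  move=> e e0; have [K HK] := invn_lt (divr_gt0 e0 (ltr0Sn R 1)).
  exists K => m n mK nK; apply: ltW; apply: lt_le_trans (near_x m n) _.
  by rewrite [leRHS]splitr lerD // ltW // HK.
apply/cvg_ex; exists l; apply/cvg_ballP => e /gtc0P[r r0 ->].
have [K1 HK1] := invn_lt (divr_gt0 r0 (ltr0Sn R 1)).
have [K2 HK2] := lim_l (r / 2) (divr_gt0 r0 (ltr0Sn R 1)).
pose n := maxn K1 K2.
apply: filterS (xF n) => y; rewrite -!ball_normE /ball_ /= => yn.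
have -> : l - y = - (x n - l) + (x n - y) by rewrite opprB addrA subrK.
apply: le_lt_trans (ler_normD _ _) _.
rewrite normrN cstar_of_normE [in ltRHS](splitr r) rmorphD ler_ltD //.
  by rewrite lecR HK2 // leq_maxr.
by apply: lt_trans yn _; rewrite ltcR HK1 // leq_maxl.
Qed.

HB.instance Definition _ := Uniform_isComplete.Build (cstar_of D) cstar_of_complete.

Fact cstar_of_normM (x y : cstar_of D) :
  `|cd_mul x y : cstar_of D| <= `|x| * `|y|.
Proof. by rewrite !cstar_of_normE -rmorphM lecR cd_normM. Qed.
Fact cstar_of_identity (x : cstar_of D) :
  `|cd_mul (cd_adj x) x : cstar_of D| = `|x| ^+ 2.
Proof. by rewrite !cstar_of_normE cd_cstar rmorphXn. Qed.

HB.instance Definition _ :=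
  CompleteNormedModule_isCStarAlgebra.Build R (cstar_of D)
    (@cd_mulA R D) (@cd_mull R D) (@cd_mulr R D) (@cd_adjL R D) (@cd_adjM R D)
    (@cd_adjK R D) cstar_of_normM cstar_of_identity.
HB.instance Definition _ :=
  CStarAlgebra_isUnital.Build R (cstar_of D) (@cd_mul1x R D) (@cd_mulx1 R D).
End Wrapper.

(** An alias carrying a ring structure, so that ring lemmas apply to the product; the structure is
    [pzRingType] because 1 = 0 in the zero algebra. *)
Definition ualg (R : realType) (A : unitalCStarAlgType R) : Type := A.

Section Ualg.
Variables (R : realType) (A : unitalCStarAlgType R).
HB.instance Definition _ := UnitalCStarAlgebra.copy (ualg A) A.
Fact ualg_mulDl : left_distributive (@cmul R A) +%R.
Proof. by move=> x y z; have := cmul_linearl z 1 x y; rewrite !scale1r. Qed.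
Fact ualg_mulDr : right_distributive (@cmul R A) +%R.
Proof. by move=> x y z; have := cmul_linearr x 1 y z; rewrite !scale1r. Qed.
HB.instance Definition _ := GRing.Zmodule_isPzRing.Build (ualg A)
  (@cmulA R A) (@cmul1x R A) (@cmulx1 R A) ualg_mulDl ualg_mulDr.

Lemma cscaleAl (k : R[i]) (x y : ualg A) : k *: (x * y) = (k *: x) * y.
Proof. by have := cmul_linearl y k x 0; rewrite !addr0 [cmul 0 y]mul0r addr0. Qed.
Lemma cscaleAr (k : R[i]) (x y : ualg A) : k *: (x * y) = x * (k *: y).
Proof. by have := cmul_linearr x k y 0; rewrite !addr0 [cmul x 0]mulr0 addr0. Qed.
End Ualg.

(** * Norm and adjoint *)

Section NoncommutativeRing.
Variable (R : pzRingType).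
(** Together with [nc_ring], this opens every [pzRingType] to the decision procedure for
    noncommutative ring identities, called [ncr] below. *)
Definition nc_ops : @Ncring.Ring_ops R (0:R) (1:R) (fun x y => x + y)
  (fun x y => x * y) (fun x y => x - y) (fun x => - x) (@eq R) := @Ncring.Build_Ring_ops _ _ _ _ _ _ _ _.
Lemma nc_ring : @Ncring.Ring R _ _ _ _ _ _ _ nc_ops.
Proof.
constructor; try exact: RelationClasses.eq_equivalence; try (by move=> ? ? -> ? ? ->);
  try (by move=> ? ? ->).
- exact: add0r.
- exact: addrC.
- exact: addrA.
- exact: mul1r.
- exact: mulr1.
- exact: mulrA.
- exact: mulrDl.
- by move=> x y z; exact: mulrDr.
- by [].
- exact: subrr.
Qed.
End NoncommutativeRing.

#[local] Existing Instance nc_ops.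
#[local] Existing Instance nc_ring.
Ltac ncr := Ncring_tac.non_commutative_ring.

Section Norm.
Variables (R : realType) (A : cstarAlgType R).
Implicit Types (x y : A) (k : R[i]).

Definition nrm x : R := complex.Re `|x|.

Lemma nrmE x : `|x| = (nrm x)%:C.
Proof. by rewrite /nrm (RRe_real (normr_real x)). Qed.

Lemma nrm_ge0 x : 0 <= nrm x.
Proof. by rewrite -lecR -nrmE normr_ge0. Qed.

Lemma nrm0 : nrm 0 = 0.
Proof. by rewrite /nrm normr0. Qed.

Lemma nrm0_eq0 x : nrm x = 0 -> x = 0.
Proof. by move=> x0; apply/normr0_eq0; rewrite nrmE x0. Qed.

Lemma nrm_le0 x : nrm x <= 0 -> x = 0.
Proof. by move=> x0; apply/nrm0_eq0/eqP; rewrite eq_le x0 nrm_ge0. Qed.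

Lemma nrm_small x : (forall e, 0 < e -> nrm x <= e) -> x = 0.
Proof.
move=> small; apply: nrm_le0; apply/ler_addgt0Pr => e /small; by rewrite add0r.
Qed.

Lemma nrmD x y : nrm (x + y) <= nrm x + nrm y.
Proof. by rewrite -lecR rmorphD /= -!nrmE ler_normD. Qed.

Lemma nrmN x : nrm (- x) = nrm x.
Proof. by rewrite /nrm normrN. Qed.

Lemma nrmB x y : nrm (x - y) <= nrm x + nrm y.
Proof. by rewrite -(nrmN y) nrmD. Qed.

Lemma nrmC x y : nrm (x - y) = nrm (y - x).
Proof. by rewrite -nrmN opprB. Qed.

Lemma nrmZ k x : nrm (k *: x) = Normc.normc k * nrm x.
Proof. by apply: complexI; rewrite -nrmE normrZ nrmE rmorphM. Qed.

Lemma nrmZr (r : R) x : nrm (r%:C *: x) = `|r| * nrm x.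
Proof. by rewrite nrmZ /Normc.normc /= expr0n /= addr0 sqrtr_sqr. Qed.

Lemma nrmZi x : nrm ('i *: x) = nrm x.
Proof. by rewrite nrmZ /Normc.normc /= expr0n expr1n /= add0r sqrtr1 mul1r. Qed.

Lemma nrmM x y : nrm (x ** y) <= nrm x * nrm y.
Proof. by rewrite -lecR rmorphM /= -!nrmE ler_norm_cmul. Qed.

Lemma nrm_cstar x : nrm (adj x ** x) = nrm x ^+ 2.
Proof. by apply: complexI; rewrite -nrmE cstar_identity nrmE rmorphXn. Qed.

Lemma nrm_adj x : nrm (adj x) = nrm x.
Proof.
suff le y : nrm y <= nrm (adj y).
  by apply/eqP; rewrite eq_le le -{2}(adjK x) le.
have [->|y0] := eqVneq (nrm y) 0; first exact: nrm_ge0.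
have: 0 < nrm y by rewrite lt_def y0 nrm_ge0.
move=> yp; rewrite -(ler_pM2r yp) -expr2 -nrm_cstar; exact: nrmM.
Qed.

Lemma cadjZ k x : adj (k *: x) = Num.conj k *: adj x.
Proof.
have a0 : adj (0 : A) = 0.
  have /eqP := adj_antilinear 1 (0:A) 0.
  by rewrite rmorph1 !scale1r addr0 -subr_eq subrr eq_sym => /eqP.
by have := adj_antilinear k x 0; rewrite a0 !addr0.
Qed.
Lemma adjD x y : adj (x + y) = adj x + adj y.
Proof. by have := adj_antilinear 1 x y; rewrite rmorph1 !scale1r. Qed.
Lemma adj0 : adj (0 : A) = 0.
Proof. by have := cadjZ 0 0; rewrite rmorph0 !scale0r. Qed.
Lemma adjN x : adj (- x) = - adj x.
Proof. by rewrite -scaleN1r cadjZ rmorphN1 scaleN1r. Qed.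
Lemma adjB x y : adj (x - y) = adj x - adj y.
Proof. by rewrite adjD adjN. Qed.
Lemma adjZr (r : R) x : adj (r%:C *: x) = r%:C *: adj x.
Proof. by rewrite cadjZ; congr (_ *: _); exact: conjc_real. Qed.
Lemma adjZi x : adj ('i *: x) = - ('i *: adj x).
Proof.
rewrite cadjZ -scaleNr; congr (_ *: _).
by apply/eqP; rewrite eq_complex /= oppr0 !eqxx.
Qed.
Lemma adj_sum I (r : seq I) (P : pred I) (F : I -> A) :
  adj (\sum_(i <- r | P i) F i) = \sum_(i <- r | P i) adj (F i).
Proof. exact: (big_morph _ adjD adj0). Qed.

Lemma cmulDl x y z : (x + y) ** z = x ** z + y ** z.
Proof. by have := cmul_linearl z 1 x y; rewrite !scale1r. Qed.
Lemma cmulDr x y z : x ** (y + z) = x ** y + x ** z.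
Proof. by have := cmul_linearr x 1 y z; rewrite !scale1r. Qed.
Lemma cmul0x x : 0 ** x = 0.
Proof. by apply: (@addIr _ (0 ** x)); rewrite -cmulDl !add0r. Qed.
Lemma cmulx0 x : x ** 0 = 0.
Proof. by apply: (@addIr _ (x ** 0)); rewrite -cmulDr !add0r. Qed.
Lemma cmulZl k x y : (k *: x) ** y = k *: (x ** y).
Proof. by have := cmul_linearl y k x 0; rewrite !addr0 cmul0x addr0. Qed.
Lemma cmulZr k x y : x ** (k *: y) = k *: (x ** y).
Proof. by have := cmul_linearr x k y 0; rewrite !addr0 cmulx0 addr0. Qed.
Lemma cmulNl x y : (- x) ** y = - (x ** y).
Proof. by rewrite -scaleN1r cmulZl scaleN1r. Qed.
Lemma cmulNr x y : x ** (- y) = - (x ** y).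
Proof. by rewrite -scaleN1r cmulZr scaleN1r. Qed.
Lemma cmulBl x y z : (x - y) ** z = x ** z - y ** z.
Proof. by rewrite cmulDl cmulNl. Qed.
Lemma cmulBr x y z : x ** (y - z) = x ** y - x ** z.
Proof. by rewrite cmulDr cmulNr. Qed.
Lemma cmul_suml I (r : seq I) (P : pred I) (F : I -> A) x :
  (\sum_(i <- r | P i) F i) ** x = \sum_(i <- r | P i) F i ** x.
Proof. by apply: (big_morph (fun y => y ** x)) => [y z|]; rewrite ?cmulDl ?cmul0x. Qed.
Lemma cmul_sumr I (r : seq I) (P : pred I) (F : I -> A) x :
  x ** (\sum_(i <- r | P i) F i) = \sum_(i <- r | P i) x ** F i.
Proof. by apply: (big_morph (fun y => x ** y)) => [y z|]; rewrite ?cmulDr ?cmulx0. Qed.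

Lemma nrm_sum I (r : seq I) (P : pred I) (F : I -> A) :
  nrm (\sum_(i <- r | P i) F i) <= \sum_(i <- r | P i) nrm (F i).
Proof.
elim/big_rec2: _ => [|i y x _ le]; first by rewrite nrm0.
by rewrite (le_trans (nrmD _ _)) // lerD2l.
Qed.

Lemma real_halfD x : x = (2^-1)%:C *: (x + x).
Proof.
have -> : x + x = (2 : R)%:C *: x by rewrite rmorph_nat scaler_nat mulr2n.
by rewrite scalerA -rmorphM mulVf ?rmorph1 ?scale1r ?pnatr_eq0.
Qed.

(* The element [v = g + i h] is normal, and [g] is its real part. *)
Lemma comm_sq_le (g h : A) : adj g = g -> adj h = h -> g ** h = h ** g ->
  nrm (g ** g) <= nrm (g ** g + h ** h).
Proof.
move=> ga ha gh; pose v := g + 'i *: h.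
have va : adj v = g - 'i *: h by rewrite adjD adjZi ga ha.
have <- : adj v ** v = g ** g + h ** h.
  rewrite va cmulBl !cmulDr !cmulZl !cmulZr gh. rewrite scalerA.
  have -> : 'i * 'i = -1 :> R[i] by rewrite -expr2 sqr_i.
  by rewrite scaleN1r opprD addrA addrK opprK.
have gv : nrm g <= nrm v.
  have -> : g = (2^-1)%:C *: (v + adj v).
    by rewrite va addrACA subrr addr0 -real_halfD.
  rewrite nrmZr ger0_norm ?invr_ge0 // mulrC ler_pdivrMr ?ltr0Sn //.
  by rewrite mulr_natr mulr2n (le_trans (nrmD _ _)) // nrm_adj.
by rewrite -{1}ga !nrm_cstar lerXn2r // nnegrE nrm_ge0.
Qed.

Definition lims (u : nat -> A) (l : A) :=
  forall e : R, 0 < e -> exists N, forall n, (N <= n)%N -> nrm (u n - l) <= e.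

Lemma cauchy_lims (u : nat -> A) :
  (forall e, 0 < e -> exists N, forall m n, (N <= m)%N -> (N <= n)%N ->
     nrm (u m - u n) <= e) ->
  exists l, lims u l.
Proof.
move=> cu.
have: cauchy (u @ \oo).
  apply: cauchy_exP => _ /gtc0P[e e0 ->].
  have [N HN] := cu _ (divr_gt0 e0 (ltr0Sn R 1)).
  exists (u N); exists N => // n /= Nn; rewrite -ball_normE /ball_ /= nrmE ltcR.
  by rewrite (le_lt_trans (HN _ _ _ _)) // ltr_pdivrMr // ltr_pMr // ltr1n.
move=> /cauchy_cvg /cvg_ex[l /cvg_ballP ul]; exists l => e e0.
have e0' : 0 < e%:C :> R[i] by rewrite ltcR.
have [N _ HN] := ul _ e0'; exists N => n /HN.
by rewrite -ball_normE /ball_ /= nrmE ltcR nrmC => /ltW.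
Qed.
End Norm.

(** * Square roots *)

Section Unital.
Variables (R : realType) (A : unitalCStarAlgType R).
Local Notation C := (ualg A).
Implicit Types (x y a b c g h : C) (k : R[i]) (r t : R).

Lemma uadjM x y : adj (x * y) = adj y * adj x. Proof. exact: adjM. Qed.
Lemma unrmM x y : nrm (x * y) <= nrm x * nrm y. Proof. exact: nrmM. Qed.
Lemma unrm_cstar x : nrm (adj x * x) = nrm x ^+ 2. Proof. exact: nrm_cstar. Qed.
Lemma uadj1 : adj (1 : C) = 1.
Proof. by rewrite -[LHS]mul1r -{1}(adjK (1 : C)) -uadjM mul1r adjK. Qed.
Lemma nrm1_le1 : nrm (1 : C) <= 1.
Proof.
have := unrm_cstar (1 : C); rewrite uadj1 mul1r => n1.
have [->//|n0] := eqVneq (nrm (1 : C)) 0.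
have p : 0 < nrm (1 : C) by rewrite lt_def n0 nrm_ge0.
by rewrite -(ler_pM2l p) mulr1 -expr2 -n1.
Qed.

Lemma nrm_sa a : adj a = a -> nrm (a * a) = nrm a ^+ 2.
Proof. by move=> aa; rewrite -unrm_cstar aa. Qed.
Lemma sq_eq0 a : adj a = a -> a * a = 0 -> a = 0.
Proof.
by move=> aa a0; apply: nrm0_eq0; apply/eqP; rewrite -sqrf_eq0 -nrm_sa // a0 nrm0.
Qed.

Lemma scale_real_mul r t (x y : C) : (r%:C *: x) * (t%:C *: y) = (r * t)%:C *: (x * y).
Proof. by rewrite -cscaleAl -cscaleAr scalerA rmorphM. Qed.

Lemma commZ k x y : GRing.comm x y -> GRing.comm x (k *: y).
Proof. by rewrite /GRing.comm -cscaleAr -cscaleAl => ->. Qed.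

Lemma lims_uniq (u : nat -> C) l l' : lims u l -> lims u l' -> l = l'.
Proof.
move=> ul ul'; apply/eqP; rewrite -subr_eq0; apply/eqP/nrm_small => e e0.
have [N HN] := ul _ (divr_gt0 e0 (ltr0Sn R 1)).
have [N' HN'] := ul' _ (divr_gt0 e0 (ltr0Sn R 1)).
have -> : l - l' = (u (maxn N N') - l') - (u (maxn N N') - l).
  by ncr.
rewrite (le_trans (nrmB _ _)) // [leRHS]splitr lerD //.
  by rewrite HN' // leq_maxr.
by rewrite HN // leq_maxl.
Qed.

Lemma lims_lin (u v : nat -> C) a b k : lims u a -> lims v b ->
  lims (fun n => k *: u n + v n) (k *: a + b).
Proof.
move=> ua vb e e0; pose n := Normc.normc k + 1.
have n0 : 0 < n by rewrite ltr_wpDl // normc_ge0.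
have e1 : 0 < e / 2 / n by rewrite !divr_gt0.
have [N1 H1] := ua _ e1; have [N2 H2] := vb _ (divr_gt0 e0 (ltr0Sn R 1)).
exists (maxn N1 N2) => m; rewrite geq_max => /andP[/H1 h1 /H2 h2].
have -> : k *: u m + v m - (k *: a + b) = k *: (u m - a) + (v m - b) by rewrite scalerBr; ncr.
rewrite (le_trans (nrmD _ _)) // [leRHS]splitr lerD // nrmZ.
apply: (@le_trans _ _ (Normc.normc k * (e / 2 / n))); first by rewrite ler_wpM2l ?normc_ge0.
by rewrite mulrA ler_pdivrMr // mulrC ler_pM2l ?divr_gt0 // lerDl.
Qed.

Let rs := fix rs n : R := if n is n'.+1 then (1 + rs n' ^+ 2) / 2 else 0.

Let rsS n : rs n.+1 = (1 + rs n ^+ 2) / 2. Proof. by []. Qed.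

Let rs_bnd n : 0 <= rs n <= 1.
Proof.
elim: n => [|n /andP[r0 r1]]; first by rewrite lexx ler01.
rewrite rsS; move: (rs n) r0 r1 => r r0 r1; apply/andP; split; nra.
Qed.

Let rs_mono n : rs n <= rs n.+1.
Proof. rewrite rsS; move: (rs n) => r; have := sqr_ge0 (r - 1); nra. Qed.

Let rs_cauchy e : 0 < e -> exists N, forall m, (N <= m)%N -> rs m - rs N <= e.
Proof.
move=> e0; pose E := [set rs n | n in setT].
have supE : has_sup E.
  by split; [exists 0, 0%N | exists 1 => _ [n _ <-]; case/andP: (rs_bnd n)].
have [_ [N _ <-] HN] := sup_adherent e0 supE.
exists N => m _; rewrite lerBlDr.
have : rs m <= sup E by apply: ub_le_sup; [case: supE | exists m].
lra.
Qed.

(* [1 - s] is a square root of [1 - a] when [s] is the limit of the iteration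
   [s' = (a + s^2) / 2]; its increments are dominated by those of the real
   iteration with [a = 1]. *)
Lemma sqrt_one_sub a : adj a = a -> nrm a <= 1 ->
  exists c, [/\ adj c = c, c * c = 1 - a, nrm (1 - c) <= 1
    & forall x, GRing.comm x a -> GRing.comm x c].
Proof.
move=> aa a1.
pose s := fix s n : C := if n is n'.+1 then (2^-1)%:C *: (a + s n' * s n') else 0.
have s_nrm n : nrm (s n) <= rs n.
  elim: n => [|n IH] /=; first by rewrite nrm0.
  rewrite nrmZr ger0_norm ?invr_ge0 // mulrC ler_pM2r ?invr_gt0 //.
  rewrite (le_trans (nrmD _ _)) // lerD // (le_trans (unrmM _ _)) // expr2.
  by rewrite ler_pM ?nrm_ge0.
have s_comm x n : GRing.comm x a -> GRing.comm x (s n).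
  move=> xa; elim: n => [|n IH] /=; first exact: commr0.
  by apply: commZ; apply: commrD => //; apply: commrM.
have s_adj n : adj (s n) = s n.
  elim: n => [|n IH] /=; first by rewrite adj0.
  by rewrite adjZr adjD aa uadjM IH.
have s_step n : nrm (s n.+1 - s n) <= rs n.+1 - rs n.
  elim: n => [|n IH].
    rewrite /= subr0 mulr0 addr0 nrmZr ger0_norm ?invr_ge0 //.
    by have := nrm_ge0 a; lra.
  (* Commuting iterates let the difference of their squares factor, so the increments obey the
     recursion of the increments of [rs]. *)
  have cs : GRing.comm (s n.+1) (s n).
    by apply: (s_comm); apply: commr_sym; apply: (s_comm).
  have -> : s n.+2 - s n.+1 = (2^-1)%:C *: ((s n.+1 + s n) * (s n.+1 - s n)).
    rewrite [s n.+2]/= {2}/s -/s -scalerBr; congr (_ *: _).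
    rewrite mulrBr !mulrDl cs; ncr.
  rewrite nrmZr ger0_norm ?invr_ge0 //.
  apply: (@le_trans _ _ (2^-1 * ((rs n.+1 + rs n) * (rs n.+1 - rs n)))).
    rewrite ler_pM2l ?invr_gt0 // (le_trans (unrmM _ _)) // ler_pM ?nrm_ge0 //.
    by rewrite (le_trans (nrmD _ _)) // lerD.
  by rewrite [rs n.+2]rsS le_eqVlt; apply/orP; left; apply/eqP; rewrite rsS; field.
have s_dist n d : nrm (s (n + d)%N - s n) <= rs (n + d) - rs n.
  elim: d => [|d IH]; first by rewrite addn0 !subrr nrm0.
  rewrite addnS -(subrK (s (n + d)%N) (s _.+1)) -addrA (le_trans (nrmD _ _)) //.
  by have := s_step (n + d)%N; lra.
have rs_le m n : (m <= n)%N -> rs m <= rs n.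
  move=> /subnKC <-; elim: (n - m)%N => [|d IH]; first by rewrite addn0.
  by rewrite addnS (le_trans IH) // rs_mono.
have [l sl] : exists l, lims s l.
  apply: cauchy_lims => e e0.
  have [N HN] := rs_cauchy (divr_gt0 e0 (ltr0Sn R 1)).
  have HN' m : (N <= m)%N -> nrm (s m - s N) <= e / 2.
    by move=> Nm; rewrite -(subnKC Nm) (le_trans (s_dist _ _)) // subnKC // HN.
  exists N => m n Nm Nn.
  have -> : s m - s n = (s m - s N) - (s n - s N) by ncr.
  by rewrite (le_trans (nrmB _ _)) // [leRHS]splitr lerD ?HN'.
have l_ n e : (forall m, (n <= m)%N -> nrm (s m - s n) <= e) -> nrm (l - s n) <= e.
  move=> se; apply/ler_addgt0Pr => d d0; have [N HN] := sl _ d0.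
  have -> : l - s n = (s (maxn n N) - s n) - (s (maxn n N) - l).
    by ncr.
  by rewrite (le_trans (nrmB _ _)) // lerD ?HN ?se ?leq_maxl ?leq_maxr.
have l1 : nrm l <= 1.
  have := @l_ 0%N 1; rewrite subr0; apply=> m _; rewrite subr0 (le_trans (s_nrm m)) //.
  by case/andP: (rs_bnd m).
have l_adj : adj l = l.
  apply: (@lims_uniq s) => // e /sl[N HN]; exists N => n /HN.
  by rewrite -[in X in X -> _]nrm_adj adjB s_adj.
have l_comm x : GRing.comm x a -> GRing.comm x l.
  move=> xa; apply/eqP; rewrite -subr_eq0; apply/eqP/nrm_small => e e0.
  have e'0 : 0 < e / (2 * nrm x + 1).
    by rewrite divr_gt0 // ltr_wpDl // mulr_ge0 // nrm_ge0.
  have [N /(_ N (leqnn _)) HN] := sl _ e'0.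
  have -> : x * l - l * x = (s N - l) * x - x * (s N - l).
    by rewrite mulrBr mulrBl (s_comm x N xa); ncr.
  rewrite (le_trans (nrmB _ _)) //.
  apply: (@le_trans _ _ (e / (2 * nrm x + 1) * (2 * nrm x))).
    have h1 := unrmM (s N - l) x; have h2 := unrmM x (s N - l).
    have := nrm_ge0 x; nra.
  rewrite mulrAC ler_pdivrMr; last by have := nrm_ge0 x; lra.
  by rewrite ler_pM2l //; lra.
have l_eq : l = (2^-1)%:C *: (a + l * l).
  apply/eqP; rewrite -subr_eq0; apply/eqP/nrm_small => e e0.
  have [N HN] := sl _ (divr_gt0 e0 (ltr0Sn R 1)).
  have h1 := HN N (leqnn _); have h2 := HN N.+1 (leqnSn _).
  have cl : GRing.comm (s N) l by apply: l_comm; apply: commr_sym; apply: s_comm.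
  (* The recursion is passed to the limit by comparing [l] with two consecutive iterates; [s N + l]
     has norm at most 2, which cancels the factor 1/2. *)
  have -> : l - (2^-1)%:C *: (a + l * l) =
     (2^-1)%:C *: ((s N - l) * (s N + l)) - (s N.+1 - l).
    rewrite [s N.+1]/= opprB addrCA; congr (_ + _).
    rewrite -scalerBr -scalerN; congr (_ *: _).
    rewrite mulrBl !mulrDr cl; ncr.
  rewrite (le_trans (nrmB _ _)) // nrmZr ger0_norm ?invr_ge0 //.
  have h3 := unrmM (s N - l) (s N + l); have h4 := nrmD (s N) l.
  have h5 := s_nrm N; have /andP[h6 h7] := rs_bnd N.
  have h8 := nrm_ge0 (s N - l); have h9 := nrm_ge0 (s N + l).
  have h10 : nrm (s N - l) * nrm (s N + l) <= e / 2 * 2 by rewrite ler_pM //; lra.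
  lra.
exists (1 - l); split.
- by rewrite adjB uadj1 l_adj.
- have l2 : l + l = a + l * l by rewrite {1 2}l_eq -scalerDr -real_halfD.
  have -> : (1 - l) * (1 - l) = 1 - (l + l) + l * l by ncr.
  by rewrite l2; ncr.
- by rewrite opprB addrC subrK.
- by move=> x /l_comm xl; apply: commrB => //; apply: commr1.
Qed.
End Unital.

(** * Positive elements *)

Lemma scale_natC (R : realType) (V : lmodType R[i]) (x : V) n :
  x *+ n = (n%:R : R)%:C *: x.
Proof. by rewrite rmorph_nat scaler_nat. Qed.

Section Positive.
Variables (R : realType) (A : unitalCStarAlgType R).
Local Notation C := (ualg A).
Local Notation "t %:U" := (t%:C *: (1 : C)) (at level 2, format "t %:U").
Implicit Types (x y a b c g h : C) (k : R[i]) (r t : R).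

(* For self-adjoint [a], the norm condition says that the spectrum of [a] lies
   in [0, 2t]. *)
Definition npos (a : C) := adj a = a /\ exists2 t, 0 <= t & nrm (t%:U - a) <= t.

Lemma npos_sa a : npos a -> adj a = a. Proof. by case. Qed.

Lemma npos0 : npos 0.
Proof. by split; [exact: adj0 | exists 0; rewrite // scale0r subrr nrm0]. Qed.

Lemma npos_real t : 0 <= t -> npos t%:U.
Proof.
move=> t0; split; first by rewrite adjZr uadj1.
by exists t; rewrite // subrr nrm0.
Qed.

Lemma npos1 : npos 1.
Proof. by have := npos_real ler01; rewrite scale1r. Qed.

Lemma nposD a b : npos a -> npos b -> npos (a + b).
Proof.
move=> [aa [t t0 at_]] [ba [s s0 bs]]; split; first by rewrite adjD aa ba.
exists (t + s); first exact: addr_ge0.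
rewrite rmorphD scalerDl opprD addrACA (le_trans (nrmD _ _)) // lerD //.
Qed.

Lemma npos_sum I (r : seq I) (P : pred I) (F : I -> C) :
  (forall i, P i -> npos (F i)) -> npos (\sum_(i <- r | P i) F i).
Proof. by move=> F0; elim/big_ind: _ => //; [exact: npos0 | exact: nposD]. Qed.

Lemma nposZ r a : 0 <= r -> npos a -> npos (r%:C *: a).
Proof.
move=> r0 [aa [t t0 at_]]; split; first by rewrite adjZr aa.
exists (r * t); first exact: mulr_ge0.
by rewrite rmorphM -scalerA -scalerBr nrmZr ger0_norm // ler_wpM2l.
Qed.

Lemma npos_sub t a : adj a = a -> nrm a <= t -> npos (t%:U - a).
Proof.
move=> aa at_; have t0 : 0 <= t := le_trans (nrm_ge0 a) at_.
split; first by rewrite adjB adjZr uadj1 aa.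
by exists t; rewrite // opprB addrC subrK.
Qed.

(** For t > 0 the bound |t - a| <= t says |1 - a/t| <= 1, so [sqrt_one_sub] gives a root of a/t,
    which is scaled by the root of t; t = 0 forces a = 0. *)
Lemma npos_sqrt a : npos a -> exists c,
  [/\ npos c, c * c = a & forall x, GRing.comm x a -> GRing.comm x c].
Proof.
move=> [aa [t]]; rewrite le_eqVlt => /orP[/eqP <-|t0 at_].
  rewrite scale0r add0r nrmN => /nrm_le0 ->; exists 0; split => //.
  - exact: npos0.
  - by rewrite mul0r.
have [||c [ca cc c1 c_comm]] := @sqrt_one_sub R A (1 - t^-1%:C *: a).
- by rewrite adjB uadj1 adjZr aa.
- have -> : 1 - t^-1%:C *: a = t^-1%:C *: (t%:U - a).
    by rewrite scalerBr scalerA -rmorphM mulVf ?gt_eqF // rmorph1 scale1r.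
  by rewrite nrmZr gtr0_norm ?invr_gt0 // mulrC ler_pdivrMr // mul1r.
have st : 0 <= Num.sqrt t by exact: sqrtr_ge0.
exists ((Num.sqrt t)%:C *: c); split.
- by apply: nposZ => //; split => //; exists 1; rewrite // rmorph1 scale1r.
- rewrite scale_real_mul -expr2 sqr_sqrtr ?ltW // cc opprB addrC subrK.
  by rewrite scalerA -rmorphM mulfV ?gt_eqF // rmorph1 scale1r.
- move=> x xa; apply: commZ; apply: c_comm; apply: commrB; first exact: commr1.
  exact: commZ.
Qed.

(** With c a root of 1 - b^2/t and d = b divided by the root of t, c and d commute and c^2 + d^2 =
    1, so [comm_sq_le] bounds c^2 by 1. *)
Lemma sq_bound b t : adj b = b -> nrm (b * b) <= t -> nrm (t%:U - b * b) <= t.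
Proof.
move=> ba bt; have := le_trans (nrm_ge0 _) bt; rewrite le_eqVlt => /orP[/eqP t0|t0].
  by move: bt; rewrite -t0 => /nrm_le0 ->; rewrite scale0r subrr nrm0.
have st0 : 0 < Num.sqrt t by rewrite sqrtr_gt0.
pose a := t^-1%:C *: (b * b).
have aa : adj a = a by rewrite adjZr uadjM ba.
have a1 : nrm a <= 1.
  by rewrite nrmZr gtr0_norm ?invr_gt0 // mulrC ler_pdivrMr // mul1r.
have [c [ca cc c1 c_comm]] := sqrt_one_sub aa a1.
pose d := (Num.sqrt t)^-1%:C *: b.
have da : adj d = d by rewrite adjZr ba.
have dd : d * d = a by rewrite scale_real_mul -invfM -expr2 sqr_sqrtr // ltW.
have cd : c * d = d * c.
  by apply/commr_sym/c_comm; rewrite -dd; apply: commrM; exact: commr_refl.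
have -> : t%:U - b * b = t%:C *: (c * c).
  by rewrite cc scalerBr scalerA -rmorphM mulfV ?gt_eqF // rmorph1 scale1r.
rewrite nrmZr gtr0_norm // ger_pMr //.
by rewrite (le_trans (comm_sq_le ca da cd)) // [c ** c]cc [d ** d]dd subrK nrm1_le1.
Qed.

Lemma npos_sq b : adj b = b -> npos (b * b).
Proof.
move=> ba; split; first by rewrite uadjM ba.
by exists (nrm (b * b)); rewrite ?nrm_ge0 ?sq_bound.
Qed.

(** Frees the existential bound in [npos]: every t above the norm works, which makes positivity
    stable under limits. *)
Lemma npos_bound a t : npos a -> nrm a <= t -> nrm (t%:U - a) <= t.
Proof. by move=> /npos_sqrt[c [/npos_sa ca <- _]]; exact: sq_bound. Qed.

Lemma npos_closed a : (forall e, 0 < e -> exists2 b, npos b & nrm (a - b) <= e) -> npos a.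
Proof.
move=> cl; have aa : adj a = a.
  apply/eqP; rewrite -subr_eq0; apply/eqP/nrm_small => e e0.
  have [b [ba _] ab] := cl _ (divr_gt0 e0 (ltr0Sn R 1)).
  have -> : adj a - a = adj (a - b) - (a - b) by rewrite adjB ba; ncr.
  by rewrite (le_trans (nrmB _ _)) // [leRHS]splitr lerD // nrm_adj.
split=> //; exists (nrm a); first exact: nrm_ge0.
apply/ler_addgt0Pr => e e0.
(* Three errors of e/4 occur: in the bound on |b|, in the shift of the scalar, and in |a - b|. *)
have [b bp ab] := cl _ (divr_gt0 e0 (ltr0Sn R 3)).
have bt : nrm b <= nrm a + e / 4.
  by rewrite -(subrK a b) addrC (le_trans (nrmD _ _)) // lerD2l nrmC.
have := npos_bound bp bt => nb.
have -> : (nrm a)%:U - a = ((nrm a + e / 4)%:U - b) - (e / 4)%:U - (a - b).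
  by rewrite rmorphD scalerDl; ncr.
rewrite (le_trans (nrmB _ _)) //.
have := nrmB ((nrm a + e / 4)%:U - b) (e / 4)%:U.
have e4 : 0 < e / 4 by rewrite divr_gt0.
have : nrm (e / 4)%:U <= e / 4 by rewrite nrmZr gtr0_norm // ger_pMr // nrm1_le1.
lra.
Qed.

Lemma npos_mul a b : npos a -> npos b -> GRing.comm a b -> npos (a * b).
Proof.
move=> /npos_sqrt[g [/npos_sa ga <- gc]] /npos_sqrt[h [/npos_sa ha <- hc]] ab.
have bg : GRing.comm (h * h) g by apply: gc; apply: commr_sym.
have gh : GRing.comm g h by apply: hc; apply: commr_sym.
have -> : g * g * (h * h) = (g * h) * (g * h) by rewrite -!mulrA; congr (_ * _); rewrite !mulrA gh.
by apply: npos_sq; rewrite uadjM ga ha gh.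
Qed.

Lemma npos_add_le a b : npos a -> npos b -> GRing.comm a b -> nrm a <= nrm (a + b).
Proof.
move=> /npos_sqrt[g [/npos_sa ga <- gc]] /npos_sqrt[h [/npos_sa ha <- hc]] ab.
apply: comm_sq_le => //.
by apply: hc; apply: commr_sym; apply: gc; apply: commr_sym.
Qed.

Lemma npos_anti a : npos a -> npos (- a) -> a = 0.
Proof.
move=> ap an; apply: nrm_le0; rewrite -(nrm0 A) -(subrr a) npos_add_le //.
by apply: commrN; exact: commr_refl.
Qed.

Lemma npos_le_nrm a t : 0 <= t -> npos a -> npos (t%:U - a) -> nrm a <= t.
Proof.
move=> t0 ap ta; apply: (@le_trans _ _ (nrm (a + (t%:U - a)))).
  apply: npos_add_le => //; apply: commrB; last exact: commr_refl.
  by apply: commZ; exact: commr1.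
by rewrite addrC subrK nrmZr ger0_norm // ler_piMr // nrm1_le1.
Qed.

(** Bernoulli's inequality with a commuting weight [g]. If the norms of g (1+u)^n stay bounded in n,
    it forces g u = 0; both contradictions of the next section have this form. *)
Lemma bernoulli_npos g (u : C) n : npos g -> npos u -> GRing.comm g u ->
  npos (g * (1 + u) ^+ n - (g * u) *+ n).
Proof.
move=> gp up gu.
have c1u x : GRing.comm x u -> GRing.comm x ((1 + u) ^+ n).
  by move=> xu; apply: commrX; apply: commrD; [exact: commr1|].
have E_ge1 m : npos ((1 + u) ^+ m - 1).
  elim: m => [|m IH]; first by rewrite expr0 subrr; exact: npos0.
  have cE : GRing.comm ((1 + u) ^+ m) u.
    by apply: commr_sym; apply: commrX; apply: commrD; [exact: commr1|exact: commr_refl].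
  have -> : (1 + u) ^+ m.+1 - 1 = ((1 + u) ^+ m - 1) + (1 + u) ^+ m * u.
    by rewrite exprSr; ncr.
  apply: nposD => //; apply: npos_mul => //.
  by rewrite -(subrK 1 (_ ^+ m)); apply: nposD => //; exact: npos1.
elim: n {c1u} => [|n IH].
  by rewrite expr0 mulr1 mulr0n subr0.
have -> : g * (1 + u) ^+ n.+1 - (g * u) *+ n.+1
  = (g * (1 + u) ^+ n - (g * u) *+ n) + g * ((1 + u) ^+ n - 1) * u.
  by rewrite exprSr mulrSr; ncr.
have cE x : GRing.comm x u -> GRing.comm x ((1 + u) ^+ n - 1).
  by move=> xu; apply: commrB; [apply: commrX; apply: commrD|]; do ?exact: commr1.
apply: nposD => //; apply: npos_mul => //.
  by apply: npos_mul => //; exact: cE.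
apply: commr_sym; apply: commrM; first exact: commr_sym.
by apply: cE; exact: commr_refl.
Qed.

(** Positivity is defined in the unital algebra [A] only. The inequality is carried to [A'] by
    writing n g u and the remainder as squares of commuting self-adjoint elements, whose images
    satisfy [comm_sq_le]. *)
Lemma bernoulli_nrm (A' : cstarAlgType R) (f : A -> A') g (u : C) n :
  star_hom f -> npos g -> npos u -> GRing.comm g u ->
  n%:R * nrm (f (g * u)) <= nrm (f (g * (1 + u) ^+ n)).
Proof.
move=> [fL fM fA] gp up gu.
have fD := linD fL; have f0 := lin0 fL.
have fMn x : f (x *+ n) = f x *+ n.
  by elim: n => [|m IH]; rewrite ?mulr0n ?f0 // !mulrS fD IH.
have guc : GRing.comm (g * u) (g * (1 + u) ^+ n).
  apply: commr_sym; apply: commrM; apply: commr_sym; apply: commrM.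
  - exact: commr_refl.
  - by apply: commrX; apply: commrD; [exact: commr1|].
  - exact: commr_sym.
  - by apply: commrX; apply: commrD; [exact: commr1|exact: commr_refl].
have gnp : npos ((g * u) *+ n).
  by rewrite scale_natC; apply: nposZ => //; exact: npos_mul.
have /npos_sqrt[s [/npos_sa sa ss sc]] := gnp.
have /npos_sqrt[h [/npos_sa ha hh hc]] := bernoulli_npos n gp up gu.
have sh : s * h = h * s.
  apply/hc/commr_sym/sc/commr_sym; rewrite scale_natC.
  apply: commr_sym; apply: commZ; apply: commr_sym.
  apply: commrB => //; apply: commZ; exact: commr_refl.
have := @comm_sq_le R A' (f s) (f h).
rewrite -!fA sa ha -!fM [s ** h]sh => /(_ erefl erefl erefl).
rewrite -fD [s ** s]ss [h ** h]hh addrC subrK fMn scale_natC.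
by rewrite nrmZr ger0_norm ?ler0n.
Qed.

End Positive.

(** * Kaplansky's theorem and the uniqueness of the norm *)

Section Kaplansky.
Variables (R : realType) (A : unitalCStarAlgType R).
Local Notation C := (ualg A).
Local Notation "t %:U" := (t%:C *: (1 : C)) (at level 2, format "t %:U").
Implicit Types (x y a b c g h : C) (k : R[i]) (r t : R).

Lemma half_half x y : x = y + y -> (2^-1)%:C *: x = y.
Proof. by move=> ->; rewrite -real_halfD. Qed.

(* [q] is twice the negative part of [a]. *)
Lemma negative_part a : adj a = a -> exists q d : C,
  [/\ adj q = q, adj d = d, d * q = q * d, d * d * q = q * q &
      [/\ q * a = - ((2^-1)%:C *: (q * q)), a * q = q * a & (q = 0 -> npos a)]].
Proof.
(* Here c = |a|, q = |a| - a, and d is a root of 2|a|; from |a|^2 = a^2 follow d^2 q = q^2 and q a =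
   - q^2 / 2. *)
move=> aa; have /npos_sqrt[c [cp cc c_comm]] := npos_sq aa.
have ca : GRing.comm a c by apply: c_comm; apply: commrM; exact: commr_refl.
have /npos_sqrt[d [/npos_sa da dd d_comm]] := nposD cp cp.
exists (c - a), d.
have cad x : GRing.comm x c -> GRing.comm x d by move=> xc; apply: d_comm; apply: commrD.
have dq : GRing.comm (c - a) d.
  by apply: cad; apply: commr_sym; apply: commrB; [exact: commr_refl|apply: commr_sym].
have qa : GRing.comm a (c - a) by apply: commrB => //; exact: commr_refl.
split=> //.
- by rewrite adjB aa (npos_sa cp).
- have -> : (c - a) * (c - a) = (c + c) * (c - a) - (c * c - a * a) + (c * a - a * c) by ncr.
  by rewrite dd cc subrr subr0 ca subrr addr0.
split=> //.
- apply/esym/(@addIr _ ((2^-1)%:C *: ((c - a) * (c - a)))).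
  rewrite addNr; apply/esym/eqP; rewrite addrC; rewrite addr_eq0; apply/eqP.
  rewrite (@half_half _ (- ((c - a) * a))) ?opprK //.
  have -> : (c - a) * (c - a) = - ((c - a) * a) - ((c - a) * a) + (c * c - a * a) - (a * c - c * a)
    by ncr.
  by rewrite cc subrr addr0 ca subrr subr0.
- by move=> /eqP; rewrite subr_eq0 => /eqP <-.
Qed.

(** Exhibits q^3 as the square of the self-adjoint element d q, hence as a positive element,
    although q itself is not yet known to be positive. *)
Lemma cubeE (q d : C) : d * q = q * d -> d * d * q = q * q ->
  (d * q) * (d * q) = q * q * q.
Proof. by move=> dq ddq; rewrite {1}dq -!mulrA [d * (d * q)]mulrA ddq. Qed.

Lemma cube_eq0 (q d : C) : adj q = q -> adj d = d -> d * q = q * d -> d * d * q = q * q ->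
  (d * q) * (d * q) = 0 -> q = 0.
Proof.
move=> qa da dq ddq /sq_eq0 dq0; apply: sq_eq0 => //.
by rewrite -ddq -mulrA dq0 ?mulr0 // uadjM qa da dq.
Qed.

(** The Cartesian parts of z, up to scalars: z z^* + z^* z is half a sum of squares, so z z^* is
    positive as soon as - z^* z is. *)
Lemma cart_sq (z : C) : exists h l : C, [/\ adj h = h, adj l = l &
  h * h + l * l = (z * adj z + adj z * z) + (z * adj z + adj z * z)].
Proof.
exists (z + adj z), ('i *: (z - adj z)); split.
- by rewrite adjD adjK addrC.
- by rewrite adjZi adjB adjK -scalerN opprB.
- rewrite -cscaleAl -cscaleAr scalerA (_ : 'i * 'i = -1); last by rewrite -expr2 sqr_i.
  by rewrite scaleN1r; ncr.
Qed.

(* If [z* z <= 0], then [w = z z*] satisfies [w z = - z p] with [p = - z* z],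
   so [z (1 - p/N)^n z* = (1 + w/N)^n w] is bounded in [n] and [w = 0]. *)
Lemma npos_opp_gram (z : C) : npos (- (adj z * z)) -> z = 0.
Proof.
set p := - (adj z * z) => pp.
have wp : npos (z * adj z).
  have [h [k [ha ka hk]]] := cart_sq z.
  have -> : z * adj z = (2^-1)%:C *: (h * h + k * k) + p.
    by rewrite hk -real_halfD /p; ncr.
  apply: nposD => //; apply: nposZ; first by rewrite invr_ge0.
  by apply: nposD; exact: npos_sq.
set w := z * adj z in wp.
pose N := nrm p + 1.
have N0 : 0 < N by rewrite ltr_wpDl // nrm_ge0.
pose e := 1 - N^-1%:C *: p; pose u := N^-1%:C *: w.
have ze : z * e = (1 + u) * z.
  rewrite mulrBr mulr1 mulrDl mul1r -cscaleAl -cscaleAr -scalerN; congr (_ + _ *: _).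
  by rewrite /p /w; ncr.
have zen n : z * e ^+ n = (1 + u) ^+ n * z.
  elim: n => [|n IH]; first by rewrite !expr0 mulr1 mul1r.
  by rewrite exprSr mulrA IH -mulrA ze mulrA -exprSr.
have e1 : nrm e <= 1.
  have -> : e = N^-1%:C *: (N%:U - p).
    by rewrite scalerBr scalerA -rmorphM mulVf ?gt_eqF // rmorph1 scale1r.
  rewrite nrmZr gtr0_norm ?invr_gt0 // mulrC ler_pdivrMr // mul1r.
  by apply: npos_bound => //; rewrite /N lerDl.
have en n : nrm (e ^+ n) <= 1.
  elim: n => [|n IH]; first by rewrite expr0 nrm1_le1.
  rewrite exprS (le_trans (unrmM _ _)) // -(mulr1 1).
  by rewrite ler_pM ?nrm_ge0.
have up : npos u by apply: nposZ; rewrite // ltW // invr_gt0.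
have wu : GRing.comm w u by apply: commZ; exact: commr_refl.
have star_id : star_hom (@id A) by [].
have bound n : n%:R * nrm (w * u) <= nrm z ^+ 2.
  apply: le_trans (bernoulli_nrm n star_id wp up wu) _.
  have -> : w * (1 + u) ^+ n = z * e ^+ n * adj z.
    rewrite zen -mulrA -/w; apply: commrX; apply: commrD => //; exact: commr1.
  rewrite (le_trans (unrmM _ _)) // nrm_adj expr2 ler_wpM2r ?nrm_ge0 //.
  by rewrite (le_trans (unrmM _ _)) // ler_piMr ?nrm_ge0.
have wu0 : nrm (w * u) <= 0.
  rewrite leNgt; apply/negP => wu0.
  have := bound (Num.truncn (nrm z ^+ 2 / nrm (w * u))).+1.
  apply/negP; rewrite -ltNge -ltr_pdivrMr //.
  exact: truncnS_gt.
have : w * u = N^-1%:C *: (w * w) by rewrite cscaleAr.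
rewrite (nrm_le0 wu0) => /esym/eqP; rewrite scaler_eq0 => /orP[|/eqP ww0].
  by rewrite eq_complex /= invr_eq0 gt_eqF.
have w0 : w = 0 by apply: sq_eq0 => //; exact: npos_sa.
apply/(can_inj (@adjK R A)); rewrite adj0; apply: nrm0_eq0; apply/eqP.
by rewrite -sqrf_eq0 -nrm_cstar adjK [z ** adj z]w0 nrm0.
Qed.

(** If q is twice the negative part of y^* y, then z = y q has z^* z = - q^3 / 2, so z = 0 by
    [npos_opp_gram], and q^3 = 0 gives q = 0. *)
Lemma npos_gram (y : C) : npos (adj y * y).
Proof.
set a := adj y * y; have aa : adj a = a by rewrite uadjM adjK.
have [q [d [qa da dq ddq [qaE aq q0]]]] := negative_part aa.
pose z := y * q.
have zz : adj z * z = - ((2^-1)%:C *: ((d * q) * (d * q))).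
  rewrite uadjM qa -!mulrA (mulrA (adj y)) -/a mulrA qaE mulNr -cscaleAl; congr (- (_ *: _)).
  by rewrite [RHS]mulrA cubeE.
have dqp : npos ((d * q) * (d * q)) by apply: npos_sq; rewrite uadjM qa da dq.
have z0 : z = 0.
  apply: npos_opp_gram; rewrite zz opprK; apply: nposZ => //; by rewrite invr_ge0.
apply: q0; apply: (@cube_eq0 q d) => //.
move: zz; rewrite z0 mulr0 => /esym/eqP; rewrite oppr_eq0 scaler_eq0 => /orP[|/eqP //].
by rewrite eq_complex /= invr_eq0 pnatr_eq0.
Qed.

(* Both norms are C*-norms on [A], and [A] is complete for the first one. If
   [|f h| <= 1 < |h|] with [h] self-adjoint, the negative part [q] of [1 - h^2]
   satisfies [q h^2 = q (1 + q / 2)], whose powers are unbounded along [f]. *)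
Lemma injective_star_hom_nrm (A' : cstarAlgType R) (f : A -> A') :
  star_hom f -> injective f -> forall x : A, nrm x <= nrm (f x).
Proof.
move=> sf f_inj; have [fL fM fA] := sf.
have f0 := lin0 fL; have fZ := linZ fL.
have sa1 (h : C) : adj h = h -> nrm (f h) <= 1 -> nrm h <= 1.
  move=> ha fh1; have ba : adj (1 - h * h) = 1 - h * h by rewrite adjB uadj1 uadjM ha.
  have [q [d [qa da dq ddq [qbE bq q0]]]] := negative_part ba.
  pose u := (2^-1)%:C *: (d * d).
  have hq : GRing.comm (h * h) q.
    have -> : h * h = 1 - (1 - h * h) by ncr.
    by apply: commr_sym; apply: commrB; [exact: commr1|exact: commr_sym].
  have qhh : q * (h * h) = q * (1 + u).
    have -> : q * (h * h) = q - q * (1 - h * h) by ncr.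
    rewrite qbE opprK mulrDr mulr1 -cscaleAr -ddq; congr (_ + _ *: _).
    by rewrite mulrA -dq -!mulrA dq.
  pose g := (d * q) * (d * q).
  have gE : g = q * q * q by exact: cubeE.
  have gp : npos g by apply: npos_sq; rewrite uadjM qa da dq.
  have up : npos u by apply: nposZ; [rewrite invr_ge0|exact: npos_sq].
  have uq : GRing.comm u q.
    by apply: commr_sym; apply: commZ; apply: commrM; exact/commr_sym.
  have gu : GRing.comm g u.
    by apply: commr_sym; rewrite gE; do ! apply: commrM.
  have ghh : g * (1 + u) = g * (h * h) by rewrite gE -!(mulrA (q * q)) qhh.
  have gh : GRing.comm (h * h) g by rewrite gE; do ! apply: commrM.
  have ghn n : g * (1 + u) ^+ n = g * (h * h) ^+ n.
    elim: n => [|n IH]; first by rewrite !expr0.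
    by rewrite !exprS [LHS]mulrA ghh -gh -[LHS]mulrA IH [LHS]mulrA [RHS]mulrA gh.
  have bound n : nrm (f (g * (h * h) ^+ n)) <= nrm (f g).
    elim: n => [|n IH]; first by rewrite expr0 mulr1.
    rewrite exprSr mulrA [f _]fM (le_trans (nrmM _ _)) // -(mulr1 (nrm (f g))).
    rewrite ler_pM ?nrm_ge0 // [f _]fM -{1}ha fA nrm_cstar.
    by rewrite expr_le1 // nrm_ge0.
  have gu0 : g * u = 0.
    apply: f_inj; rewrite f0; apply: nrm_le0; rewrite leNgt; apply/negP => gu0.
    have := le_trans (bernoulli_nrm (Num.truncn (nrm (f g) / nrm (f (g * u)))).+1 sf gp up gu).
    move=> /(_ (nrm (f g))); rewrite ghn bound => /(_ isT).
    by apply/negP; rewrite -ltNge -ltr_pdivrMr // truncnS_gt.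
  have qq : adj (q * q) = q * q by rewrite uadjM qa.
  have : g * u = (2^-1)%:C *: ((q * q) * (q * q)).
    have qdd : q * (d * d) = q * q by rewrite -ddq mulrA -dq -!mulrA dq.
    by rewrite -cscaleAr gE -(mulrA (q * q)) qdd.
  rewrite gu0 => /esym/eqP; rewrite scaler_eq0 => /orP[|/eqP /(sq_eq0 qq)/(sq_eq0 qa) /q0].
    by rewrite eq_complex /= invr_eq0 pnatr_eq0.
  rewrite -[X in X - _]scale1r => /(npos_le_nrm ler01 (npos_sq ha)).
  by rewrite nrm_sa // expr_le1 // nrm_ge0.
have sa (a : C) : adj a = a -> nrm a <= nrm (f a).
  move=> aa; have := nrm_ge0 (f a); rewrite le_eqVlt => /orP[/eqP fa0|fa0].
    by have /f_inj -> : f a = f 0; rewrite ?f0 ?nrm0 //; apply: nrm0_eq0.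
  have := sa1 ((nrm (f a))^-1%:C *: a).
  rewrite adjZr aa fZ !nrmZr gtr0_norm ?invr_gt0 // mulVf ?gt_eqF // => /(_ erefl (lexx _)).
  by rewrite mulrC ler_pdivrMr // mul1r.
move=> x; rewrite -(@ler_pXn2r _ 2) ?nnegrE ?nrm_ge0 //.
by rewrite -!nrm_cstar -fA -fM sa // adjM adjK.
Qed.
End Kaplansky.

(** * Operators on pre-Hilbert modules *)

(** All laws are stated under the inner product, that is, modulo null vectors; lists of formal terms
    can thus be a carrier without forming a quotient. *)
Record preHilb (R : realType) (B : unitalCStarAlgType R) := PreHilb {
  hcar :> Type;
  ip : hcar -> hcar -> ualg B;
  hlin : R[i] -> hcar -> hcar -> hcar;
  hact : hcar -> ualg B -> hcar;
  ip_lin : forall k x y z, ip x (hlin k y z) = k *: ip x y + ip x z;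
  ip_act : forall x y b, ip x (hact y b) = ip x y * b;
  ip_adj : forall x y, adj (ip x y) = ip y x;
  ip_pos : forall x, npos (ip x x) }.

Section Forms.
Variables (R : realType) (B : unitalCStarAlgType R) (H : preHilb B).
Local Notation C := (ualg B).
Implicit Types (x y z : H) (k : R[i]) (c d e : R) (t s : H -> H -> C).

Lemma ip_linl k x y z : ip (hlin k x y) z = Num.conj k *: ip x z + ip y z.
Proof. by rewrite -ip_adj ip_lin adjD cadjZ !ip_adj. Qed.

Lemma ip_actl x b y : ip (hact x b) y = adj b * ip x y.
Proof. by rewrite -ip_adj ip_act uadjM ip_adj. Qed.

(** The inner [hlin (-1) x x] plays the zero vector, for which the record has no field. *)
Definition hscale k x : H := hlin k x (hlin (-1) x x).
Lemma ip_scale k x y : ip x (hscale k y) = k *: ip x y.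
Proof. by rewrite !ip_lin scaleN1r addNr addr0. Qed.
Lemma ip_scalel k x y : ip (hscale k x) y = Num.conj k *: ip x y.
Proof. by rewrite -ip_adj ip_scale cadjZ ip_adj. Qed.

Definition sesq t :=
  (forall k x y z, t x (hlin k y z) = k *: t x y + t x z) /\
  (forall k x y z, t (hlin k x y) z = Num.conj k *: t x z + t y z).

Lemma sesq_scaler t k x y : sesq t -> t x (hscale k y) = k *: t x y.
Proof. by move=> [tr _]; rewrite !tr scaleN1r addNr addr0. Qed.
Lemma sesq_scalel t k x y : sesq t -> t (hscale k x) y = Num.conj k *: t x y.
Proof. by move=> [_ tl]; rewrite !tl rmorphN1 scaleN1r addNr addr0. Qed.

(* Positivity of the block matrix [[c, t], [t*, c]]: the form [t] is given by an
   operator of norm at most [c]. *)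
Definition bnd t c := forall x y,
  npos (c%:C *: ip x x + c%:C *: ip y y + t x y + adj (t x y)).

Lemma bnd_ext t s c : t =2 s -> bnd t c -> bnd s c.
Proof. by move=> ts bt x y; rewrite -ts. Qed.

Lemma bnd_le t c d : bnd t c -> c <= d -> bnd t d.
Proof.
move=> tc cd x y; rewrite -(subrK c d) rmorphD !scalerDl.
have -> : (d - c)%:C *: ip x x + c%:C *: ip x x + ((d - c)%:C *: ip y y + c%:C *: ip y y)
   + t x y + adj (t x y) = (d - c)%:C *: ip x x + (d - c)%:C *: ip y y +
  (c%:C *: ip x x + c%:C *: ip y y + t x y + adj (t x y)) by ncr.
by apply: nposD (tc x y); apply: nposD; apply: nposZ; rewrite ?subr_ge0 //; exact: ip_pos.
Qed.

Lemma bndD t s c d : bnd t c -> bnd s d -> bnd (fun x y => t x y + s x y) (c + d).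
Proof.
move=> tc sd x y; have := nposD (tc x y) (sd x y); congr npos.
by rewrite rmorphD !scalerDl adjD; ncr.
Qed.

Lemma bnd0 : bnd (fun _ _ => 0) 0.
Proof. by move=> x y; rewrite !scale0r adj0 !addr0; exact: npos0. Qed.

(** Rescaling the two vectors by the root of r and its inverse leaves [t x y] alone and trades
    weight between the diagonal terms. *)
Lemma bnd_scale t c r x y : sesq t -> bnd t c -> 0 < r ->
  npos ((c * r)%:C *: ip x x + (c / r)%:C *: ip y y + t x y + adj (t x y)).
Proof.
move=> st tc r0; have := tc (hscale (Num.sqrt r)%:C x) (hscale (Num.sqrt r)^-1%:C y).
have sr : Num.sqrt r != 0 by rewrite gt_eqF ?sqrtr_gt0.
have conjr (a : R) : Num.conj a%:C = a%:C :> R[i] by exact: conjc_real.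
rewrite !ip_scale !ip_scalel sesq_scaler // sesq_scalel // !scalerA !conjr -!rmorphM.
congr npos; rewrite -!mulrA -invfM -!expr2 sqr_sqrtr ?ltW // mulVf //.
by rewrite rmorph1 !scale1r.
Qed.

Lemma mul_conj_normc k : k * Num.conj k = (Normc.normc k ^+ 2)%:C.
Proof.
case: k => a b; rewrite /Normc.normc sqr_sqrtr ?addr_ge0 ?sqr_ge0 //.
apply/eqP; rewrite eq_complex /=; apply/andP; split; apply/eqP; ring.
Qed.

Lemma bndZ t c k : sesq t -> bnd t c -> bnd (fun x y => k *: t x y) (Normc.normc k * c).
Proof.
move=> st tc; have [->|k0] := eqVneq k 0.
  rewrite Normc.normc0 mul0r; apply: bnd_ext bnd0 => x y; by rewrite scale0r.
set n := Normc.normc k; have n0 : 0 < n.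
  rewrite lt_def normc_ge0 andbT; apply: contraNneq k0 => /Normc.eq0_normc ->; exact: eqxx.
(* Replacing x by conj(k) x puts k before [t x y] and |k|^2 before [ip x x]; the weight r = 1/|k|
   makes both diagonal coefficients |k| c. The middle vector argument is then instantiated at y. *)
move=> x y; have := bnd_scale (hscale (Num.conj k) x) y st tc (r := n^-1).
rewrite invr_gt0 n0 => /(_ isT).
have -> : ip (hscale (Num.conj k) x) (hscale (Num.conj k) x) = (n ^+ 2)%:C *: ip x x.
  by rewrite ip_scale ip_scalel scalerA conjCK mulrC mul_conj_normc.
rewrite sesq_scalel // conjCK invrK scalerA -rmorphM [c * n]mulrC.
by rewrite (_ : c * n^-1 * n ^+ 2 = n * c) //; field; rewrite gt_eqF.
Qed.

Lemma bnd_adj t c : bnd t c -> bnd (fun x y => adj (t y x)) c.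
Proof. by move=> tc x y; have := tc y x; congr npos; rewrite adjK; ncr. Qed.

Lemma bnd_closed t c : (forall e, 0 < e -> bnd t (c + e)) -> bnd t c.
Proof.
move=> tc x y; apply: npos_closed => e e0.
pose K := nrm (ip x x) + nrm (ip y y).
have K0 : 0 <= K by rewrite addr_ge0 ?nrm_ge0.
have d0 : 0 < e / (K + 1) by rewrite divr_gt0 // ltr_wpDl.
exists ((c + e / (K + 1))%:C *: ip x x + (c + e / (K + 1))%:C *: ip y y + t x y + adj (t x y)).
  exact: tc.
rewrite rmorphD !scalerDl; set d := e / (K + 1) in d0 *.
have -> : c%:C *: ip x x + c%:C *: ip y y + t x y + adj (t x y) -
   (c%:C *: ip x x + d%:C *: ip x x + (c%:C *: ip y y + d%:C *: ip y y) +
    t x y + adj (t x y)) = - (d%:C *: (ip x x + ip y y)) by rewrite scalerDr; ncr.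
rewrite nrmN nrmZr gtr0_norm // /d mulrAC ler_pdivrMr ?ltr_wpDl // ler_pM2l //.
by rewrite (le_trans (nrmD _ _)) // -/K lerDl.
Qed.

(** Let h = t x y + adj (t x y) and let Q be the diagonal part. Changing the sign of x gives -Q <= h
    <= Q, hence |Q + h| <= 2cK and |h| <= 3cK. The same bound for i t controls the other Cartesian
    part. *)
Lemma bnd_point t c x y : sesq t -> 0 <= c -> bnd t c ->
  nrm (t x y) <= 3 * c * (nrm (ip x x) + nrm (ip y y)).
Proof.
move=> st c0 tc; set K := _ + _.
have K0 : 0 <= K by rewrite addr_ge0 ?nrm_ge0.
have key s : sesq s -> bnd s c -> nrm (s x y + adj (s x y)) <= 3 * c * K.
  move=> ss sc; set h := s x y + adj (s x y).
  pose Q := c%:C *: ip x x + c%:C *: ip y y.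
  have Qp : npos Q by apply: nposD; apply: nposZ => //; exact: ip_pos.
  have QK : nrm Q <= c * K.
    by rewrite /Q -scalerDr nrmZr ger0_norm // ler_wpM2l // nrmD.
  have p1 : npos (Q + h) by have := sc x y; rewrite -addrA.
  have p2 : npos (Q - h).
    have := sc (hscale (-1) x) y.
    rewrite ip_scale ip_scalel sesq_scalel // rmorphN1 !scaleN1r opprK adjN -addrA.
    by rewrite /h opprD.
  have nQh : nrm (Q + h) <= 2 * (c * K).
    apply: npos_le_nrm => //; first by rewrite !mulr_ge0.
    have -> : (2 * (c * K))%:C *: (1 : C) - (Q + h) =
       (2%:C *: ((c * K)%:C *: (1 : C) - Q)) + (Q - h).
      rewrite scalerBr scalerA -rmorphM (_ : 2%:C *: Q = Q + Q); first by ncr.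
      by rewrite -mulr2n scale_natC.
    apply: nposD => //; apply: nposZ => //; apply: npos_sub => //; exact: npos_sa.
  have -> : h = (Q + h) - Q by ncr.
  rewrite (le_trans (nrmB _ _)) //; lra.
have s1 := key t st tc.
have st' : sesq (fun x y => 'i *: t x y).
  by case: st => sr sl; split=> k u v w; rewrite ?sr ?sl scalerDr !scalerA mulrC.
have ni : Normc.normc 'i%C = 1 :> R by rewrite /Normc.normc /= expr0n expr1n /= add0r sqrtr1.
have s2 := key _ st'; move: s2.
have := bndZ 'i%C st tc; rewrite ni mul1r => ic /(_ ic).
rewrite adjZi -scalerBr nrmZi => s2.
rewrite [t x y]real_halfD.
have -> : t x y + t x y = (t x y + adj (t x y)) + (t x y - adj (t x y)) by ncr.
rewrite nrmZr ger0_norm ?invr_ge0 // mulrC ler_pdivrMr //.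
rewrite (le_trans (nrmD _ _)) //; lra.
Qed.
End Forms.

(** * Adjointable operators, bounded as forms *)

Section Operators.
Variables (R : realType) (B : unitalCStarAlgType R) (H : preHilb B).
Local Notation C := (ualg B).
Implicit Types (x y z : H) (k : R[i]) (c d e : R).

Definition opform (f : H -> H) : H -> H -> C := fun x y => ip x (f y).

(** The adjoint is part of the data: by [opP] it makes [opform] sesquilinear, which is linearity of
    the map modulo null vectors. *)
Record op := Op {
  opf :> H -> H;
  opa : H -> H;
  opP : forall x y, ip (opa x) y = ip x (opf y);
  op_bnd : exists2 c, 0 <= c & bnd (opform opf) c }.

Implicit Types T S : op.

Lemma opform_sesq T : sesq (opform T).
Proof.
split=> k x y z; rewrite /opform; last exact: ip_linl.
by rewrite -opP ip_lin !opP.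
Qed.

Lemma opform_adj T x y : opform (opa T) x y = adj (opform T y x).
Proof. by rewrite /opform -[LHS]ip_adj opP. Qed.

Fact op1_bnd : exists2 c, 0 <= c & bnd (opform id) c.
Proof.
exists 1 => // x y; rewrite !scale1r.
have := ip_pos (hlin 1 x y); rewrite !ip_lin !ip_linl rmorph1 !scale1r.
by congr npos; rewrite /opform ip_adj; ncr.
Qed.
Definition op1 : op := @Op id id (fun _ _ => erefl) op1_bnd.

Fact op_lin_adj k T S x y :
  ip (hlin (Num.conj k) (opa T x) (opa S x)) y = ip x (hlin k (T y) (S y)).
Proof. by rewrite ip_linl ip_lin conjCK !opP. Qed.
Fact op_lin_bnd k T S :
  exists2 c, 0 <= c & bnd (opform (fun x => hlin k (T x) (S x))) c.
Proof.
have [c c0 Tc] := op_bnd T; have [d d0 Sd] := op_bnd S.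
exists (Normc.normc k * c + d); first by rewrite addr_ge0 ?mulr_ge0 ?normc_ge0.
apply: bnd_ext (bndD (bndZ k (opform_sesq T) Tc) Sd) => x y.
by rewrite /opform ip_lin.
Qed.
Definition op_lin k T S : op := Op (op_lin_adj k T S) (op_lin_bnd k T S).

Fact op_adj_adj T x y : ip (T x) y = ip x (opa T y).
Proof. by rewrite -ip_adj -opP ip_adj. Qed.
Fact op_adj_bnd T : exists2 c, 0 <= c & bnd (opform (opa T)) c.
Proof.
have [c c0 Tc] := op_bnd T; exists c => //.
by apply: bnd_ext (bnd_adj Tc) => x y; rewrite opform_adj.
Qed.
Definition op_adj T : op := Op (op_adj_adj T) (op_adj_bnd T).

(* [c^2 - f* f >= 0] as quadratic forms, for [f] with formal adjoint [fa]. *)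
Lemma bnd_of_gram (f fa : H -> H) c : (forall x y, ip (fa x) y = ip x (f y)) ->
  0 < c -> (forall x, npos ((c ^+ 2)%:C *: ip x x - ip (f x) (f x))) -> bnd (opform f) c.
Proof.
move=> fP c0 gram x y.
have b1 := bnd_scale x (f y) (opform_sesq op1) (_ : bnd (opform op1) 1) c0.
have /b1 : bnd (opform op1) 1.
  move=> u v; have := ip_pos (hlin 1 u v); rewrite !ip_lin !ip_linl rmorph1 !scale1r.
  by congr npos; rewrite /opform ip_adj; ncr.
rewrite !mul1r => b2.
have ci : 0 <= c^-1 by rewrite invr_ge0 ltW.
have := nposD b2 (nposZ ci (gram y)); congr npos.
rewrite scalerBr scalerA -rmorphM (_ : c^-1 * c ^+ 2 = c); last by field; rewrite gt_eqF.
by rewrite /opform; ncr.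
Qed.

Lemma gram_of_bnd T c : 0 < c -> bnd (opform T) c ->
  forall x, npos ((c ^+ 2)%:C *: ip x x - ip (T x) (T x)).
Proof.
(* For fixed y the block form is least at x = - T y / c, where its value is c <y,y> - <Ty,Ty> /
   c. *)
move=> c0 Tc y; have := Tc (hscale (- c^-1)%:C (T y)) y.
have conjr (a : R) : Num.conj a%:C = a%:C :> R[i] by exact: conjc_real.
rewrite ip_scale !ip_scalel /opform ip_scalel !conjr adjZr ip_adj => /(nposZ (ltW c0)).
congr npos; rewrite !scalerDr !scalerA -!rmorphM.
rewrite (_ : c * c * - c^-1 * - c^-1 = 1); last by field; rewrite gt_eqF.
rewrite (_ : c * - c^-1 = -1) ; last by field; rewrite gt_eqF.
rewrite rmorphN /= !rmorph1 !scaleN1r scale1r expr2.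
by ncr.
Qed.

Lemma bnd_mul T S c d : 0 < c -> 0 < d -> bnd (opform T) c -> bnd (opform S) d ->
  bnd (opform (T \o S)) (c * d).
Proof.
move=> c0 d0 Tc Sd.
apply: (@bnd_of_gram _ (opa S \o opa T)); first by move=> x y /=; rewrite !opP.
  exact: mulr_gt0.
move=> x; have := nposD (gram_of_bnd c0 Tc (S x)) (nposZ (sqr_ge0 c) (gram_of_bnd d0 Sd x)).
by congr npos; rewrite exprMn scalerBr scalerA -rmorphM /=; ncr.
Qed.

Fact op_mul_adj T S x y : ip ((opa S \o opa T) x) y = ip x ((T \o S) y).
Proof. by rewrite /= !opP. Qed.
Fact op_mul_bnd T S : exists2 c, 0 <= c & bnd (opform (T \o S)) c.
Proof.
have [c c0 Tc] := op_bnd T; have [d d0 Sd] := op_bnd S.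
exists ((c + 1) * (d + 1)); first by rewrite mulr_ge0 // addr_ge0.
by apply: bnd_mul; rewrite ?ltr_wpDl //; [apply: bnd_le Tc _ | apply: bnd_le Sd _]; rewrite lerDl.
Qed.
Definition op_mul T S : op := Op (op_mul_adj T S) (op_mul_bnd T S).

(** The source of the C*-identity: the bound on T^* T, tested at the pair -x, x, reads 2 c <x,x> - 2
    <Tx,Tx> >= 0. *)
Lemma bnd_of_sq T c : 0 < c -> bnd (opform (op_mul (op_adj T) T)) c ->
  bnd (opform T) (Num.sqrt c).
Proof.
move=> c0 TTc; apply: (@bnd_of_gram T (opa T)); [exact: opP | by rewrite sqrtr_gt0 |].
move=> x; rewrite sqr_sqrtr ?ltW //.
have := TTc (hscale (-1) x) x; rewrite ip_scale !ip_scalel sesq_scalel; last exact: opform_sesq.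
rewrite /opform /= -op_adj_adj => h.
have h2 : (0 : R) <= 2^-1 by rewrite invr_ge0.
have := nposZ h2 h; congr npos.
rewrite rmorphN1 !scaleN1r opprK -[RHS](half_half (erefl)) adjN ip_adj; congr (_ *: _).
by ncr.
Qed.

(** The completion of the adjointable operators. On a module that is not complete a limit may have
    no underlying map, but its form exists; comparing forms also identifies operators that agree
    modulo null vectors. *)
Record lop := Lop {
  lopf :> H -> H -> C;
  lop_sesq : sesq lopf;
  lop_appr : forall e, 0 < e -> exists T, bnd (fun x y => lopf x y - opform T x y) e }.

Lemma lop_eq (s t : lop) : s =2 t -> s = t.
Proof.
case: s t => f fs fa [g gs ga] /= fg.
have E : f = g by apply: functional_extensionality_dep => x; apply: functional_extensionality_dep.
by subst g; congr Lop; exact: Prop_irrelevance.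
Qed.
End Operators.

(** * The Banach space of limit forms *)

Section LopModule.
Variables (R : realType) (B : unitalCStarAlgType R) (H : preHilb B).
Local Notation C := (ualg B).
Local Notation L := (lop H).
Implicit Types (x y z : H) (k : R[i]) (c d e : R) (s t : L) (T S : op H).

Lemma sesq_lin (f g : H -> H -> C) k : sesq f -> sesq g ->
  sesq (fun x y => k *: f x y + g x y).
Proof.
move=> [fr fl] [gr gl]; split=> l x y z; rewrite ?fr ?fl ?gr ?gl !scalerDr !scalerA.
  by rewrite (mulrC k); ncr.
by rewrite (mulrC k); ncr.
Qed.

Lemma sesq0 : sesq (fun _ _ : H => 0 : C).
Proof. by split=> k x y z; rewrite scaler0 addr0. Qed.

Fact lop0_appr e : 0 < e -> exists T, bnd (fun x y => 0 - opform T x y) e.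
Proof.
move=> e0; exists (op_lin (-1) (op1 H) (op1 H)).
have b0 := bnd_le (@bnd0 R B H) (ltW e0).
apply: bnd_ext b0 => x y.
by rewrite /opform ip_lin scaleN1r addNr subr0.
Qed.
Definition lop0 : L := Lop sesq0 lop0_appr.

Fact lop_lin_appr k s t e : 0 < e ->
  exists T, bnd (fun x y => k *: s x y + t x y - opform T x y) e.
Proof.
move=> e0; pose n := Normc.normc k + 1.
have n0 : 0 < n by rewrite ltr_wpDl // normc_ge0.
have e1 : 0 < e / 2 / n by rewrite !divr_gt0.
have [T Tb] := lop_appr s e1; have [S Sb] := lop_appr t (divr_gt0 e0 (ltr0Sn R 1)).
exists (op_lin k T S).
have st : sesq (fun x y => s x y - opform T x y).
  have := sesq_lin (-1) (opform_sesq T) (lop_sesq s).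
  by case=> h1 h2; split=> l x y z; move: (h1 l x y z) (h2 l x y z); rewrite !scaleN1r !(addrC (- _)).
have := bndD (bndZ k st Tb) Sb; move/bnd_le => /(_ e) H1.
apply: bnd_ext (H1 _).
  by move=> x y; rewrite /opform ip_lin scalerBr; ncr.
rewrite [leRHS]splitr lerD2r mulrA ler_pdivrMr // mulrC ler_pM2l ?divr_gt0 //.
by rewrite /n lerDl.
Qed.
Definition lop_lin k s t : L := Lop (sesq_lin k (lop_sesq s) (lop_sesq t)) (lop_lin_appr k s t).

Definition lop_add s t := lop_lin 1 s t.
Definition lop_opp s := lop_lin (-1) s lop0.
Definition lop_scale k s := lop_lin k s lop0.

HB.instance Definition _ := gen_eqMixin L.
HB.instance Definition _ := gen_choiceMixin L.

Let lopE := (scale1r, scaleN1r, addr0, add0r).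

Fact lop_addA : associative lop_add.
Proof. by move=> s t u; apply: lop_eq => x y; rewrite /= !lopE addrA. Qed.
Fact lop_addC : commutative lop_add.
Proof. by move=> s t; apply: lop_eq => x y; rewrite /= !lopE addrC. Qed.
Fact lop_add0 : left_id lop0 lop_add.
Proof. by move=> s; apply: lop_eq => x y; rewrite /= !lopE. Qed.
Fact lop_addN : left_inverse lop0 lop_opp lop_add.
Proof. by move=> s; apply: lop_eq => x y; rewrite /= !lopE addNr. Qed.
HB.instance Definition _ := GRing.isZmodule.Build L lop_addA lop_addC lop_add0 lop_addN.

Fact lop_scaleA k l s : lop_scale k (lop_scale l s) = lop_scale (k * l) s.
Proof. by apply: lop_eq => x y; rewrite /= !lopE scalerA. Qed.
Fact lop_scale1 : left_id 1 lop_scale.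
Proof. by move=> s; apply: lop_eq => x y; rewrite /= !lopE. Qed.
Fact lop_scaleDr : right_distributive lop_scale +%R.
Proof. by move=> k s t; apply: lop_eq => x y; rewrite /= !lopE scalerDr. Qed.
Fact lop_scaleDl s : {morph lop_scale^~ s : k l / k + l}.
Proof. by move=> k l; apply: lop_eq => x y; rewrite /= !lopE scalerDl. Qed.
HB.instance Definition _ := GRing.Zmodule_isLmodule.Build R[i] L
  lop_scaleA lop_scale1 lop_scaleDr lop_scaleDl.

Lemma lopD s t x y : (s + t) x y = s x y + t x y.
Proof. by rewrite /= !lopE. Qed.
Lemma lopZ k s x y : (k *: s) x y = k *: s x y.
Proof. by rewrite /= !lopE. Qed.
Lemma lopN s x y : (- s) x y = - s x y.
Proof. by rewrite /= !lopE. Qed.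
Lemma lopB s t x y : (s - t) x y = s x y - t x y.
Proof. by rewrite lopD lopN. Qed.

Definition lnorm s : R := inf [set c | 0 <= c /\ bnd s c].

Lemma lop_bounded s : exists2 c, 0 <= c & bnd s c.
Proof.
have [T Tb] := lop_appr s ltr01; have [c c0 Tc] := op_bnd T.
exists (1 + c); first by rewrite addr_ge0.
by apply: bnd_ext (bndD Tb Tc) => x y; rewrite subrK.
Qed.

Lemma lnorm_has_inf s : has_inf [set c | 0 <= c /\ bnd s c].
Proof.
split; first by have [c c0 sc] := lop_bounded s; exists c.
by exists 0 => c [].
Qed.

Lemma lnorm_ge0 s : 0 <= lnorm s.
Proof. by apply: lb_le_inf; [case: (lnorm_has_inf s) | move=> c []]. Qed.

Lemma lnorm_le s c : 0 <= c -> bnd s c -> lnorm s <= c.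
Proof. by move=> c0 sc; apply: ge_inf => //; case: (lnorm_has_inf s). Qed.

Lemma lnorm_bnd s : bnd s (lnorm s).
Proof.
apply: bnd_closed => e e0; have [c [_ sc] cs] := inf_adherent e0 (lnorm_has_inf s).
by apply: bnd_le sc _; exact: ltW.
Qed.

Lemma lnormD s t : lnorm (s + t) <= lnorm s + lnorm t.
Proof.
apply: lnorm_le; first by rewrite addr_ge0 ?lnorm_ge0.
by apply: bnd_ext (bndD (lnorm_bnd s) (lnorm_bnd t)) => x y; rewrite lopD.
Qed.

Lemma lnormZ_le k s : lnorm (k *: s) <= Normc.normc k * lnorm s.
Proof.
apply: lnorm_le; first by rewrite mulr_ge0 ?lnorm_ge0 ?normc_ge0.
by apply: bnd_ext (bndZ k (lop_sesq s) (lnorm_bnd s)) => x y; rewrite lopZ.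
Qed.

Lemma lnorm0_eq0 s : lnorm s = 0 -> s = 0.
Proof.
move=> s0; apply: lop_eq => x y; apply: nrm_le0.
have := bnd_point x y (lop_sesq s) (lexx 0); rewrite mulr0 mul0r; apply.
by rewrite -s0; exact: lnorm_bnd.
Qed.

Lemma lnormZ k s : lnorm (k *: s) = Normc.normc k * lnorm s.
Proof.
have [->|k0] := eqVneq k 0.
  rewrite scale0r Normc.normc0 mul0r; apply/eqP; rewrite eq_le lnorm_ge0 andbT.
  by apply: lnorm_le => //; exact: bnd0.
apply/eqP; rewrite eq_le lnormZ_le /=.
have n0 : 0 < Normc.normc k.
  rewrite lt_def normc_ge0 andbT; apply: contraNneq k0 => /Normc.eq0_normc ->; exact: eqxx.
rewrite mulrC -ler_pdivlMr // mulrC -Normc.normcV.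
by rewrite -{1}(scale1r s) -(mulVf k0) -scalerA lnormZ_le.
Qed.

Lemma lop_nrm s x y : nrm (s x y) <= 3 * lnorm s * (nrm (ip x x) + nrm (ip y y)).
Proof. exact: bnd_point (lop_sesq s) (lnorm_ge0 s) (lnorm_bnd s). Qed.

(** Values converge by the pointwise bound [lop_nrm]; the bounds between the u n pass to the
    pointwise limit because positivity is closed, and the approximating operators come from a late u
    N. *)
Lemma lop_complete (u : nat -> L) :
  (forall e, 0 < e -> exists N, forall m n, (N <= m)%N -> (N <= n)%N ->
     lnorm (u m - u n) <= e) ->
  exists l, forall e, 0 < e -> exists N, forall n, (N <= n)%N -> lnorm (u n - l) <= e.
Proof.
move=> cu.
have lim_ex (p : H * H) : exists l : C, lims (fun n => u n p.1 p.2) l.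
  apply: cauchy_lims => e e0; case: p => x y /=.
  pose K := 3 * (nrm (ip x x) + nrm (ip y y)) + 1.
  have K0 : 0 < K by rewrite ltr_wpDl // mulr_ge0 // addr_ge0 ?nrm_ge0.
  have [N HN] := cu _ (divr_gt0 e0 K0); exists N => m n Nm Nn.
  rewrite -lopB (le_trans (lop_nrm _ _ _)) // -mulrA mulrCA.
  apply: (@le_trans _ _ (e / K * (K - 1))).
    by rewrite /K addrK ler_wpM2r ?HN // mulr_ge0 // addr_ge0 ?nrm_ge0.
  rewrite mulrAC ler_pdivrMr // ler_pM2l //; lra.
have [l ul] := choice lim_ex.
pose f x y := l (x, y).
have fs : sesq f.
  split=> k x y z; rewrite /f.
    apply: lims_uniq (ul (x, hlin k y z)) _ => /= e e0.
    have [N HN] := lims_lin k (ul (x, y)) (ul (x, z)) e0.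
    by exists N => n /HN; rewrite (lop_sesq (u n)).1.
  apply: lims_uniq (ul (hlin k x y, z)) _ => /= e e0.
  have [N HN] := lims_lin (Num.conj k) (ul (x, z)) (ul (y, z)) e0.
  by exists N => n /HN; rewrite (lop_sesq (u n)).2.
have bf e : 0 < e -> exists N, forall n, (N <= n)%N -> bnd (fun x y => u n x y - f x y) e.
  move=> e0; have [N HN] := cu _ e0; exists N => n Nn x y; apply: npos_closed => d d0.
  have [N' HN'] := ul (x, y) _ (divr_gt0 d0 (ltr0Sn R 1)).
  pose m := maxn N N'.
  exists (e%:C *: ip x x + e%:C *: ip y y + (u n - u m) x y + adj ((u n - u m) x y)).
    exact: (bnd_le (lnorm_bnd (u n - u m)) (HN n m Nn (leq_maxl _ _))).
  rewrite lopB.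
  have -> : e%:C *: ip x x + e%:C *: ip y y + (u n x y - f x y) + adj (u n x y - f x y) -
    (e%:C *: ip x x + e%:C *: ip y y + (u n x y - u m x y) + adj (u n x y - u m x y))
    = (u m x y - f x y) + adj (u m x y - f x y) by rewrite !adjB; ncr.
  rewrite (le_trans (nrmD _ _)) // nrm_adj [leRHS]splitr.
  by have := HN' m (leq_maxr _ _); rewrite -/(f x y) => h; rewrite lerD.
have fa e : 0 < e -> exists T, bnd (fun x y => f x y - opform T x y) e.
  move=> e0; have e20 := divr_gt0 e0 (ltr0Sn R 1).
  have [N HN] := bf _ e20; have [T Tb] := lop_appr (u N) e20.
  exists T; have su : sesq (fun x y => u N x y - f x y).
    case: (sesq_lin (-1) fs (lop_sesq (u N))) => h1 h2; split=> l' x y z;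
    by move: (h1 l' x y z) (h2 l' x y z); rewrite !scaleN1r !(addrC (- _)).
  have := bndD (bndZ (-1) su (HN N (leqnn _))) Tb.
  rewrite normcN Normc.normc1 mul1r -splitr; apply: bnd_ext => x y.
  by rewrite scaleN1r; ncr.
exists (Lop fs fa) => e e0; have [N HN] := bf _ e0; exists N => n Nn.
apply: lnorm_le; first exact: ltW.
by apply: bnd_ext (HN n Nn) => x y; rewrite lopB.
Qed.

End LopModule.

(** * The C*-algebra of limit forms *)

Section LopAlgebra.
Variables (R : realType) (B : unitalCStarAlgType R) (H : preHilb B).
Local Notation C := (ualg B).
Local Notation L := (lop H).
Implicit Types (x y z : H) (k : R[i]) (c d e : R) (s t r : L) (T S : op H).

Fact loc_appr T e : 0 < e -> exists S, bnd (fun x y => opform T x y - opform S x y) e.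
Proof.
move=> e0; exists T; have b0 := bnd_le (@bnd0 R B H) (ltW e0).
by apply: bnd_ext b0 => x y; rewrite subrr.
Qed.
Definition loc T : L := Lop (opform_sesq T) (loc_appr T).

Lemma locE T x y : loc T x y = ip x (T y). Proof. by []. Qed.

Lemma loc_lin k T S : loc (op_lin k T S) = k *: loc T + loc S.
Proof. by apply: lop_eq => x y; rewrite lopD lopZ locE /= ip_lin. Qed.

Lemma lnormN t : lnorm (- t) = lnorm t.
Proof. by rewrite -scaleN1r lnormZ normcN Normc.normc1 mul1r. Qed.
Lemma lnormB s t : lnorm (s - t) <= lnorm s + lnorm t.
Proof. by rewrite -(lnormN t) lnormD. Qed.
Lemma lnormC s t : lnorm (s - t) = lnorm (t - s).
Proof. by rewrite -lnormN opprB. Qed.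

Lemma lnorm_mul_loc T S : lnorm (loc (op_mul T S)) <= lnorm (loc T) * lnorm (loc S).
Proof.
set a := lnorm (loc T); set b := lnorm (loc S).
have a0 : 0 <= a by exact: lnorm_ge0.
have b0 : 0 <= b by exact: lnorm_ge0.
apply/ler_addgt0Pr => d d0.
pose e := d / (a + b + d + 1).
have K0 : 0 < a + b + d + 1 by rewrite ltr_wpDl // !addr_ge0 // ltW.
have e0 : 0 < e by rewrite divr_gt0.
have ed : e * (a + b + d + 1) = d by rewrite /e divfK // gt_eqF.
have ed' : e <= d by rewrite -ed ler_peMr // ?(ltW e0) //; lra.
apply: (@le_trans _ _ ((a + e) * (b + e))); last by nra.
apply: lnorm_le; first by rewrite mulr_ge0 // addr_ge0 // ltW.
by apply: bnd_mul; rewrite ?ltr_wpDl //;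
  [apply: bnd_le (lnorm_bnd (loc T)) _ | apply: bnd_le (lnorm_bnd (loc S)) _];
  rewrite lerDl ltW.
Qed.

Lemma lnorm_sq_loc T : lnorm (loc T) ^+ 2 <= lnorm (loc (op_mul (op_adj T) T)).
Proof.
set b := lnorm (loc (op_mul _ _)).
have b0 : 0 <= b by exact: lnorm_ge0.
apply/ler_addgt0Pr => e e0.
have be : 0 < b + e by rewrite ltr_wpDl.
have := @bnd_of_sq _ _ _ T _ be (bnd_le (lnorm_bnd (loc (op_mul (op_adj T) T))) _).
rewrite lerDl => /(_ (ltW e0))/(@lnorm_le _ _ _ (loc T) _ (sqrtr_ge0 _)) h.
by rewrite -(sqr_sqrtr (ltW be)) lerXn2r // nnegrE ?lnorm_ge0 ?sqrtr_ge0.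
Qed.

Lemma sesq_adj (f : H -> H -> C) : sesq f -> sesq (fun x y => adj (f y x)).
Proof.
move=> [fr fl]; split=> k x y z; rewrite ?fl ?fr adjD cadjZ //.
by rewrite conjCK.
Qed.

Fact lop_adj_appr t e : 0 < e -> exists T, bnd (fun x y => adj (t y x) - opform T x y) e.
Proof.
move=> /(lop_appr t)[T Tb]; exists (op_adj T).
by apply: bnd_ext (bnd_adj Tb) => x y; rewrite adjB -opform_adj.
Qed.
Definition lop_adj t : L := Lop (sesq_adj (lop_sesq t)) (lop_adj_appr t).

Lemma loc_adj T : loc (op_adj T) = lop_adj (loc T).
Proof. by apply: lop_eq => x y; exact: opform_adj. Qed.

Lemma lop_adj_lin k s t : lop_adj (k *: s + t) = Num.conj k *: lop_adj s + lop_adj t.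
Proof. by apply: lop_eq => x y; rewrite lopD lopZ [LHS]/= -[adj _]/(adj ((k *: s + t) y x)) lopD lopZ adjD cadjZ. Qed.

Lemma lop_adjK : involutive lop_adj.
Proof. by move=> t; apply: lop_eq => x y /=; rewrite adjK. Qed.

Lemma lnorm_adj t : lnorm (lop_adj t) = lnorm t.
Proof.
have le s : lnorm (lop_adj s) <= lnorm s.
  by apply: lnorm_le; [exact: lnorm_ge0 | exact: bnd_adj (lnorm_bnd s)].
by apply/eqP; rewrite eq_le le -{1}(lop_adjK t) le.
Qed.

Definition flim (T : nat -> op H) t := forall e, 0 < e ->
  exists N, forall n, (N <= n)%N -> lnorm (loc (T n) - t) <= e.

Lemma flim_ex t : exists T : nat -> op H, flim T t.
Proof.
have ex (n : nat) : exists T, lnorm (loc T - t) <= n.+1%:R^-1.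
  have n0 : 0 < n.+1%:R^-1 :> R by rewrite invr_gt0.
  have [T Tb] := lop_appr t n0; exists T; rewrite lnormC; apply: lnorm_le; first exact: ltW.
  by apply: bnd_ext Tb => x y; rewrite lopB.
have [T HT] := choice ex; exists T => e /invn_lt[N HN].
by exists N => n /HN /ltW; exact: le_trans (HT n).
Qed.

Lemma flim_ext (T' T : nat -> op H) t : (forall n, loc (T n) = loc (T' n)) -> flim T t -> flim T' t.
Proof. by move=> TT Tt e /Tt[N HN]; exists N => n /HN; rewrite TT. Qed.

Lemma flim_loc T : flim (fun=> T) (loc T).
Proof.
move=> e e0; exists 0%N => n _; rewrite subrr.
by rewrite (_ : lnorm 0 = 0) ?ltW // -(scale0r 0) lnormZ Normc.normc0 mul0r.
Qed.

Lemma flim_uniq (T : nat -> op H) s t : flim T s -> flim T t -> s = t.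
Proof.
move=> Ts Tt; apply/eqP; rewrite -subr_eq0; apply/eqP/lnorm0_eq0.
apply/eqP; rewrite eq_le lnorm_ge0 andbT; apply/ler_addgt0Pr => e e0; rewrite add0r.
have [N1 H1] := Ts _ (divr_gt0 e0 (ltr0Sn R 1)).
have [N2 H2] := Tt _ (divr_gt0 e0 (ltr0Sn R 1)).
pose n := maxn N1 N2.
have -> : s - t = (loc (T n) - t) - (loc (T n) - s) by rewrite opprB [RHS]addrC addrA subrK.
by rewrite (le_trans (lnormB _ _)) // [leRHS]splitr lerD // ?H1 ?H2 ?leq_maxl ?leq_maxr.
Qed.

Lemma flim_lin k (T S : nat -> op H) s t : flim T s -> flim S t ->
  flim (fun n => op_lin k (T n) (S n)) (k *: s + t).
Proof.
move=> Ts St e e0; pose n := Normc.normc k + 1.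
have n0 : 0 < n by rewrite ltr_wpDl // normc_ge0.
have e1 : 0 < e / 2 / n by rewrite !divr_gt0.
have [N1 H1] := Ts _ e1; have [N2 H2] := St _ (divr_gt0 e0 (ltr0Sn R 1)).
exists (maxn N1 N2) => m; rewrite geq_max => /andP[/H1 h1 /H2 h2].
rewrite loc_lin.
have -> : k *: loc (T m) + loc (S m) - (k *: s + t) = k *: (loc (T m) - s) + (loc (S m) - t).
  by rewrite scalerBr opprD addrACA.
rewrite (le_trans (lnormD _ _)) // [leRHS]splitr lerD // lnormZ.
apply: (@le_trans _ _ (Normc.normc k * (e / 2 / n))); first by rewrite ler_wpM2l ?normc_ge0.
by rewrite mulrA ler_pdivrMr // mulrC ler_pM2l ?divr_gt0 // lerDl.
Qed.

Lemma flim_adj (T : nat -> op H) t : flim T t -> flim (fun n => op_adj (T n)) (lop_adj t).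
Proof.
move=> Tt e /Tt[N HN]; exists N => n /HN; rewrite loc_adj.
suff -> : lop_adj (loc (T n)) - lop_adj t = lop_adj (loc (T n) - t) by rewrite lnorm_adj.
apply: lop_eq => x y; rewrite lopB.
by rewrite -[RHS]/(adj ((loc (T n) - t) y x)) lopB adjB.
Qed.

Lemma flim_norm (T : nat -> op H) t : flim T t -> (fun n => lnorm (loc (T n))) @ \oo --> lnorm t.
Proof.
move=> Tt; apply/cvgrPdist_le => e /Tt[N HN]; exists N => // n /= /HN h.
rewrite ler_norml; apply/andP; split.
  rewrite lerNl opprB lerBlDr (le_trans _ (lerD h (lexx _))) //.
  by rewrite (le_trans _ (lnormD _ _)) // subrK.
rewrite lerBlDr (le_trans _ (lerD h (lexx _))) // lnormC.
by rewrite (le_trans _ (lnormD _ _)) // subrK.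
Qed.

Lemma loc_mulB T T' S S' : lnorm (loc (op_mul T S) - loc (op_mul T' S')) <=
  lnorm (loc T - loc T') * lnorm (loc S) + lnorm (loc T') * lnorm (loc S - loc S').
Proof.
have sub U V : loc U - loc V = loc (op_lin (-1) V U) by rewrite loc_lin scaleN1r addrC.
rewrite !sub.
have -> : loc (op_lin (-1) (op_mul T' S') (op_mul T S)) =
   loc (op_mul (op_lin (-1) T' T) S) + loc (op_mul T' (op_lin (-1) S' S)).
  apply: lop_eq => x y; rewrite lopD !locE /= !ip_lin.
  rewrite -[ip x (T' (hlin _ _ _))]opP ip_lin !opP !scaleN1r; ncr.
by rewrite (le_trans (lnormD _ _)) // lerD // lnorm_mul_loc.
Qed.

Lemma flim_bounded (T : nat -> op H) t : flim T t -> exists N, forall n, (N <= n)%N ->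
  lnorm (loc (T n)) <= lnorm t + 1.
Proof.
move=> Tt; have [N HN] := Tt 1 ltr01; exists N => n /HN h.
by rewrite addrC (le_trans _ (lerD h (lexx _))) // (le_trans _ (lnormD _ _)) // subrK.
Qed.

Lemma flim_mul_close (T T' S S' : nat -> op H) t s : flim T t -> flim T' t -> flim S s -> flim S' s ->
  forall e, 0 < e -> exists N, forall m n, (N <= m)%N -> (N <= n)%N ->
  lnorm (loc (op_mul (T m) (S m)) - loc (op_mul (T' n) (S' n))) <= e.
Proof.
move=> Tt T't Ss S's e e0.
pose K := 2 * (lnorm t + lnorm s + 2).
have K0 : 0 < K by have := lnorm_ge0 t; have := lnorm_ge0 s; rewrite /K; lra.
pose d := e / K; have d0 : 0 < d by rewrite divr_gt0.
have [N1 H1] := Tt _ d0; have [N2 H2] := T't _ d0.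
have [N3 H3] := Ss _ d0; have [N4 H4] := S's _ d0.
have [N5 H5] := flim_bounded Ss; have [N6 H6] := flim_bounded T't.
exists (maxn (maxn N1 N2) (maxn (maxn N3 N4) (maxn N5 N6))) => m n.
rewrite !geq_max => /andP[/andP[m1 _] /andP[/andP[m3 _] /andP[m5 _]]].
move=> /andP[/andP[_ n2] /andP[/andP[_ n4] /andP[_ n6]]].
have close U V u : lnorm (loc U - u) <= d -> lnorm (loc V - u) <= d ->
    lnorm (loc U - loc V) <= 2 * d.
  move=> hU hV; have -> : loc U - loc V = (loc U - u) - (loc V - u).
    by rewrite opprB addrA subrK.
  by rewrite (le_trans (lnormB _ _)) // mulr_natl mulr2n lerD.
have c1 := close _ _ _ (H1 _ m1) (H2 _ n2); have c2 := close _ _ _ (H3 _ m3) (H4 _ n4).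
rewrite (le_trans (loc_mulB _ _ _ _)) //.
apply: (@le_trans _ _ (2 * d * (lnorm s + 1) + (lnorm t + 1) * (2 * d))).
  by rewrite lerD // ler_pM ?lnorm_ge0 // ?H5 ?H6.
have : d * K = e by rewrite /d divfK // gt_eqF.
by rewrite /K => <-; rewrite le_eqVlt; apply/orP; left; apply/eqP; ring.
Qed.

(** Forms do not compose, so the product is a limit of products of approximants. Quantifying over
    all approximations under one [r] records that the choice does not matter, and every algebra law
    then reduces to operators. *)
Lemma lop_mul_ex t s : exists r, forall T S : nat -> op H, flim T t -> flim S s ->
  flim (fun n => op_mul (T n) (S n)) r.
Proof.
have [T0 Tt0] := flim_ex t; have [S0 Ss0] := flim_ex s.
have [r Hr] := lop_complete (flim_mul_close Tt0 Tt0 Ss0 Ss0).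
exists r => T S Tt Ss e e0; have e2 := divr_gt0 e0 (ltr0Sn R 1).
have [N1 H1] := Hr _ e2; have [N2 H2] := flim_mul_close Tt Tt0 Ss Ss0 e2.
exists (maxn N1 N2) => n; rewrite geq_max => /andP[n1 n2].
rewrite -(subrK (loc (op_mul (T0 n) (S0 n))) (loc _)) -addrA.
by rewrite (le_trans (lnormD _ _)) // [leRHS]splitr lerD ?H1 ?H2.
Qed.

Definition lop_mul t s : L := projT1 (cid (lop_mul_ex t s)).

Lemma flim_mul (T S : nat -> op H) t s : flim T t -> flim S s ->
  flim (fun n => op_mul (T n) (S n)) (lop_mul t s).
Proof. exact: projT2 (cid (lop_mul_ex t s)) T S. Qed.

Lemma loc_mul T S : loc (op_mul T S) = lop_mul (loc T) (loc S).
Proof. apply: (flim_uniq (flim_loc _)); apply: flim_mul; exact: flim_loc. Qed.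

Fact lop_mulA : associative lop_mul.
Proof.
move=> s t r; have [T Ts] := flim_ex s; have [S St] := flim_ex t; have [U Ur] := flim_ex r.
apply: flim_uniq (flim_mul Ts (flim_mul St Ur)) _.
by apply: flim_ext (flim_mul (flim_mul Ts St) Ur) => n; apply: lop_eq.
Qed.

Fact lop_mull t : linear (lop_mul^~ t).
Proof.
move=> k s r; have [T Ts] := flim_ex s; have [S St] := flim_ex t; have [U Ur] := flim_ex r.
apply: flim_uniq (flim_mul (flim_lin k Ts Ur) St) _.
apply: flim_ext (flim_lin k (flim_mul Ts St) (flim_mul Ur St)) => n.
by apply: lop_eq => x y.
Qed.

Fact lop_mulr t : linear (lop_mul t).
Proof.
move=> k s r; have [T Ts] := flim_ex s; have [S St] := flim_ex t; have [U Ur] := flim_ex r.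
apply: flim_uniq (flim_mul St (flim_lin k Ts Ur)) _.
apply: flim_ext (flim_lin k (flim_mul St Ts) (flim_mul St Ur)) => n.
apply: lop_eq => x y; rewrite !locE /= ip_lin.
by rewrite -[RHS]opP ip_lin !opP.
Qed.

Fact lop_adjM s t : lop_adj (lop_mul s t) = lop_mul (lop_adj t) (lop_adj s).
Proof.
have [T Ts] := flim_ex s; have [S St] := flim_ex t.
apply: flim_uniq (flim_adj (flim_mul Ts St)) _.
by apply: flim_ext (flim_mul (flim_adj St) (flim_adj Ts)) => n; apply: lop_eq.
Qed.

Fact lnormM s t : lnorm (lop_mul s t) <= lnorm s * lnorm t.
Proof.
have [T Ts] := flim_ex s; have [S St] := flim_ex t.
apply: (ler_cvg_to (flim_norm (flim_mul Ts St))).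
  exact: cvgM (flim_norm Ts) (flim_norm St).
by apply: nearW => n; exact: lnorm_mul_loc.
Qed.

Fact lnorm_cstar t : lnorm (lop_mul (lop_adj t) t) = lnorm t ^+ 2.
Proof.
apply/eqP; rewrite eq_le (le_trans (lnormM _ _)) ?lnorm_adj // ?expr2 //=.
have [T Tt] := flim_ex t.
apply: (ler_cvg_to _ (flim_norm (flim_mul (flim_adj Tt) Tt))).
  exact: cvgM (flim_norm Tt) (flim_norm Tt).
by apply: nearW => n; exact: lnorm_sq_loc.
Qed.

Fact lop_mul1x : left_id (loc (op1 H)) lop_mul.
Proof.
move=> t; have [T Tt] := flim_ex t.
apply: flim_uniq (flim_mul (flim_loc _) Tt) _.
by apply: flim_ext Tt => n; apply: lop_eq.
Qed.
Fact lop_mulx1 : right_id (loc (op1 H)) lop_mul.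
Proof.
move=> t; have [T Tt] := flim_ex t.
apply: flim_uniq (flim_mul Tt (flim_loc _)) _.
by apply: flim_ext Tt => n; apply: lop_eq.
Qed.

Definition lopData : cstarData R := @CStarData R L (@lnorm R B H) lop_mul lop_adj
  (loc (op1 H)) (@lnormD R B H) (@lnormZ R B H) (@lnorm0_eq0 R B H)
  lop_mulA lop_mull lop_mulr lop_adj_lin lop_adjM lop_adjK lnormM lnorm_cstar
  lop_mul1x lop_mulx1 (@lop_complete R B H).

Lemma flim_point (T : nat -> op H) t x y : flim T t -> lims (fun n => ip x (T n y)) (t x y).
Proof.
move=> Tt e e0; pose K := 3 * (nrm (ip x x) + nrm (ip y y)) + 1.
have K0 : 0 < K by rewrite ltr_wpDl // mulr_ge0 // addr_ge0 ?nrm_ge0.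
have [N HN] := Tt _ (divr_gt0 e0 K0); exists N => n Nn.
rewrite -locE -lopB (le_trans (lop_nrm _ _ _)) // -mulrA mulrCA.
apply: (@le_trans _ _ (e / K * (K - 1))).
  by rewrite /K addrK ler_wpM2r ?HN // mulr_ge0 // addr_ge0 ?nrm_ge0.
rewrite mulrAC ler_pdivrMr // ler_pM2l //; lra.
Qed.

Lemma lop_mul_locl T t x y : lop_mul (loc T) t x y = t (opa T x) y.
Proof.
have [S St] := flim_ex t.
apply: lims_uniq (flim_point x y (flim_mul (flim_loc T) St)) _ => e.
move=> /(flim_point (opa T x) y St)[N HN]; exists N => n /HN.
by rewrite /= opP.
Qed.

Lemma lop_mul_locr T t x y : lop_mul t (loc T) x y = t x (T y).
Proof.
have [S St] := flim_ex t.
apply: lims_uniq (flim_point x y (flim_mul St (flim_loc T))) _ => e.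
by move=> /(flim_point x (T y) St)[N HN]; exists N => n /HN.
Qed.

End LopAlgebra.

(** * Matrices over a C*-algebra *)

Section Columns.
Variables (R : realType) (A : unitalCStarAlgType R).
Local Notation C := (ualg A).
Implicit Types (a b u v : C) (c d e : R) (k : R[i]).

Lemma npos_conj a u : npos a -> npos (adj u * a * u).
Proof.
move=> /npos_sqrt[g [/npos_sa ga <- _]].
have -> : adj u * (g * g) * u = adj (g * u) * (g * u) by rewrite uadjM ga !mulrA.
exact: npos_gram.
Qed.

Lemma npos_gram_le a c : nrm a <= c -> npos ((c ^+ 2)%:C *: (1 : C) - adj a * a).
Proof.
move=> ac; have c0 := le_trans (nrm_ge0 a) ac.
apply: npos_sub; first exact: npos_sa (npos_gram a).
by rewrite unrm_cstar lerXn2r ?nnegrE ?nrm_ge0.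
Qed.

(** Completing the square: the expression is 1/c times the Gram square of c u + a v, plus 1/c times
    v^* (c^2 - a^* a) v. *)
Lemma npos_block a u v c : 0 < c -> nrm a <= c ->
  npos (c%:C *: (adj u * u) + c%:C *: (adj v * v) + adj u * a * v + adj (adj u * a * v)).
Proof.
move=> c0 ac.
have p1 := nposZ (_ : 0 <= c^-1) (npos_gram (c%:C *: u + a * v)).
have p2 := nposZ (_ : 0 <= c^-1) (npos_conj v (npos_gram_le ac)).
have ci : 0 <= c^-1 by rewrite invr_ge0 ltW.
have := nposD (p1 ci) (p2 ci); congr npos.
have cn : c != 0 by rewrite gt_eqF.
have -> : c^-1%:C *: (adj (c%:C *: u + a * v) * (c%:C *: u + a * v)) =
  c%:C *: (adj u * u) + adj u * a * v + adj (adj u * a * v) +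
  c^-1%:C *: (adj v * (adj a * a) * v).
  rewrite adjD adjZr !uadjM adjK mulrDl !mulrDr -!cscaleAl -!cscaleAr.
  have cc : c^-1%:C * c%:C = 1 :> R[i] by rewrite -rmorphM mulVf ?rmorph1.
  rewrite !scalerDr !scalerA !cc mul1r !scale1r.
  by rewrite !mulrA; ncr.
have -> : c^-1%:C *: (adj v * ((c ^+ 2)%:C *: (1 : C) - adj a * a) * v) =
  c%:C *: (adj v * v) - c^-1%:C *: (adj v * (adj a * a) * v).
  rewrite mulrBr mulrBl -cscaleAr -cscaleAl mulr1 scalerBr scalerA -rmorphM.
  by rewrite (_ : c^-1 * c ^+ 2 = c) //; field.
ncr.
Qed.

(* The standard Hilbert module [A^n]. *)
Fact colip_lin n k (x y z : 'I_n -> C) :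
  \sum_i adj (x i) * (k *: y i + z i) =
  k *: (\sum_i adj (x i) * y i) + \sum_i adj (x i) * z i.
Proof.
rewrite scaler_sumr -big_split; apply: eq_bigr => i _ /=.
by rewrite mulrDr cscaleAr.
Qed.
Fact colip_act n (x y : 'I_n -> C) b :
  \sum_i adj (x i) * (y i * b) = (\sum_i adj (x i) * y i) * b.
Proof. by rewrite mulr_suml; apply: eq_bigr => i _; rewrite mulrA. Qed.
Fact colip_adj n (x y : 'I_n -> C) :
  adj (\sum_i adj (x i) * y i) = \sum_i adj (y i) * x i.
Proof. by rewrite adj_sum; apply: eq_bigr => i _; rewrite uadjM adjK. Qed.
Fact colip_pos n (x : 'I_n -> C) : npos (\sum_i adj (x i) * x i).
Proof. by apply: npos_sum => i _; exact: npos_gram. Qed.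

Definition colmod (n : nat) : preHilb A := @PreHilb R A ('I_n -> C)
  (fun x y => \sum_i adj (x i) * y i) (fun k x y i => k *: x i + y i)
  (fun x b i => x i * b) (@colip_lin n) (@colip_act n) (@colip_adj n) (@colip_pos n).

Lemma col_ipE n (x y : colmod n) : ip x y = \sum_i adj (x i) * y i.
Proof. by []. Qed.

Definition mxform n (b : 'I_n -> 'I_n -> C) : colmod n -> colmod n -> C :=
  fun x y => \sum_i \sum_j adj (x i) * b i j * y j.

Definition mxop_fun n (b : 'I_n -> 'I_n -> C) : colmod n -> colmod n :=
  fun x i => \sum_j b i j * x j.

Lemma opform_mx n (b : 'I_n -> 'I_n -> C) : opform (mxop_fun b) =2 mxform b.
Proof.
move=> x y; apply: eq_bigr => i _; rewrite mulr_sumr.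
by apply: eq_bigr => j _; rewrite mulrA.
Qed.

Lemma bnd_sum (H : preHilb A) I (r : seq I) (t : I -> H -> H -> C) (c : I -> R) :
  (forall i, bnd (t i) (c i)) -> bnd (fun x y => \sum_(i <- r) t i x y) (\sum_(i <- r) c i).
Proof.
move=> tc; elim: r => [|i r IH].
  by rewrite big_nil; apply: bnd_ext (@bnd0 _ _ H) => x y; rewrite big_nil.
rewrite big_cons; apply: bnd_ext (bndD (tc i) IH) => x y; by rewrite big_cons.
Qed.

Lemma col_coord_le n (x : 'I_n -> C) i : npos (ip (x : colmod n) x - adj (x i) * x i).
Proof.
rewrite /= (bigD1 i) //= addrAC subrr add0r.
by apply: npos_sum => j _; exact: npos_gram.
Qed.

Lemma mxop_fun_bnd n (b : 'I_n -> 'I_n -> C) :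
  bnd (opform (mxop_fun b)) (\sum_i \sum_j nrm (b i j)).
Proof.
have entry (a : C) (i j : 'I_n) :
    bnd (fun x y : colmod n => adj (x i) * a * y j) (nrm a).
  have := nrm_ge0 a; rewrite le_eqVlt => /orP[/eqP a0|c0].
    rewrite -a0 (nrm0_eq0 (esym a0)); apply: bnd_ext (@bnd0 _ _ _) => x y.
    by rewrite mulr0 mul0r.
  move=> x y; have p1 := nposZ (ltW c0) (col_coord_le x i).
  have p2 := nposZ (ltW c0) (col_coord_le y j).
  have p3 := npos_block (x i) (y j) c0 (lexx (nrm a)).
  by have := nposD (nposD p1 p2) p3; congr npos; rewrite !scalerBr; ncr.
have := bnd_sum (index_enum 'I_n) (fun i => bnd_sum (index_enum 'I_n) (fun j => entry (b i j) i j)).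
by apply: bnd_ext => x y; rewrite opform_mx.
Qed.

Fact mxop_adj n (b : 'I_n -> 'I_n -> C) (x y : colmod n) :
  ip (mxop_fun (fun i j => adj (b j i)) x) y = ip x (mxop_fun b y).
Proof.
rewrite /=; under eq_bigr => i _ do rewrite adj_sum mulr_suml.
rewrite exchange_big /=; apply: eq_bigr => i _; rewrite mulr_sumr; apply: eq_bigr => j _.
by rewrite uadjM adjK mulrA.
Qed.
Fact mxop_bnd n (b : 'I_n -> 'I_n -> C) :
  exists2 c, 0 <= c & bnd (opform (mxop_fun b)) c.
Proof.
exists (\sum_i \sum_j nrm (b i j)); last exact: mxop_fun_bnd.
by do 2! (apply: sumr_ge0 => ? _); exact: nrm_ge0.
Qed.
Definition mxop n (b : 'I_n -> 'I_n -> C) : op (colmod n) := Op (mxop_adj b) (mxop_bnd b).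

Lemma lnorm_mx n (b : 'I_n -> 'I_n -> C) :
  lnorm (loc (mxop b)) <= \sum_i \sum_j nrm (b i j).
Proof.
apply: lnorm_le; last exact: mxop_fun_bnd.
by do 2! (apply: sumr_ge0 => ? _); exact: nrm_ge0.
Qed.

Definition ecol n (i : 'I_n) : colmod n := fun j => if j == i then 1 else 0.

Lemma ip_ecol n (i : 'I_n) (x : colmod n) : ip (ecol i) x = x i.
Proof.
rewrite /= (bigD1 i) //= /ecol eqxx uadj1 mul1r big1 ?addr0 // => j /negPf ->.
by rewrite adj0 mul0r.
Qed.

Lemma loc_mx_entry n (b : 'I_n -> 'I_n -> C) i j : loc (mxop b) (ecol i) (ecol j) = b i j.
Proof.
rewrite locE ip_ecol /= /mxop_fun (bigD1 j) //= /ecol eqxx mulr1 big1 ?addr0 // => l /negPf ->.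
by rewrite mulr0.
Qed.

Lemma limsM (u v : nat -> C) a b : lims u a -> lims v b -> lims (fun n => u n * v n) (a * b).
Proof.
move=> ua vb e e0; pose K := nrm a + nrm b + 1.
have a0 := nrm_ge0 a; have b0 := nrm_ge0 b.
have K0 : 0 < K by rewrite /K; lra.
have d0 : 0 < e / (e + K) by rewrite divr_gt0 // addr_gt0.
set d := e / (e + K) in d0.
have [N1 H1] := ua _ d0; have [N2 H2] := vb _ d0.
exists (maxn N1 N2) => n; rewrite geq_max => /andP[/H1 h1 /H2 h2].
have -> : u n * v n - a * b = (u n - a) * (v n - b) + (u n - a) * b + a * (v n - b) by ncr.
have m1 := unrmM (u n - a) (v n - b); have m2 := unrmM (u n - a) b; have m3 := unrmM a (v n - b).
rewrite (le_trans (nrmD _ _)) //.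
have := nrmD ((u n - a) * (v n - b)) ((u n - a) * b).
have n1 := nrm_ge0 (u n - a); have n2 := nrm_ge0 (v n - b).
have eK : 0 < e + K by rewrite addr_gt0.
have d1 : d <= 1 by rewrite /d ler_pdivrMr // mul1r lerDl ltW.
have dK : d * K <= e.
  by rewrite /d mulrAC ler_pdivrMr // ler_pM2l // lerDr ltW.
move: dK; rewrite /K => dK.
have x1 : nrm (u n - a) * nrm (v n - b) <= d * 1 by rewrite ler_pM // (le_trans h2).
have x2 : nrm (u n - a) * nrm b <= d * nrm b by rewrite ler_wpM2r.
have x3 : nrm a * nrm (v n - b) <= nrm a * d by rewrite ler_wpM2l.
lra.
Qed.

Lemma lims_cst (a : C) : lims (fun=> a) a.
Proof. by move=> e e0; exists 0%N => n _; rewrite subrr nrm0 ltW. Qed.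

Lemma lims_sum I (r : seq I) (u : I -> nat -> C) (a : I -> C) :
  (forall i, lims (u i) (a i)) ->
  lims (fun n => \sum_(i <- r) u i n) (\sum_(i <- r) a i).
Proof.
move=> ua; elim: r => [|i r IH].
  by rewrite big_nil => e /lims_cst -/(_ 0)[N HN]; exists N => n /HN; rewrite big_nil.
rewrite big_cons => e; rewrite -[a i]scale1r => /(lims_lin 1 (ua i) IH)[N HN].
by exists N => n /HN; rewrite big_cons scale1r.
Qed.

Lemma lop_mul_entry n (s t : lop (colmod n)) (i j : 'I_n) :
  lop_mul s t (ecol i) (ecol j) = \sum_l s (ecol i) (ecol l) * t (ecol l) (ecol j).
Proof.
have [T Ts] := flim_ex s; have [S St] := flim_ex t.
apply: lims_uniq (flim_point _ _ (flim_mul Ts St)) _.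
have := lims_sum (index_enum 'I_n) (fun l =>
  limsM (flim_point (ecol i) (ecol l) Ts) (flim_point (ecol l) (ecol j) St)).
move=> h e /h[N HN]; exists N => m /HN.
have -> : ip (ecol i) (op_mul (T m) (S m) (ecol j)) =
   \sum_l ip (ecol i) (T m (ecol l)) * ip (ecol l) (S m (ecol j)).
  rewrite -[LHS]/(ip (ecol i) (T m (S m (ecol j)))) -[LHS]opP [LHS]col_ipE.
  by apply: eq_bigr => l _; rewrite [in RHS](ip_ecol l) -(ip_ecol l (opa (T m) (ecol i))) ip_adj opP.
by [].
Qed.

(** Polarisation: the diagonal values at x + y and at i x + y give the two Cartesian halves of the
    identity. *)
Lemma sesq_herm (H : preHilb A) (t : H -> H -> C) : sesq t ->
  (forall x, adj (t x x) = t x x) -> forall x y, adj (t x y) = t y x.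
Proof.
move=> [tr tl] tx x y.
have h1 : adj (t y x) + adj (t x y) = t y x + t x y.
  have := tx (hlin 1 x y); rewrite !tr !tl rmorph1 !scale1r !adjD !tx.
  by rewrite -!addrA => /addrI; rewrite !addrA => /addIr.
have ci : Num.conj 'i%C = - 'i%C :> R[i] by apply/eqP; rewrite eq_complex /= oppr0 !eqxx.
have h2 : adj (t x y) - adj (t y x) = t y x - t x y.
  have := tx (hlin 'i%C x y); rewrite !tr !tl ci scalerDr scalerA.
  rewrite (_ : 'i * - 'i = 1); last by rewrite mulrN -expr2 sqr_i opprK.
  rewrite scale1r scaleNr !adjD adjN !adjZi !tx opprK -!addrA => /addrI.
  rewrite !addrA => /addIr E.
  have i0 : 'i%C != 0 :> R[i] by rewrite eq_complex /= oner_eq0 andbF.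
  apply: (scalerI i0); rewrite !scalerBr -E; ncr.
have e2 : adj (t x y) + adj (t x y) = t y x + t y x.
  have -> : adj (t x y) + adj (t x y) =
    (adj (t x y) - adj (t y x)) + (adj (t y x) + adj (t x y)) by ncr.
  by rewrite h1 h2; ncr.
by rewrite [LHS]real_halfD e2 -real_halfD.
Qed.

(** A positive quadratic form is a positive element of the C*-algebra of limit forms on A^n;
    [npos_sqrt] applies there, and the factor is read off from the entries of the root. *)
Lemma psd_mx_positive n (b : 'I_n -> 'I_n -> C) :
  (forall v : 'I_n -> C, npos (\sum_i \sum_j adj (v i) * b i j * v j)) ->
  exists c : 'I_n -> 'I_n -> C, forall i j, b i j = \sum_l adj (c l i) * c l j.
Proof.
move=> bp; pose t : ualg (cstar_of (lopData (colmod n))) := loc (mxop b).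
have tp (x : colmod n) : npos (loc (mxop b) x x).
  by have := bp x; rewrite -[in X in X -> _]/(mxform b x x) -opform_mx.
have th (x y : colmod n) : adj (loc (mxop b) x y) = loc (mxop b) y x.
  by apply: sesq_herm; [exact: lop_sesq | move=> z; exact: npos_sa].
have t_pos : npos t.
  split; first by apply: lop_eq => x y; exact: th.
  pose N := lnorm (loc (mxop b)); exists N; first exact: lnorm_ge0.
  suff : lnorm (N%:C *: loc (op1 (colmod n)) - loc (mxop b)) <= N by [].
  apply: lnorm_le; first exact: lnorm_ge0.
  set D := _ - _.
  have DE x y : D x y = N%:C *: ip x y - loc (mxop b) x y by rewrite lopB lopZ.
  have Dp x : npos (D x x).
    have := lnorm_bnd (loc (mxop b)) (hscale (-1) x) x.
    rewrite ip_scale !ip_scalel sesq_scalel; last exact: lop_sesq.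
    rewrite rmorphN1 !scaleN1r opprK adjN (npos_sa (tp x)) => h.
    have h2 : (0 : R) <= 2^-1 by rewrite invr_ge0.
    have := nposZ h2 h; congr npos; apply: half_half.
    by rewrite DE -/N; ncr.
  (* With D = N - b, the block expression of D with weight N is D(x+y, x+y) + b(x,x) + b(y,y). *)
  move=> x y; have := nposD (Dp (hlin 1 x y)) (nposD (tp x) (tp y)).
  congr npos.
  have [Dr Dl] := lop_sesq D; rewrite Dr !Dl rmorph1 !scale1r.
  have -> : adj (D x y) = D y x by rewrite !DE adjB adjZr ip_adj th.
  by rewrite !DE; ncr.
have [z [/npos_sa za zz _]] := npos_sqrt t_pos.
exists (fun i j => (z : lop (colmod n)) (ecol i) (ecol j)) => i j.
rewrite -(loc_mx_entry b) -[loc (mxop b)]/t -zz -[X in X * _]za.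
exact: lop_mul_entry.
Qed.

(** [mx_positive] asks for a square factor; testing on vectors exchanges a rectangular one for
    it. *)
Lemma gram_mx_positive m n (c : 'I_m -> 'I_n -> C) (x : 'M[A]_n) :
  (forall i j, x i j = \sum_l adj (c l i) * c l j) -> mx_positive x.
Proof.
move=> xc; have [|d xd] := @psd_mx_positive n (fun i j => x i j).
  move=> v.
  have -> : \sum_i \sum_j adj (v i) * x i j * v j =
      \sum_l adj (\sum_i c l i * v i) * (\sum_i c l i * v i).
    under [RHS]eq_bigr => l _ do rewrite adj_sum mulr_suml.
    rewrite [RHS]exchange_big /=; apply: eq_bigr => i _.
    under [RHS]eq_bigr => l _ do rewrite mulr_sumr.
    rewrite [RHS]exchange_big /=; apply: eq_bigr => j _.
    rewrite xc mulr_sumr mulr_suml; apply: eq_bigr => l _.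
    by rewrite uadjM !mulrA.
  by apply: npos_sum => l _; exact: npos_gram.
by exists (\matrix_(i, j) d i j) => i j; rewrite xd; apply: eq_bigr => l _; rewrite !mxE.
Qed.

End Columns.

(** * The trace of a finite-dimensional C*-algebra *)

(** The trace is the sum of the roots of the characteristic polynomial. If it vanishes, all these
    nonnegative roots are 0, the polynomial is X^n, and Cayley-Hamilton makes M nilpotent. *)
Lemma trace_nonneg_spectrum (F : numClosedFieldType) n (M : 'M[F]_n) :
  (forall k, eigenvalue M k -> 0 <= k) ->
  0 <= \tr M /\ (\tr M = 0 -> forall v : 'rV_n, iter n (mulmxr M) v = 0).
Proof.
case: n M => [|n] M eig.
  by rewrite /mxtrace big_ord0 lexx; split=> // _ v; rewrite thinmx0.
have [rs rsE] := closed_field_poly_normal (char_poly M).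
rewrite (monicP (char_poly_monic M)) scale1r in rsE.
have rs_size : size rs = n.+1.
  by apply/eqP; rewrite -eqSS -(size_prod_XsubC rs id) -rsE size_char_poly.
have rs0 z : z \in rs -> 0 <= z.
  by move=> zr; apply: eig; rewrite eigenvalue_root_char rsE root_prod_XsubC.
have trE : \tr M = \sum_(z <- rs) z.
  apply: oppr_inj; rewrite -(char_poly_trace M (ltn0Sn n)) rsE.
  by rewrite -[n.+1]rs_size coefPn_prod_XsubC // rs_size.
rewrite trE big_seq; split; first by apply: sumr_ge0 => z /rs0.
move=> sum0.
have z0 z : z \in rs -> z = 0.
  move=> zr; have := sum0 => /eqP; rewrite psumr_eq0 => [/allP/(_ z zr)/implyP/(_ zr)/eqP //|].
  by move=> y /rs0.
have charE : char_poly M = 'X^(n.+1).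
  rewrite rsE (eq_big_seq (fun=> 'X)) => [|z /z0 ->]; last by rewrite subr0.
  by rewrite big_const_seq count_predT rs_size iter_mulr_1.
have := Cayley_Hamilton M; rewrite charE rmorphXn /= horner_mx_X => Mn v.
have it m : iter m (mulmxr M) v = v *m M ^+ m.
  elim: m => [|m IH]; first by rewrite expr0 mulmx1.
  by rewrite iterS IH /= -mulmxA exprSr.
by rewrite -[LHS]/(iter n.+1 (mulmxr M) v) (it n.+1) (Mn : M ^+ n.+1 = 0) mulmx0.
Qed.

Section Trace.
Variables (R : realType) (P : unitalCStarAlgType R).
Local Notation C := (ualg P).
Implicit Types (a b x y : C) (k : R[i]).

(** A spanning family of least length is independent, as a relation with [c i] nonzero would allow
    [e i] to be dropped. *)
Lemma fd_basis : finite_dimensional P -> exists d (e : 'I_d -> C),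
  (forall x, exists c : 'I_d -> R[i], x = \sum_i c i *: e i) /\ lin_indep e.
Proof.
move=> finP.
pose spanning n := `[< exists e : 'I_n -> C,
  forall x, exists c : 'I_n -> R[i], x = \sum_i c i *: e i >].
have ex : exists n, spanning n by have [n [e he]] := finP; exists n; apply/asboolP; exists e.
case: (ex_minnP ex) => d /asboolP[e he] dmin; exists d, e; split=> // c c0 i.
apply/eqP/negPn/negP => ci.
case: d e he dmin c c0 i ci => [|d] e he dmin c c0 i ci; first by case: i ci.
suff : (d.+1 <= d)%N by rewrite ltnn.
apply: dmin; apply/asboolP; exists (fun j => e (lift i j)) => x; have [f ->] := he x.
exists (fun j => f (lift i j) - f i / c i * c (lift i j)).
have ei : e i = - ((c i)^-1 *: \sum_j c (lift i j) *: e (lift i j)).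
  move: c0; rewrite (bigD1_ord i) //= => /eqP; rewrite addr_eq0 => /eqP E.
  by rewrite -scalerN -E scalerA mulVf // scale1r.
rewrite (bigD1_ord i) //= {1}ei scalerN scalerA scaler_sumr addrC -sumrB.
by apply: eq_bigr => j _; rewrite scalerBl scalerA.
Qed.

Lemma nilpotent_sa x n : adj x = x -> x ^+ n.+1 = 0 -> x = 0.
Proof.
move=> xa; have xn m : adj (x ^+ m) = x ^+ m.
  by elim: m => [|m IH]; rewrite ?expr0 ?uadj1 // {1}exprS uadjM IH xa -exprSr.
elim: n => [|n IH]; first by rewrite expr1.
move=> x0; apply: IH; apply: sq_eq0 => //.
by rewrite -exprD addSnnS exprD x0 mulr0.
Qed.

Section Basis.
Variables (d : nat) (e : 'I_d -> C) (co : C -> 'I_d -> R[i]).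
Hypothesis coP : forall x, x = \sum_i co x i *: e i.
Hypothesis e_indep : lin_indep e.

Lemma co_uniq x (c : 'I_d -> R[i]) : x = \sum_i c i *: e i -> co x =1 c.
Proof.
move=> xc i; apply/eqP; rewrite -subr_eq0; apply/eqP; move: i; apply: e_indep.
under eq_bigr => i _ do rewrite scalerBl.
by rewrite sumrB -coP -xc subrr.
Qed.

Lemma co_lin k x y i : co (k *: x + y) i = k * co x i + co y i.
Proof.
apply: (@co_uniq _ (fun i => k * co x i + co y i)).
under eq_bigr => j _ do rewrite scalerDl -scalerA.
by rewrite big_split /= -scaler_sumr -!coP.
Qed.
Lemma coD x y i : co (x + y) i = co x i + co y i.
Proof. by rewrite -[x]scale1r co_lin mul1r scale1r. Qed.
Lemma co0 i : co 0 i = 0.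
Proof. by apply: (@addIr _ (co 0 i)); rewrite -coD !add0r. Qed.
Lemma coZ k x i : co (k *: x) i = k * co x i.
Proof. by rewrite -[k *: x]addr0 co_lin co0 addr0. Qed.
Lemma co_sum I (r : seq I) (F : I -> C) i : co (\sum_(j <- r) F j) i = \sum_(j <- r) co (F j) i.
Proof. by elim/big_rec2: _ => [|j y z _ <-]; rewrite ?co0 ?coD. Qed.

Definition tr x : R[i] := \sum_k co (x * e k) k.

Lemma tr_lin k x y : tr (k *: x + y) = k * tr x + tr y.
Proof.
rewrite mulr_sumr -big_split; apply: eq_bigr => i _ /=.
by rewrite mulrDl -cscaleAl co_lin.
Qed.
Lemma trD x y : tr (x + y) = tr x + tr y.
Proof. by rewrite -[x]scale1r tr_lin mul1r scale1r. Qed.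
Lemma tr0 : tr 0 = 0.
Proof. by apply: (@addIr _ (tr 0)); rewrite -trD !add0r. Qed.
Lemma trZ k x : tr (k *: x) = k * tr x.
Proof. by rewrite -[k *: x]addr0 tr_lin tr0 addr0. Qed.
Lemma trN x : tr (- x) = - tr x.
Proof. by rewrite -scaleN1r trZ mulN1r. Qed.
Lemma tr_sum I (r : seq I) (F : I -> C) : tr (\sum_(j <- r) F j) = \sum_(j <- r) tr (F j).
Proof. by elim/big_rec2: _ => [|j y z _ <-]; rewrite ?tr0 ?trD. Qed.

Lemma trC x y : tr (x * y) = tr (y * x).
Proof.
have E u v : tr (u * v) = \sum_k \sum_l co (v * e k) l * co (u * e l) k.
  apply: eq_bigr => k _; rewrite -mulrA {1}(coP (v * e k)) mulr_sumr co_sum.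
  by apply: eq_bigr => l _; rewrite -cscaleAr coZ.
rewrite !E exchange_big; apply: eq_bigr => l _; apply: eq_bigr => k _.
by rewrite mulrC.
Qed.

Definition lmx x : 'M[R[i]]_d := \matrix_(k, l) co (x * e k) l.
Definition rvec x : 'rV[R[i]]_d := \row_l co x l.

Lemma rvecM x y : rvec y *m lmx x = rvec (x * y).
Proof.
apply/rowP => l; rewrite !mxE {2}(coP y) mulr_sumr co_sum; apply: eq_bigr => k _.
by rewrite !mxE -cscaleAr coZ.
Qed.

(** An eigenvector is an element p of [P] with a^* a p = k p, so w = k y for the positive elements w
    = adj (a p) * (a p) and y = adj p * p; as y is not 0, k is real and nonnegative. *)
Lemma eigenvalue_gram a k : eigenvalue (lmx (adj a * a)) k -> 0 <= k.
Proof.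
move=> /eigenvalueP[v /rowP vk v0].
pose p : C := \sum_l v 0 l *: e l.
have pv : rvec p = v by apply/rowP => l; rewrite mxE (co_uniq (erefl p)).
have ap : adj a * a * p = k *: p.
  rewrite (coP (_ * p)) scaler_sumr; apply: eq_bigr => l _; rewrite scalerA; congr (_ *: _).
  by have := vk l; rewrite -{1}pv rvecM !mxE.
have p0 : p != 0.
  apply: contra_neq v0 => p0; rewrite -pv p0; apply/rowP => l; by rewrite !mxE co0.
pose y := adj p * p; pose w := adj (a * p) * (a * p).
have wy : w = k *: y by rewrite /w uadjM -mulrA (mulrA (adj a)) ap -cscaleAr.
have y0 : y != 0.
  apply: contra_neq p0 => y0; apply: nrm0_eq0; apply/eqP; rewrite -sqrf_eq0 -unrm_cstar.
  by rewrite -/y y0 nrm0.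
have yp : npos y := npos_gram p; have wp : npos w := npos_gram (a * p).
have kr : Num.conj k = k.
  have := npos_sa wp; rewrite wy cadjZ (npos_sa yp) => /eqP.
  by rewrite -subr_eq0 -scalerBl scaler_eq0 (negPf y0) orbF subr_eq0 => /eqP.
have kC : k = (complex.Re k)%:C by apply/esym/RRe_real/CrealP.
rewrite kC lecR leNgt; apply/negP => k0.
have : npos (- w).
  rewrite wy kC -scaleNr -rmorphN; apply: nposZ => //; by rewrite oppr_ge0 ltW.
move=> /(npos_anti wp) w0; move: wy; rewrite w0 => /esym/eqP.
by rewrite scaler_eq0 (negPf y0) orbF kC => /eqP/complexI k00; rewrite k00 ltxx in k0.
Qed.

Lemma tr_lmx x : tr x = \tr (lmx x).
Proof. by apply: eq_bigr => l _; rewrite mxE. Qed.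

(** Faithfulness: if the trace vanishes, left multiplication by a^* a is nilpotent; applied to 1
    this makes a^* a a nilpotent self-adjoint element, hence 0. *)
Lemma tr_gram a : 0 <= tr (adj a * a) /\ (tr (adj a * a) = 0 -> a = 0).
Proof.
have [t0 tn] := trace_nonneg_spectrum (@eigenvalue_gram a).
rewrite tr_lmx; split=> // /tn n0.
suff a0 : adj a * a = 0.
  by apply: nrm0_eq0; apply/eqP; rewrite -sqrf_eq0 -unrm_cstar a0 nrm0.
have aa : adj (adj a * a) = adj a * a by exact: npos_sa (npos_gram a).
apply: (@nilpotent_sa _ d) => //; rewrite exprSr.
have it m y : iter m (mulmxr (lmx (adj a * a))) (rvec y) = rvec ((adj a * a) ^+ m * y).
  elim: m => [|m IH]; first by rewrite expr0 mul1r.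
  by rewrite iterS IH /= rvecM mulrA -exprS.
have := n0 (rvec 1); rewrite it mulr1 => /rowP r0.
rewrite [_ ^+ d]coP big1 ?mul0r // => i _.
by have := r0 i; rewrite !mxE => ->; rewrite scale0r.
Qed.

(** A self-adjoint x is the scalar |x| minus a square, and the trace is nonnegative on squares. *)
Lemma tr_real x : adj x = x -> tr x \is Num.real.
Proof.
move=> xa; have /npos_sqrt[c [/npos_sa ca cc _]] := npos_sub xa (lexx (nrm x)).
have -> : x = (nrm x)%:C *: (1 : C) - adj c * c by rewrite ca cc; ncr.
have t1 : tr 1 = tr (adj (1 : C) * 1) by rewrite uadj1 mulr1.
rewrite trD trN trZ t1 rpredB // ?rpredM //.
- by apply/CrealP; exact: conjc_real.
- by apply: ger0_real; case: (tr_gram 1).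
- by apply: ger0_real; case: (tr_gram c).
Qed.

Lemma tr_adj x : tr (adj x) = Num.conj (tr x).
Proof.
have h1 : adj (x + adj x) = x + adj x by rewrite adjD adjK addrC.
have h2 : adj ('i *: (x - adj x)) = 'i *: (x - adj x).
  by rewrite adjZi adjB adjK -scalerN opprB.
have /CrealP := tr_real h1; have /CrealP := tr_real h2.
rewrite trZ !trD trN.
case: (tr x) => p q; case: (tr (adj x)) => r s.
move=> /eqP; rewrite eq_complex /= => /andP[/eqP E1 /eqP E2] /eqP.
rewrite eq_complex /= => /andP[/eqP E3 /eqP E4].
apply/eqP; rewrite eq_complex /=; apply/andP; split; apply/eqP; lra.
Qed.

Definition dot x y : R[i] := tr (adj x * y).
Lemma dot_lin x k y z : dot x (k *: y + z) = k * dot x y + dot x z.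
Proof. by rewrite /dot mulrDr -cscaleAr tr_lin. Qed.
Lemma dot_conj x y : Num.conj (dot x y) = dot y x.
Proof. by rewrite /dot -tr_adj uadjM adjK. Qed.

Lemma dot_sum x I (r : seq I) (F : I -> C) :
  dot x (\sum_(j <- r) F j) = \sum_(j <- r) dot x (F j).
Proof. by rewrite /dot mulr_sumr tr_sum. Qed.
Lemma dotZ x k y : dot x (k *: y) = k * dot x y.
Proof. by rewrite /dot -cscaleAr trZ. Qed.

Lemma gram_schmidt (s : seq C) : exists m (u : 'I_m -> C),
  (forall i j, dot (u i) (u j) = (i == j)%:R) /\
  (forall x, x \in s -> x = \sum_i dot (u i) x *: u i).
Proof.
elim: s => [|x s [m [u [ON us]]]]; first by exists 0%N, (fun=> 0); split=> // -[].
pose r := x - \sum_i dot (u i) x *: u i.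
have ur i : dot (u i) r = 0.
  rewrite /r -scaleN1r addrC dot_lin dot_sum (bigD1 i) //= big1 => [|j ji].
    by rewrite dotZ ON eqxx mulr1 addr0 mulN1r addNr.
  by rewrite dotZ ON eq_sym (negPf ji) mulr0.
have [r0|r0] := eqVneq r 0.
  exists m, u; split=> // y; rewrite inE => /orP[/eqP ->|/us //].
  by apply/eqP; rewrite -subr_eq0 -/r r0.
have rr0 : dot r r != 0 by apply: contra_neq r0; case: (tr_gram r).
have rrp : 0 <= dot r r by case: (tr_gram r).
have [n nE] : exists n : R, dot r r = n%:C.
  by exists (complex.Re (dot r r)); rewrite RRe_real // ger0_real.
have n0 : 0 < n by move: rr0 rrp; rewrite nE lecR lt_def => h ->; rewrite andbT -(inj_eq (@complexI R)).
pose al := (Num.sqrt n)^-1; pose v := al%:C *: r.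
have al2 : al * (al * n) = 1.
  rewrite /al -{3}(sqr_sqrtr (ltW n0)); field; by rewrite gt_eqF // sqrtr_gt0.
have uv i : dot (u i) v = 0 by rewrite dotZ ur mulr0.
have vu i : dot v (u i) = 0 by rewrite -dot_conj uv rmorph0.
have vr : dot v r = (al * n)%:C.
  by rewrite -dot_conj dotZ nE -rmorphM; exact: conjc_real.
have vv : dot v v = 1 by rewrite dotZ vr -rmorphM al2 rmorph1.
pose w (i : 'I_m.+1) := if unlift ord0 i is Some j then u j else v.
have w0 : w ord0 = v by rewrite /w unlift_none.
have wl j : w (lift ord0 j) = u j by rewrite /w liftK.
exists m.+1, w; split.
  move=> i j; case: (unliftP ord0 i) => [i'|] ->; case: (unliftP ord0 j) => [j'|] ->; rewrite !(w0, wl).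
  - by rewrite ON (inj_eq lift_inj).
  - by rewrite uv lift_eqF.
  - by rewrite vu eq_liftF.
  - by rewrite vv eqxx.
have spanE y : \sum_i dot (w i) y *: w i = dot v y *: v + \sum_i dot (u i) y *: u i.
  by rewrite big_ord_recl w0; congr (_ + _); apply: eq_bigr => i _; rewrite wl.
have v_span y : y = \sum_i dot (u i) y *: u i -> dot v y = 0.
  by move=> ->; rewrite dot_sum big1 // => i _; rewrite dotZ vu mulr0.
move=> y; rewrite spanE inE => /orP[/eqP ->|/us ys]; last by rewrite (v_span _ ys) scale0r add0r.
have xE : x = r + \sum_i dot (u i) x *: u i by rewrite /r subrK.
have vx : dot v x = (al * n)%:C.
  rewrite xE -[r]scale1r dot_lin mul1r vr dot_sum big1 ?addr0 // => i _.
  by rewrite dotZ vu mulr0.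
by rewrite vx /v scalerA -rmorphM mulrC al2 rmorph1 scale1r -xE.
Qed.

Lemma orthonormal_frame : exists m (u : 'I_m -> C),
  (forall i j, dot (u i) (u j) = (i == j)%:R) /\
  (forall x, x = \sum_i dot (u i) x *: u i).
Proof.
have [m [u [ON us]]] := gram_schmidt (codom e).
exists m, u; split=> // x.
have dx i : dot (u i) x = \sum_k co x k * dot (u i) (e k).
  by rewrite {1}(coP x) dot_sum; apply: eq_bigr => k _; rewrite dotZ.
under [RHS]eq_bigr => i _ do rewrite dx scaler_suml.
rewrite [RHS]exchange_big /= {1}(coP x); apply: eq_bigr => k _.
rewrite {1}(us (e k) (codom_f e k)) scaler_sumr; apply: eq_bigr => i _.
by rewrite scalerA.
Qed.

Section Frame.
Variables (m : nat) (u : 'I_m -> C).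
Hypothesis ON : forall i j, dot (u i) (u j) = (i == j)%:R.
Hypothesis uP : forall x, x = \sum_i dot (u i) x *: u i.

Lemma tr_frame x : tr x = \sum_i dot (u i) (x * u i).
Proof.
rewrite /tr; under eq_bigr => k _.
  rewrite {1}(uP (e k)) mulr_sumr co_sum.
  under eq_bigr => i _ do rewrite -cscaleAr coZ mulrC.
over.
rewrite exchange_big /=; apply: eq_bigr => i _.
rewrite [in RHS](coP (x * u i)) dot_sum; apply: eq_bigr => k _.
by rewrite dotZ.
Qed.

Lemma frame_sum : \sum_j u j * adj (u j) = 1.
Proof.
pose z := 1 - \sum_j u j * adj (u j).
have trz x : tr (x * z) = 0.
  rewrite /z mulrBr mulr1 trD trN mulr_sumr tr_sum {1}tr_frame.
  apply/eqP; rewrite subr_eq0; apply/eqP; apply: eq_bigr => j _.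
  by rewrite [in RHS]mulrA [RHS]trC.
have z0 : z = 0 by case: (tr_gram z) => _; apply; exact: trz.
by apply/eqP; rewrite eq_sym -subr_eq0 -/z z0.
Qed.

(** Each coefficient is bounded by Parseval's identity and tr (x^* x) <= |x|^2 tr 1, whence K is the
    root of tr 1. *)
Lemma frame_bound : exists2 K, 0 <= K & forall i x, Normc.normc (dot (u i) x) <= K * nrm x.
Proof.
have [t10 _] := tr_gram 1; rewrite uadj1 mulr1 in t10.
have [t tE] : exists t : R, tr 1 = t%:C.
  by exists (complex.Re (tr 1)); rewrite RRe_real // ger0_real.
rewrite tE lecR in t10.
exists (Num.sqrt t); first exact: sqrtr_ge0.
move=> i x; rewrite -(@ler_pXn2r _ 2) ?nnegrE ?normc_ge0 ?mulr_ge0 ?sqrtr_ge0 ?nrm_ge0 //.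
rewrite exprMn sqr_sqrtr // -lecR.
have le1 : dot x x <= (t * nrm x ^+ 2)%:C.
  have /npos_sqrt[c [/npos_sa ca cc _]] := npos_gram_le (lexx (nrm x)).
  have [h _] := tr_gram c; move: h; rewrite ca cc trD trN trZ tE -rmorphM -/(dot x x) subr_ge0.
  by rewrite mulrC.
apply: le_trans le1.
have -> : dot x x = \sum_j (Normc.normc (dot (u j) x) ^+ 2)%:C.
  rewrite {2}(uP x) dot_sum; apply: eq_bigr => j _.
  by rewrite dotZ -(dot_conj (u j)) mul_conj_normc.
rewrite (bigD1 i) //= lerDl; apply: sumr_ge0 => j _.
by rewrite lecR sqr_ge0.
Qed.

End Frame.
End Basis.

(* A *-representation of [P] by the matrices [cf i (p u_j)], with the completely
   positive left inverse [m |-> \sum_ij m_ij u_i u_j^*]. *)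
Lemma fd_frame : finite_dimensional P -> exists d (u : 'I_d -> C) (cf : 'I_d -> C -> R[i]),
  [/\ forall i k x y, cf i (k *: x + y) = k * cf i x + cf i y,
      exists2 K, 0 <= K & forall i x, Normc.normc (cf i x) <= K * nrm x,
      forall i j, cf i (u j) = (i == j)%:R,
      forall x, x = \sum_i cf i x *: u i
    & (forall i j x, cf i (adj x * u j) = Num.conj (cf j (x * u i))) /\
      \sum_j u j * adj (u j) = 1].
Proof.
move=> /fd_basis[d [e [espan eind]]].
have [co coP] := choice espan.
have [m [u [ON uP]]] := orthonormal_frame coP eind.
exists m, u, (fun i x => dot e co (u i) x); split=> //.
- by move=> i k x y; exact: (dot_lin coP eind).
- exact: (frame_bound coP eind).
- split; last exact: (frame_sum coP eind).
  by move=> i j x; rewrite (dot_conj coP eind) /dot uadjM mulrA.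
Qed.
End Trace.

(** * Tensor products with a finite-dimensional C*-algebra *)

(** Keeps what the sequel needs of [fd_frame]; the trace survives only through the coordinate
    functionals [fcf]. *)
Record frame (R : realType) (P : unitalCStarAlgType R) := Frame {
  fdim : nat;
  fu : 'I_fdim -> ualg P;
  fcf : 'I_fdim -> ualg P -> R[i];
  fcf_lin : forall i k (x y : ualg P), fcf i (k *: x + y) = k * fcf i x + fcf i y;
  fcf_bnd : exists2 K, 0 <= K & forall i x, Normc.normc (fcf i x) <= K * nrm x;
  fcf_u : forall i j, fcf i (fu j) = (i == j)%:R;
  fcfP : forall x : ualg P, x = \sum_i fcf i x *: fu i;
  fcf_adj : forall i j (x : ualg P), fcf i (adj x * fu j) = Num.conj (fcf j (x * fu i));
  fu_sum : \sum_j fu j * adj (fu j) = 1 }.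

Section Tensor.
Variables (R : realType) (P X : unitalCStarAlgType R) (F : frame P).
Local Notation d := (fdim F).
Local Notation u := (@fu R P F).
Local Notation cf := (@fcf R P F).
Local Notation C := (ualg X).
Local Notation Q := (ualg P).
Implicit Types (p q : Q) (k : R[i]).

Lemma cfD i p q : cf i (p + q) = cf i p + cf i q.
Proof. by rewrite -[p]scale1r fcf_lin mul1r scale1r. Qed.
Lemma cf0 i : cf i 0 = 0.
Proof. by apply: (@addIr _ (cf i 0)); rewrite -cfD !add0r. Qed.
Lemma cfZ i k p : cf i (k *: p) = k * cf i p.
Proof. by rewrite -[k *: p]addr0 fcf_lin cf0 addr0. Qed.
Lemma cf_sum i I (r : seq I) (G : I -> Q) : cf i (\sum_(j <- r) G j) = \sum_(j <- r) cf i (G j).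
Proof. by elim/big_rec2: _ => [|j y z _ <-]; rewrite ?cf0 ?cfD. Qed.

Definition lam i j p := cf i (p * u j).

Lemma lamM i j p q : lam i j (p * q) = \sum_l lam i l p * lam l j q.
Proof.
rewrite /lam -mulrA {1}(fcfP F (q * u j)) mulr_sumr cf_sum.
by apply: eq_bigr => l _; rewrite -cscaleAr cfZ mulrC.
Qed.
Lemma lam1 i j : lam i j 1 = (i == j)%:R.
Proof. by rewrite /lam mul1r fcf_u. Qed.
Lemma lam_adj i j p : lam i j (adj p) = Num.conj (lam j i p).
Proof. exact: fcf_adj. Qed.
Lemma lam_sum i j I (r : seq I) (G : I -> Q) :
  lam i j (\sum_(l <- r) G l) = \sum_(l <- r) lam i j (G l).
Proof. by rewrite /lam mulr_suml cf_sum. Qed.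
Lemma lamZ i j k p : lam i j (k *: p) = k * lam i j p.
Proof. by rewrite /lam -cscaleAl cfZ. Qed.
Lemma lamK p : p = \sum_i \sum_j lam i j p *: (u i * adj (u j)).
Proof.
rewrite exchange_big /= -[LHS]mulr1 -[in LHS](fu_sum F) mulr_sumr.
apply: eq_bigr => j _; rewrite mulrA {1}(fcfP F (p * u j)) mulr_suml.
by apply: eq_bigr => i _; rewrite -cscaleAl.
Qed.

Local Notation V := {ffun 'I_d -> X}.
Implicit Types (x y : V).

(** The matrix over X of the element \sum_l u_l (x) x_l, by the left regular representation on the
    first leg. *)
Definition tmx (x : 'I_d -> C) : 'I_d -> 'I_d -> C := fun i j => \sum_l lam i j (u l) *: x l.

(** Applying [cf l] to [lamK] at [u m] shows that the coefficient of [x m] on the right is 1 for m =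
    l and 0 otherwise. *)
Lemma tmxK (x : 'I_d -> C) l : x l = \sum_i \sum_j cf l (u i * adj (u j)) *: tmx x i j.
Proof.
rewrite /tmx; under eq_bigr => i _.
  under eq_bigr => j _ do rewrite scaler_sumr.
  rewrite exchange_big /=.
over.
rewrite exchange_big /= (bigD1 l) //= [X in _ + X]big1 ?addr0 => [|m ml].
  under eq_bigr => i _ do (under eq_bigr => j _ do rewrite scalerA; rewrite -scaler_suml).
  rewrite -scaler_suml (_ : \sum_i _ = 1) ?scale1r //.
  rewrite -[RHS](_ : cf l (u l) = 1); last by rewrite fcf_u eqxx.
  rewrite [in RHS](lamK (u l)) cf_sum; apply: eq_bigr => i _; rewrite cf_sum.
  by apply: eq_bigr => j _; rewrite cfZ mulrC.
under eq_bigr => i _ do (under eq_bigr => j _ do rewrite scalerA; rewrite -scaler_suml).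
rewrite -scaler_suml (_ : \sum_i _ = 0) ?scale0r //.
rewrite -[RHS](_ : cf l (u m) = 0); last by rewrite fcf_u eq_sym (negPf ml).
rewrite [in RHS](lamK (u m)) cf_sum; apply: eq_bigr => i _; rewrite cf_sum.
by apply: eq_bigr => j _; rewrite cfZ mulrC.
Qed.

Definition temb x : lop (colmod X d) := loc (mxop (tmx x)).

Lemma tembE x i j : temb x (ecol X i) (ecol X j) = tmx x i j.
Proof. exact: loc_mx_entry. Qed.

Lemma temb_inj : injective temb.
Proof.
move=> x y xy; apply/ffunP => l; rewrite (tmxK x) (tmxK y).
by apply: eq_bigr => i _; apply: eq_bigr => j _; rewrite -!tembE xy.
Qed.

Lemma loc_mx_ext n (b c : 'I_n -> 'I_n -> C) : b =2 c -> loc (mxop b) = loc (mxop c).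
Proof.
move=> bc; apply: lop_eq => x y; rewrite !locE; congr ip; apply: functional_extensionality_dep => i.
by apply: eq_bigr => j _; rewrite bc.
Qed.

Lemma loc_mx_lin n (b c : 'I_n -> 'I_n -> C) k :
  loc (mxop (fun i j => k *: b i j + c i j)) = k *: loc (mxop b) + loc (mxop c).
Proof.
rewrite -loc_lin; apply: lop_eq => x y; rewrite !locE; congr ip.
apply: functional_extensionality_dep => i.
rewrite /= /mxop_fun scaler_sumr -big_split; apply: eq_bigr => j _ /=.
by rewrite mulrDl cscaleAl.
Qed.

Lemma loc_mx_mul n (b c : 'I_n -> 'I_n -> C) :
  loc (mxop (fun i j => \sum_l b i l * c l j)) = lop_mul (loc (mxop b)) (loc (mxop c)).
Proof.
rewrite -loc_mul; apply: lop_eq => x y; rewrite !locE; congr ip.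
apply: functional_extensionality_dep => i; rewrite /= /mxop_fun.
under eq_bigr => j _ do rewrite mulr_suml.
rewrite exchange_big /=; apply: eq_bigr => l _; rewrite mulr_sumr.
by apply: eq_bigr => j _; rewrite mulrA.
Qed.

Lemma loc_mx_adj n (b : 'I_n -> 'I_n -> C) :
  loc (mxop (fun i j => adj (b j i))) = lop_adj (loc (mxop b)).
Proof. by rewrite -loc_adj; apply: lop_eq. Qed.

Lemma loc_mx1 n : loc (mxop (fun i j : 'I_n => (i == j)%:R : C)) = loc (op1 (colmod X n)).
Proof.
apply: lop_eq => x y; rewrite !locE; congr ip; apply: functional_extensionality_dep => i.
rewrite /= /mxop_fun (bigD1 i) //= eqxx mul1r big1 ?addr0 // => j.
by rewrite eq_sym => /negPf ->; rewrite mul0r.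
Qed.

Lemma temb_lin k x y : temb (k *: x + y) = k *: temb x + temb y.
Proof.
rewrite -loc_mx_lin; apply: loc_mx_ext => i j; rewrite scaler_sumr -big_split.
apply: eq_bigr => l _ /=; rewrite !ffunE scalerDr !scalerA; congr (_ *: _ + _).
by rewrite mulrC.
Qed.
Lemma tembD x y : temb (x + y) = temb x + temb y.
Proof. by rewrite -[x]scale1r temb_lin !scale1r. Qed.
Lemma temb0 : temb 0 = 0.
Proof. by apply: (@addIr _ (temb 0)); rewrite -tembD !add0r. Qed.
Lemma tembZ k x : temb (k *: x) = k *: temb x.
Proof. by rewrite -[k *: x]addr0 temb_lin temb0 addr0. Qed.

Definition tmul x y : V :=
  [ffun n => \sum_l \sum_m cf n (u l * u m) *: ((x l : C) * (y m : C))].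
Definition tadj x : V := [ffun n => \sum_l cf n (adj (u l)) *: adj (x l)].
Definition tone : V := [ffun n => cf n 1 *: (1 : C)].

Lemma tmx_comb (I : finType) (a : I -> Q) (x : I -> C) i j :
  tmx (fun n => \sum_l cf n (a l) *: x l) i j = \sum_l lam i j (a l) *: x l.
Proof.
rewrite /tmx; under eq_bigr => n _ do rewrite scaler_sumr.
rewrite exchange_big; apply: eq_bigr => l _ /=.
rewrite [in RHS](fcfP F (a l)) lam_sum scaler_suml; apply: eq_bigr => n _.
by rewrite lamZ scalerA mulrC.
Qed.

Lemma tmx_ext (x y : 'I_d -> C) i j : x =1 y -> tmx x i j = tmx y i j.
Proof. by move=> xy; apply: eq_bigr => l _; rewrite xy. Qed.

Lemma temb_mul x y : temb (tmul x y) = lop_mul (temb x) (temb y).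
Proof.
rewrite -loc_mx_mul; apply: loc_mx_ext => i j.
pose a (s : 'I_d * 'I_d) := u s.1 * u s.2; pose z (s : 'I_d * 'I_d) := (x s.1 : C) * (y s.2 : C).
rewrite (@tmx_ext _ (fun n => \sum_s cf n (a s) *: z s)) => [|n]; last first.
  by rewrite ffunE pair_bigA.
rewrite tmx_comb -(pair_bigA _ (fun l m => lam i j (u l * u m) *: ((x l : C) * (y m : C)))) /=.
under eq_bigr => l _ do (under eq_bigr => m _ do rewrite lamM scaler_suml).
under [RHS]eq_bigr => r _.
  rewrite /tmx mulr_suml; under eq_bigr => l _ do rewrite mulr_sumr.
over.
rewrite [RHS]exchange_big /=; apply: eq_bigr => l _.
rewrite [RHS]exchange_big /=; apply: eq_bigr => m _; apply: eq_bigr => r _.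
by rewrite -cscaleAl -cscaleAr scalerA.
Qed.

Lemma temb_adj x : temb (tadj x) = lop_adj (temb x).
Proof.
rewrite -loc_mx_adj; apply: loc_mx_ext => i j.
rewrite (@tmx_ext _ (fun n => \sum_l cf n (adj (u l)) *: adj (x l))) => [|n]; last by rewrite ffunE.
rewrite tmx_comb /tmx adj_sum; apply: eq_bigr => l _.
by rewrite cadjZ lam_adj.
Qed.

Lemma temb_one : temb tone = loc (op1 (colmod X d)).
Proof.
rewrite -loc_mx1; apply: loc_mx_ext => i j.
rewrite (@tmx_ext _ (fun n => \sum_(l : 'I_1) cf n 1 *: (1 : C))) => [|n]; last first.
  by rewrite ffunE big_ord1.
by rewrite tmx_comb big_ord1 lam1 scaler_nat.
Qed.

(** The norm of P (x) X acting on X^d; the algebraic laws and the C*-identity are pulled back along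
    the injection [temb]. *)
Definition tnorm x : R := lnorm (temb x).

Fact tnormD x y : tnorm (x + y) <= tnorm x + tnorm y.
Proof. by rewrite /tnorm tembD lnormD. Qed.
Fact tnormZ k x : tnorm (k *: x) = Normc.normc k * tnorm x.
Proof. by rewrite /tnorm tembZ lnormZ. Qed.
Fact tnorm0 x : tnorm x = 0 -> x = 0.
Proof. by move=> /lnorm0_eq0 x0; apply: temb_inj; rewrite x0 temb0. Qed.
Fact tmulA : associative tmul.
Proof. by move=> x y z; apply: temb_inj; rewrite !temb_mul lop_mulA. Qed.
Fact tmull y : linear (tmul^~ y).
Proof.
move=> k x z; apply: temb_inj; rewrite temb_mul !temb_lin !temb_mul.
exact: (lop_mull (temb y) k (temb x) (temb z)).
Qed.
Fact tmulr x : linear (tmul x).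
Proof.
move=> k y z; apply: temb_inj; rewrite temb_mul !temb_lin !temb_mul.
exact: (lop_mulr (temb x) k (temb y) (temb z)).
Qed.
Fact tadjL k x y : tadj (k *: x + y) = Num.conj k *: tadj x + tadj y.
Proof. by apply: temb_inj; rewrite temb_adj !temb_lin !temb_adj lop_adj_lin. Qed.
Fact tadjM x y : tadj (tmul x y) = tmul (tadj y) (tadj x).
Proof. by apply: temb_inj; rewrite temb_adj !temb_mul !temb_adj lop_adjM. Qed.
Fact tadjK : involutive tadj.
Proof. by move=> x; apply: temb_inj; rewrite !temb_adj lop_adjK. Qed.
Fact tnormM x y : tnorm (tmul x y) <= tnorm x * tnorm y.
Proof. by rewrite /tnorm temb_mul lnormM. Qed.
Fact tnorm_cstar x : tnorm (tmul (tadj x) x) = tnorm x ^+ 2.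
Proof. by rewrite /tnorm temb_mul temb_adj lnorm_cstar. Qed.
Fact tmul1x : left_id tone tmul.
Proof. by move=> x; apply: temb_inj; rewrite temb_mul temb_one lop_mul1x. Qed.
Fact tmulx1 : right_id tone tmul.
Proof. by move=> x; apply: temb_inj; rewrite temb_mul temb_one lop_mulx1. Qed.

(** With [tnorm_le], the norm is equivalent to the sum of the coordinate norms; completeness thus
    comes from that of X. *)
Lemma tcoord_bound : exists2 K, 0 <= K & forall x l, nrm (x l : C) <= K * tnorm x.
Proof.
pose c l := \sum_i \sum_j Normc.normc (cf l (u i * adj (u j))) *
  (3 * (nrm (ip (ecol X i) (ecol X i)) + nrm (ip (ecol X j) (ecol X j)))).
have c0 l : 0 <= c l.
  by do 2!(apply: sumr_ge0 => ? _); rewrite !mulr_ge0 ?normc_ge0 ?addr_ge0 ?nrm_ge0.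
exists (\sum_l c l); first by apply: sumr_ge0 => l _.
move=> x l; apply: (@le_trans _ _ (c l * tnorm x)); last first.
  by rewrite ler_wpM2r ?lnorm_ge0 // (bigD1 l) //= lerDl; apply: sumr_ge0.
rewrite (tmxK x l) (le_trans (nrm_sum _ _ _)) // mulr_suml; apply: ler_sum => i _.
rewrite (le_trans (nrm_sum _ _ _)) // mulr_suml; apply: ler_sum => j _.
rewrite nrmZ -mulrA ler_wpM2l ?normc_ge0 // -tembE mulrAC.
exact: lop_nrm.
Qed.

Lemma tnorm_le : exists2 K, 0 <= K & forall x, tnorm x <= K * \sum_l nrm (x l : C).
Proof.
pose K := \sum_i \sum_j \sum_l Normc.normc (lam i j (u l)).
have K0 i j : 0 <= \sum_l Normc.normc (lam i j (u l)).
  by apply: sumr_ge0 => l _; exact: normc_ge0.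
exists K; first by do 2!(apply: sumr_ge0 => ? _).
move=> x; rewrite (le_trans (lnorm_mx _)) // mulr_suml; apply: ler_sum => i _.
rewrite mulr_suml; apply: ler_sum => j _.
rewrite (le_trans (nrm_sum _ _ _)) // mulr_suml; apply: ler_sum => l _.
rewrite nrmZ ler_wpM2l ?normc_ge0 // (bigD1 l) //= lerDl.
by apply: sumr_ge0 => m _; exact: nrm_ge0.
Qed.

Fact tcomplete (v : nat -> V) :
  (forall e, 0 < e -> exists N, forall m n, (N <= m)%N -> (N <= n)%N ->
     tnorm (v m - v n) <= e) ->
  exists l, forall e, 0 < e -> exists N, forall n, (N <= n)%N -> tnorm (v n - l) <= e.
Proof.
move=> cv; have [K K0 HK] := tcoord_bound; have [K' K'0 HK'] := tnorm_le.
have lim_ex l : exists z : C, lims (fun n => (v n l : C)) z.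
  apply: cauchy_lims => e e0.
  have K1 : 0 < K + 1 by rewrite ltr_wpDl.
  have [N HN] := cv _ (divr_gt0 e0 K1); exists N => m n Nm Nn.
  have -> : (v m l : C) - v n l = (v m - v n) l by rewrite !ffunE.
  rewrite (le_trans (HK _ _)) // (le_trans (ler_wpM2l K0 (HN m n Nm Nn))) //.
  by rewrite mulrCA ger_pMr // ler_pdivrMr // mul1r lerDl.
have [z Hz] := choice lim_ex.
exists [ffun l => z l] => e e0.
pose D := K' * d%:R + 1; have D0 : 0 < D by rewrite ltr_wpDl // mulr_ge0.
have [N HN] : exists N, forall l n, (N <= n)%N -> nrm ((v n l : C) - z l) <= e / D.
  have [N HN] := choice (fun l => Hz l _ (divr_gt0 e0 D0)).
  exists (\max_l N l) => l n Nn; apply: HN; apply: leq_trans Nn; exact: leq_bigmax.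
exists N => n Nn; rewrite (le_trans (HK' _)) //.
apply: (@le_trans _ _ (K' * \sum_(l < d) (e / D))).
  rewrite ler_wpM2l //; apply: ler_sum => l _.
  by rewrite !ffunE; exact: HN.
rewrite sumr_const card_ord -mulr_natr.
have -> : K' * (e / D * d%:R) = e * (K' * d%:R) / D by ring.
by rewrite ler_pdivrMr // ler_pM2l // lerDl.
Qed.

Definition tensorData : cstarData R := @CStarData R V tnorm tmul tadj tone
  tnormD tnormZ tnorm0 tmulA tmull tmulr tadjL tadjM tadjK tnormM tnorm_cstar
  tmul1x tmulx1 tcomplete.

Definition tensor : unitalCStarAlgType R := cstar_of tensorData.

Definition ttau (p : P) (x : X) : tensor := [ffun l => cf l p *: (x : C)].

Lemma fu_indep : lin_indep u.
Proof.
move=> c c0 i; have := cf_sum i (index_enum 'I_d) (fun j => c j *: u j).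
rewrite c0 cf0 (bigD1 i) //= cfZ fcf_u eqxx mulr1 big1 ?addr0 // => j ji.
by rewrite cfZ fcf_u eq_sym (negPf ji) mulr0.
Qed.

Lemma ttau_sum (x : tensor) : x = \sum_l ttau (u l) ((x : V) l).
Proof.
apply/ffunP => l; rewrite -[in RHS]/(V) sum_ffunE (bigD1 l) //= ffunE fcf_u eqxx scale1r.
rewrite big1 ?addr0 // => m ml; by rewrite ffunE fcf_u eq_sym (negPf ml) scale0r.
Qed.

Lemma ttau_star_tensor : star_tensor ttau.
Proof.
split.
- split=> [x k p q|p k x y]; apply/ffunP => l; rewrite !ffunE.
    by rewrite fcf_lin scalerDl scalerA.
  by rewrite scalerDr !scalerA mulrC.
- move=> p q x y; apply/ffunP => n; rewrite !ffunE.
  under eq_bigr => l _ do under eq_bigr => m _ do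
    rewrite !ffunE -cscaleAl -cscaleAr !scalerA.
  under eq_bigr => l _ do rewrite -scaler_suml.
  rewrite -scaler_suml; congr (_ *: _).
  rewrite -[p ** q]/((p : Q) * (q : Q)) [in RHS](fcfP F p) mulr_suml cf_sum; apply: eq_bigr => l _.
  rewrite [in RHS](fcfP F q) mulr_sumr cf_sum; apply: eq_bigr => m _.
  by rewrite -cscaleAl -cscaleAr !cfZ; ring.
- move=> p x; apply/ffunP => n; rewrite !ffunE.
  under eq_bigr => l _ do rewrite ffunE cadjZ scalerA.
  rewrite -scaler_suml; congr (_ *: _).
  rewrite [in RHS](fcfP F p) adj_sum cf_sum; apply: eq_bigr => l _.
  by rewrite cadjZ cfZ mulrC.
- move=> n a b a_indep ab0 i.
  (* Independence of the [a i] says that their coordinate matrix has full row rank; its right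
     inverse N recovers each [b i] from the vanishing coordinates. *)
  pose M := \matrix_(i < n, l < d) cf l (a i).
  have /row_freeP[N MN] : row_free M.
    apply: inj_row_free => v vM; apply/rowP => m; rewrite mxE; move: m; apply: a_indep.
    rewrite [LHS](fcfP F) big1 // => l _.
    have := congr1 (fun w : 'rV_d => w 0 l) vM; rewrite !mxE => vl.
    suff -> : cf l (\sum_j v 0 j *: a j) = 0 by rewrite scale0r.
    by rewrite cf_sum -[RHS]vl; apply: eq_bigr => j _; rewrite cfZ !mxE.
  have ab l : \sum_j cf l (a j) *: (b j : C) = 0.
    have := congr1 (fun w : V => w l) ab0; rewrite /= [RHS]ffunE => E.
    by rewrite -[RHS]E sum_ffunE; apply: eq_bigr => j _; rewrite ffunE.
  have MNE j : \sum_l N l i * cf l (a j) = (j == i)%:R.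
    have := congr1 (fun w : 'M[R[i]]_n => w j i) MN; rewrite !mxE => E; rewrite -[RHS]E.
    by apply: eq_bigr => l _; rewrite !mxE mulrC.
  have -> : b i = \sum_l N l i *: \sum_j cf l (a j) *: (b j : C).
    under eq_bigr => l _ do rewrite scaler_sumr.
    rewrite exchange_big /=; under eq_bigr => j _ do
      (under eq_bigr => l _ do rewrite scalerA; rewrite -scaler_suml MNE).
    rewrite (bigD1 i) //= eqxx scale1r big1 ?addr0 // => j /negPf ->; by rewrite scale0r.
  by rewrite big1 // => l _; rewrite ab scaler0.
Qed.

Lemma ttau_span (x : tensor) : lin_span [set t : tensor | exists a b, t = ttau a b] x.
Proof.
exists d, (fun=> 1), (fun l => ttau (u l) ((x : V) l)); split.
  by move=> l; exists (u l), ((x : V) l).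
by rewrite {1}(ttau_sum x); apply: eq_bigr => l _; rewrite scale1r.
Qed.

(** Every tensor product receives the concrete one injectively, since the [u l] are independent;
    norms can then be compared by [injective_star_hom_nrm]. *)
Lemma star_tensor_hom (T : cstarAlgType R) (tau : P -> X -> T) : star_tensor tau ->
  let f (x : tensor) := \sum_l tau (u l) ((x : V) l) in
  [/\ star_hom f, injective f & forall p (x : X), f (ttau p x) = tau p x].
Proof.
move=> [[taul taur] tauM tauA tau_indep] f.
have fL : linear f.
  move=> k x y; rewrite /f scaler_sumr -big_split; apply: eq_bigr => l _ /=.
  by rewrite !ffunE taur.
have fS := lin_sum fL.
have ft p (x : X) : f (ttau p x) = tau p x.
  rewrite /f [in RHS](fcfP F p) (lin_sum (taul x)).
  by apply: eq_bigr => l _; rewrite ffunE (linZ (taur _)) (linZ (taul _)).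
have [_ ttM ttA _] := ttau_star_tensor.
split=> //.
  split=> // [x y|x].
    have -> : x ** y = \sum_l \sum_m ttau (u l) ((x : V) l) ** ttau (u m) ((y : V) m).
      rewrite {1}(ttau_sum x) {1}(ttau_sum y) cmul_suml.
      by apply: eq_bigr => l _; rewrite cmul_sumr.
    rewrite fS [in RHS]/f cmul_suml; apply: eq_bigr => l _.
    rewrite fS cmul_sumr; apply: eq_bigr => m _.
    by rewrite ttM ft tauM.
  have -> : adj x = \sum_l adj (ttau (u l) ((x : V) l)) by rewrite {1}(ttau_sum x) adj_sum.
  rewrite fS [in RHS]/f adj_sum; apply: eq_bigr => l _.
  by rewrite ttA ft tauA.
move=> x y xy; apply/eqP; rewrite -subr_eq0; apply/eqP.
have : f (x - y) = 0 by rewrite -scaleN1r addrC fL xy scaleN1r addNr.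
by move=> /(tau_indep _ _ _ fu_indep) h; apply/ffunP => l; rewrite h ffunE.
Qed.

(** The algebraic tensor product with a finite-dimensional [P] is already complete for [tnorm], so
    an injective *-homomorphism out of it cannot decrease the norm. *)
Lemma ttau_min_tensor : min_tensor ttau.
Proof.
split; [exact: ttau_star_tensor | by move=> O [x Ox] _; exists x; split=> //; exact: ttau_span |].
move=> T tau /star_tensor_hom[sf f_inj ft] n a b.
have [fL _ _] := sf.
have h := injective_star_hom_nrm sf f_inj (\sum_i ttau (a i) (b i)).
rewrite !nrmE lecR (le_trans h) // le_eqVlt; apply/orP; left; apply/eqP; congr nrm.
by rewrite (lin_sum fL); apply: eq_bigr => i _; rewrite ft.
Qed.

End Tensor.

Lemma linear_dominated_continuous (R : realType) (U V : normedModType R[i]) (f : U -> V) (K : R) :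
  linear f -> 0 <= K -> (forall x, `|f x| <= K%:C * `|x|) -> continuous f.
Proof.
move=> fL K0 fK x; apply/cvgrPdist_lt => e e0.
have K1 : 0 < (K + 1)%:C :> R[i] by rewrite ltcR ltr_wpDl.
near=> y; rewrite -(linB fL).
apply: (@le_lt_trans _ _ ((K + 1)%:C * `|x - y|)).
  by rewrite (le_trans (fK _)) // ler_wpM2r // lecR lerDl.
rewrite mulrC -ltr_pdivlMr //.
near: y; apply/nbhs_ballP; exists (e / (K + 1)%:C) => /=; first by rewrite divr_gt0.
by move=> y; rewrite -ball_normE.
Unshelve. all: by end_near. Qed.

Lemma dense_approx (R : realType) (A : cstarAlgType R) (D : set A) (x : A) (e : R) :
  dense D -> 0 < e -> exists2 y, D y & nrm (x - y) < e.
Proof.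
move=> dD e0; have e0' : 0 < e%:C :> R[i] by rewrite ltcR.
have [y [xy Dy]] : interior (ball x e%:C) `&` D !=set0.
  by apply: dD; [exists x; exact: nbhsx_ballx | exact: open_interior].
exists y => //; have := interior_subset xy.
by rewrite -ball_normE /ball_ /= nrmE ltcR.
Qed.

Section Coordinates.
Variables (R : realType) (P M : unitalCStarAlgType R) (T : cstarAlgType R) (F : frame P).
Variable (tau : P -> M -> T).
Hypothesis tau_min : min_tensor tau.
Local Notation d := (fdim F).
Local Notation u := (@fu R P F).
Local Notation cf := (@fcf R P F).

(** The canonical map g from the concrete tensor product to [T] is isometric: one inequality is
    [injective_star_hom_nrm], the other is minimality of [tau]. Its range is then closed, and dense
    by assumption, so g has an inverse, which is [G]. *)
Lemma tensor_coordinates : exists G : T -> {ffun 'I_d -> M},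
  [/\ @star_hom R T (tensor M F) G, forall l, continuous (fun t => G t l),
      forall p m, G (tau p m) = ttau F p m &
      forall t, t = \sum_l tau (u l) (G t l)].
Proof.
have [ts tdense tmin] := tau_min.
have [sf g_inj gt] := @star_tensor_hom R P M F T tau ts.
set g := (fun x => \sum_l _) in sf g_inj gt.
have [gL _ _] := sf.
have g_ge := injective_star_hom_nrm sf g_inj.
have g_le x : nrm (g x) <= nrm x.
  rewrite -lecR -!nrmE {2}(ttau_sum x); apply: tmin; exact: ttau_star_tensor.
have g_span t : lin_span [set t : T | exists a b, t = tau a b] t -> exists x, g x = t.
  move=> [n [c [s [sP ->]]]].
  have ex i : exists x, g x = s i.
    by have [a [b ->]] := sP i; exists (ttau F a b); exact: gt.
  have [xs xsP] := choice ex.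
  exists (\sum_i c i *: xs i); rewrite (lin_sum gL); apply: eq_bigr => i _.
  by rewrite (linZ gL) xsP.
have g_surj t : exists x, g x = t.
  have ex (n : nat) : exists x, nrm (t - g x) < n.+1%:R^-1.
    have n0 : 0 < n.+1%:R^-1 :> R by rewrite invr_gt0.
    by have [_ /g_span[x <-] tx] := dense_approx t tdense n0; exists x.
  have [x xP] := choice ex.
  have [|l xl] := @cauchy_lims R (tensor M F) x.
    move=> e e0; have [N HN] := invn_lt (divr_gt0 e0 (ltr0Sn R 1)).
    exists N => m n Nm Nn; rewrite (le_trans (g_ge _)) // (linB gL).
    have -> : g (x m) - g (x n) = (t - g (x n)) - (t - g (x m)).
      by rewrite opprB [RHS]addrC addrA subrK.
    rewrite (le_trans (nrmB _ _)) // [leRHS]splitr lerD //.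
      by rewrite ltW // (lt_trans (xP n)) // HN.
    by rewrite ltW // (lt_trans (xP m)) // HN.
  exists l; apply/eqP; rewrite -subr_eq0; apply/eqP/nrm_small => e e0.
  have [N1 H1] := invn_lt (divr_gt0 e0 (ltr0Sn R 1)).
  have [N2 H2] := xl _ (divr_gt0 e0 (ltr0Sn R 1)).
  pose n := maxn N1 N2.
  have -> : g l - t = - (g (x n - l)) - (t - g (x n)).
    by rewrite (linB gL) !opprB addrA subrK.
  rewrite (le_trans (nrmB _ _)) // nrmN [leRHS]splitr lerD //.
    by rewrite (le_trans (g_le _)) // H2 // leq_maxr.
  by rewrite ltW // (lt_trans (xP n)) // H1 // leq_maxl.
have [h hP] := choice g_surj.
have hg x : h (g x) = x by apply: g_inj; rewrite hP.
have hL : linear h by move=> k x y; apply: g_inj; rewrite gL !hP.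
have h_le t : nrm (h t) <= nrm t by rewrite -{2}(hP t).
have GL l : linear (fun t => (h t : {ffun 'I_d -> M}) l).
  by move=> k x y; rewrite hL !ffunE.
have [_ gM gA] := sf.
exists (h : T -> {ffun 'I_d -> M}); split.
- split=> // [x y|x]; apply: g_inj; first by rewrite gM !hP.
  by rewrite gA !hP.
- move=> l; have [K K0 HK] := tcoord_bound M F.
  apply: (linear_dominated_continuous (GL l) K0) => t.
  rewrite !nrmE -rmorphM lecR (le_trans (HK (h t) l)) // ler_wpM2l //; exact: h_le.
- by move=> p m; rewrite -gt hg.
- by move=> t; rewrite -{1}(hP t).
Qed.

End Coordinates.

(** * Stinespring dilation *)

Section VectorStates.
Variables (R : realType) (B : unitalCStarAlgType R) (H : preHilb B).
Local Notation C := (ualg B).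
Implicit Types (x y z w : H) (b : C).

Lemma npos_lims (p : nat -> C) l : lims p l -> (forall n, npos (p n)) -> npos l.
Proof.
move=> pl pp; apply: npos_closed => e /pl[N HN]; exists (p N) => //.
by rewrite nrmC HN.
Qed.

Lemma lop_actr (t : lop H) x y b : t x (hact y b) = t x y * b.
Proof.
have [T Tt] := flim_ex t; apply: lims_uniq (flim_point x (hact y b) Tt) _ => e.
move=> /(limsM (flim_point x y Tt) (lims_cst b))[N HN]; exists N => n /HN.
by rewrite -!opP ip_act.
Qed.
Lemma lop_actl (t : lop H) x y b : t (hact x b) y = adj b * t x y.
Proof.
have [T Tt] := flim_ex t; apply: lims_uniq (flim_point (hact x b) y Tt) _ => e.
move=> /(limsM (lims_cst (adj b)) (flim_point x y Tt))[N HN]; exists N => n /HN.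
by rewrite ip_actl.
Qed.

(** The vector [w] serves to write the empty combination, as [hlin (-1) w w]. *)
Lemma hcomb w I (r : seq I) (h : I -> H) (v : I -> C) :
  exists z, forall y, ip y z = \sum_(i <- r) ip y (h i) * v i.
Proof.
elim: r => [|i r [z zP]].
  by exists (hlin (-1) w w) => y; rewrite big_nil ip_lin scaleN1r addNr.
exists (hlin 1 (hact (h i) (v i)) z) => y.
by rewrite big_cons ip_lin scale1r ip_act zP.
Qed.

(** For operators Y_i, the sum of v_i^* <Y_i w, Y_j w> v_j is the inner square of the combination of
    the Y_i w with coefficients v_i. Limits give the general case, and [psd_mx_positive] turns
    positivity of the form into a factorisation. *)
Lemma vector_state_cp w n (x : 'M[cstar_of (lopData H)]_n) : mx_positive x ->
  exists c : 'I_n -> 'I_n -> C, forall i j, (x i j : lop H) w w = \sum_l adj (c l i) * c l j.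
Proof.
move=> [y xy]; apply: (psd_mx_positive (b := fun i j => (x i j : lop H) w w)) => v.
have [Y0 HY0] := choice (fun li : 'I_n * 'I_n => flim_ex (y li.1 li.2)).
pose Y l i m := Y0 (l, i) m.
have HY l i : flim (Y l i) (y l i) := HY0 (l, i).
have xE i j : (x i j : lop H) w w = \sum_l lop_mul (lop_adj (y l i)) (y l j) w w.
  rewrite xy; elim/big_rec2: _ => // l a t _ <-; exact: lopD.
pose p m := \sum_i \sum_j adj (v i) * (\sum_l ip (Y l i m w) (Y l j m w)) * v j.
apply: (@npos_lims p).
  apply: lims_sum => i; apply: lims_sum => j.
  apply: (limsM _ (lims_cst _)); apply: (limsM (lims_cst _)); rewrite xE.
  apply: lims_sum => l e.
  move=> /(flim_point w w (flim_mul (flim_adj (HY l i)) (HY l j)))[N HN].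
  by exists N => m /HN /=; rewrite op_adj_adj.
move=> m; rewrite /p.
have -> : \sum_i \sum_j adj (v i) * (\sum_l ip (Y l i m w) (Y l j m w)) * v j =
   \sum_l \sum_i \sum_j adj (v i) * ip (Y l i m w) (Y l j m w) * v j.
  rewrite [RHS]exchange_big /=; apply: eq_bigr => i _; rewrite [RHS]exchange_big /=.
  by apply: eq_bigr => j _; rewrite mulr_sumr mulr_suml.
apply: npos_sum => l _.
have [z zP] := hcomb w (index_enum 'I_n) (fun i => Y l i m w) v.
have := ip_pos z; congr npos; rewrite zP.
under eq_bigr => j _ do rewrite -ip_adj zP adj_sum mulr_suml.
rewrite exchange_big /=; apply: eq_bigr => i _; apply: eq_bigr => j _.
by rewrite uadjM ip_adj.
Qed.

Section RankOne.
Variables (x y : H) (b : C).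
Hypotheses (x1 : ip x x = 1) (y1 : ip y y = 1).

Fact rank_one_adj z z' : ip (hact y (adj b * ip x z)) z' = ip z (hact x (b * ip y z')).
Proof. by rewrite ip_actl ip_act uadjM adjK ip_adj mulrA. Qed.
Fact rank_one_bnd : exists2 c, 0 <= c & bnd (opform (fun z => hact x (b * ip y z))) c.
Proof.
have c0 : 0 < nrm b + 1 by rewrite ltr_wpDl // nrm_ge0.
exists (nrm b + 1); first exact: ltW.
apply: (bnd_of_gram rank_one_adj c0) => z.
have bc : nrm b <= nrm b + 1 by rewrite lerDl.
(* The component of z orthogonal to the unit vector y: its inner square yields Bessel's
   inequality. *)
set v := hlin (-1) (hact y (ip y z)) z.
have vv : ip v v = ip z z - adj (ip y z) * ip y z.
  rewrite {2}/v ip_lin ip_act /v !ip_linl !ip_actl y1 rmorphN1 !scaleN1r mulr1.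
  by rewrite -[ip z y]ip_adj addNr mul0r oppr0 add0r addrC.
have p1 := nposZ (sqr_ge0 (nrm b + 1)) (ip_pos v).
have p2 := npos_conj (ip y z) (npos_gram_le bc).
have := nposD p1 p2; congr npos; rewrite vv ip_act ip_actl x1 mulr1 uadjM.
by rewrite scalerBr mulrBr mulrBl -cscaleAr -cscaleAl mulr1; ncr.
Qed.
(** The operator |x> b <y|. *)
Definition rank_one : op H := Op rank_one_adj rank_one_bnd.
End RankOne.

End VectorStates.

(** * The doubled Stinespring module of a completely positive matrix of maps *)

Section Stinespring.
Variables (R : realType) (O B : unitalCStarAlgType R) (d : nat).
Local Notation A := (ualg O).
Local Notation C := (ualg B).
Variable beta : 'I_d -> 'I_d -> A -> C.
Hypothesis beta_lin : forall i j k a a', beta i j (k *: a + a') = k *: beta i j a + beta i j a'.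
Hypothesis beta_cp : forall n (a : 'I_n -> A) (i : 'I_n -> 'I_d),
  exists m (c : 'I_m -> 'I_n -> C), forall r s,
  beta (i r) (i s) (adj (a r) * a s) = \sum_l adj (c l r) * c l s.
Hypothesis beta1 : forall i j, beta i j 1 = (i == j)%:R.

(* Two orthogonal copies of the GNS-type module of [beta]. *)
Local Notation Om := (A * 'I_d * bool)%type.
(** The generator (a, i, s) stands for r(a) xi_i in copy s; distinct flags make the copies
    orthogonal. *)
Definition stin_ker (w w' : Om) : C :=
  if w.2 == w'.2 then beta w.1.2 w'.1.2 (adj w.1.1 * w'.1.1) else 0.
Definition stin_ip (x y : seq (Om * C)) : C :=
  \sum_(p <- x) \sum_(q <- y) adj p.2 * stin_ker p.1 q.1 * q.2.
Definition stin_lin (k : R[i]) (x y : seq (Om * C)) :=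
  [seq (p.1, k *: p.2) | p <- x] ++ y.
Definition stin_act (x : seq (Om * C)) (b : C) := [seq (p.1, p.2 * b) | p <- x].

Fact stin_ip_lin k x y z : stin_ip x (stin_lin k y z) = k *: stin_ip x y + stin_ip x z.
Proof.
rewrite /stin_ip scaler_sumr -big_split; apply: eq_bigr => p _ /=.
rewrite big_cat big_map scaler_sumr; congr (_ + _).
by apply: eq_bigr => q _ /=; rewrite cscaleAr.
Qed.

Fact stin_ip_act x y b : stin_ip x (stin_act y b) = stin_ip x y * b.
Proof.
rewrite /stin_ip mulr_suml; apply: eq_bigr => p _.
by rewrite big_map mulr_suml; apply: eq_bigr => q _; rewrite mulrA.
Qed.

Lemma beta_adj i j (a a' : A) : adj (beta i j (adj a * a')) = beta j i (adj a' * a).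
Proof.
have [m [c cP]] := beta_cp (fun r : 'I_2 => if r == ord0 then a else a')
  (fun r : 'I_2 => if r == ord0 then i else j).
have := cP ord0 ord_max; have := cP ord_max ord0; rewrite /= => -> ->.
by rewrite adj_sum; apply: eq_bigr => l _; rewrite uadjM adjK.
Qed.

Lemma stin_ker_adj w w' : adj (stin_ker w w') = stin_ker w' w.
Proof. by rewrite /stin_ker eq_sym; case: ifP => _; rewrite ?adj0 ?beta_adj. Qed.

Fact stin_ip_adj x y : adj (stin_ip x y) = stin_ip y x.
Proof.
rewrite /stin_ip adj_sum [RHS]exchange_big /=; apply: eq_bigr => p _.
rewrite adj_sum; apply: eq_bigr => q _.
by rewrite !uadjM adjK stin_ker_adj mulrA.
Qed.

Fact stin_ip_pos x : npos (stin_ip x x).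
Proof.
pose t := in_tuple x; pose w r := (tnth t r).1; pose b r := (tnth t r).2.
have [m [c cP]] := beta_cp (fun r => (w r).1.1) (fun r => (w r).1.2).
have -> : stin_ip x x = \sum_r \sum_r' adj (b r) * stin_ker (w r) (w r') * b r'.
  by rewrite /stin_ip [LHS]big_tnth; apply: eq_bigr => r _; rewrite [LHS]big_tnth.
(* [beta_cp] factors the kernel with the flags ignored; masking the factor by the flag restores the
   orthogonality of the copies and leaves a sum of Gram squares. *)
pose cb l s r := if (w r).2 == s then c l r * b r else 0.
have -> : \sum_r \sum_r' adj (b r) * stin_ker (w r) (w r') * b r' =
    \sum_l \sum_(s : bool) adj (\sum_r cb l s r) * (\sum_r cb l s r).
  transitivity (\sum_l \sum_(s : bool) \sum_r \sum_r' adj (cb l s r) * cb l s r'); last first.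
    apply: eq_bigr => l _; apply: eq_bigr => s _; rewrite adj_sum mulr_suml.
    by apply: eq_bigr => r _; rewrite mulr_sumr.
  under [RHS]eq_bigr => l _ do rewrite exchange_big /=.
  rewrite [RHS]exchange_big /=; apply: eq_bigr => r _.
  under [RHS]eq_bigr => l _ do rewrite exchange_big /=.
  rewrite [RHS]exchange_big /=; apply: eq_bigr => r' _.
  rewrite /stin_ker cP /cb.
  have [->|ss] := eqVneq (w r).2 (w r').2.
    rewrite mulr_sumr mulr_suml; apply: eq_bigr => l _.
    rewrite (bigD1 (w r').2) //= eqxx big1 ?addr0 => [|s]; last first.
      by rewrite eq_sym => /negPf ->; rewrite mulr0.
    by rewrite uadjM !mulrA.
  rewrite mulr0 mul0r big1 // => l _; rewrite big1 // => s _.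
  have [<-|_] := eqVneq (w r).2 s; last by rewrite adj0 mul0r.
  by rewrite eq_sym (negPf ss) mulr0.
by apply: npos_sum => l _; apply: npos_sum => s _; exact: npos_gram.
Qed.

Definition stin : preHilb B := PreHilb stin_ip_lin stin_ip_act stin_ip_adj stin_ip_pos.

Definition stin_rho_fun (a : A) (x : stin) : stin :=
  [seq ((a * p.1.1.1, p.1.1.2, p.1.2), p.2) | p : Om * C <- x].

Lemma ker_rho (a : A) w w' : stin_ker (adj a * w.1.1, w.1.2, w.2) w' = stin_ker w (a * w'.1.1, w'.1.2, w'.2).
Proof. by rewrite /stin_ker /=; case: ifP => // _; rewrite uadjM adjK mulrA. Qed.

Fact rho_adj (a : A) (x y : stin) : ip (stin_rho_fun (adj a) x) y = ip x (stin_rho_fun a y).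
Proof.
rewrite /= /stin_ip big_map; apply: eq_bigr => p _; rewrite big_map; apply: eq_bigr => q _ /=.
by rewrite ker_rho.
Qed.

Lemma stin_ker_lin k (a a' : A) w w' :
  stin_ker w ((k *: a + a') * w'.1.1, w'.1.2, w'.2) =
  k *: stin_ker w (a * w'.1.1, w'.1.2, w'.2) + stin_ker w (a' * w'.1.1, w'.1.2, w'.2).
Proof.
rewrite /stin_ker /=; case: ifP => _; last by rewrite scaler0 addr0.
by rewrite mulrDl mulrDr -cscaleAl -cscaleAr beta_lin.
Qed.

Lemma rho_lin k (a a' : A) (x y : stin) : ip x (stin_rho_fun (k *: a + a') y) =
  k *: ip x (stin_rho_fun a y) + ip x (stin_rho_fun a' y).
Proof.
rewrite /= /stin_ip scaler_sumr -big_split; apply: eq_bigr => p _ /=.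
rewrite !big_map scaler_sumr -big_split; apply: eq_bigr => q _ /=.
by rewrite stin_ker_lin mulrDr mulrDl -cscaleAr -cscaleAl.
Qed.

Lemma rhoM a a' x : stin_rho_fun (a * a') x = stin_rho_fun a (stin_rho_fun a' x).
Proof. by rewrite /stin_rho_fun -map_comp; apply: eq_map => p /=; rewrite mulrA. Qed.

Lemma rho1 x : stin_rho_fun 1 x = x.
Proof. by rewrite -[RHS]map_id; apply: eq_map => [[[[a i] s] b]] /=; rewrite mul1r. Qed.

Fact rho_bnd (a : A) : exists2 c, 0 <= c & bnd (opform (stin_rho_fun a)) c.
Proof.
have c0 : 0 < nrm a + 1 by rewrite ltr_wpDl // nrm_ge0.
exists (nrm a + 1); first exact: ltW.
apply: (bnd_of_gram (rho_adj a) c0) => x.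
have ac : nrm a <= nrm a + 1 by rewrite lerDl.
(* With g a root of c^2 - a^* a, the difference c^2 <x,x> - <ax,ax> is the inner square of g x. *)
have /npos_sqrt[g [/npos_sa ga gg _]] := npos_gram_le ac.
have rhoL : linear (fun a => ip x (stin_rho_fun a x)) by move=> k a1 a2; exact: rho_lin.
have := ip_pos (stin_rho_fun g x); congr npos.
rewrite -{1}ga rho_adj -rhoM gg (linB rhoL) (linZ rhoL) rho1 rhoM.
by rewrite -[X in _ - X = _]rho_adj adjK.
Qed.
Definition rho (a : A) : op stin := Op (rho_adj a) (rho_bnd a).

Definition stin_vec (i : 'I_d) (s : bool) : stin := [:: ((1, i, s), 1)].

Lemma ip_stin_vec a i j s s' :
  ip (stin_vec i s) (rho a (stin_vec j s')) = if s == s' then beta i j a else 0.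
Proof.
rewrite /= /stin_ip !big_seq1 /= uadj1 mul1r mulr1 /stin_ker /=.
by rewrite uadj1 mul1r mulr1.
Qed.

Lemma ip_stin_vec1 i j s s' :
  ip (stin_vec i s) (stin_vec j s') = ((s == s') && (i == j))%:R.
Proof.
rewrite -{1}[stin_vec j s']rho1 -[stin_rho_fun 1 _]/(rho 1 _) ip_stin_vec beta1.
by case: (s == s').
Qed.

Variable i0 : 'I_d.

(** The dilation is exposed through algebraic relations only: [iota b] is |w> b <w| and [kappa] is
    the vector state at w, so that [kappa] inverts [iota]. *)
Theorem stinespring : exists (X : unitalCStarAlgType R) (r : A -> ualg X)
    (s : 'I_d -> ualg X) (iota : C -> ualg X) (kappa : ualg X -> C),
  [/\ @unital_star_hom R O X r,
      forall i j a, adj (s i) * r a * s j = iota (beta i j a),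
      forall i j, s i * s j = 0 &
   [/\ forall i, s i * iota 1 = s i,
      linear iota, linear kappa,
      [/\ kappa 1 = 1, forall b, kappa (iota b) = b &
        forall x, kappa (iota 1 * x * iota 1) = kappa x]
    & forall n (x : 'M[X]_n), mx_positive x -> mx_positive (map_mx kappa x)]].
Proof.
(* The unit vectors [w] and [xi i] sit in different copies and s_i is |xi_i><w|. Hence s_i s_j = 0,
   while s_i^* r(a) s_j pairs xi_i with r(a) xi_j inside one copy and returns beta_ij(a). *)
pose w := stin_vec i0 true; pose xi i := stin_vec i false.
have w1 : ip w w = 1 by rewrite ip_stin_vec1 !eqxx.
have xi1 i : ip (xi i) (xi i) = 1 by rewrite ip_stin_vec1 !eqxx.
have wxi i : ip w (xi i) = 0 by rewrite ip_stin_vec1.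
exists (cstar_of (lopData stin)), (fun a => loc (rho a)),
  (fun i => loc (rank_one 1 (xi1 i) w1)), (fun b => loc (rank_one b w1 w1)), (fun t => (t : lop stin) w w).
split.
- split; last by apply: lop_eq => x y; rewrite !locE /= rho1.
  split=> [k a a'|a a'|a].
  + by apply: lop_eq => x y; rewrite lopD lopZ; exact: rho_lin.
  + rewrite -[RHS]/(lop_mul (loc (rho a)) (loc (rho a'))) -loc_mul.
    by apply: lop_eq => x y; rewrite !locE; congr ip; exact: rhoM.
  + rewrite -[RHS]/(lop_adj (loc (rho a))) -loc_adj.
    by apply: lop_eq.
- move=> i j a.
  rewrite -[LHS]/(lop_mul (lop_mul (lop_adj (loc _)) (loc _)) (loc _)) -loc_adj -!loc_mul.
  apply: lop_eq => x y; rewrite !locE [LHS]ip_act [RHS]ip_act uadj1 mul1r.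
  rewrite -[X in _ * X](opP (rho a)) ip_act opP ip_stin_vec eqxx mul1r //.
- move=> i j; rewrite -[LHS]/(lop_mul (loc _) (loc _)) -loc_mul.
  by apply: lop_eq => x y; rewrite !locE [LHS]ip_act ip_act wxi mul0r mulr0 mulr0.
split.
- move=> i; rewrite -[LHS]/(lop_mul (loc _) (loc _)) -loc_mul.
  by apply: lop_eq => x y; rewrite !locE [LHS]ip_act [RHS]ip_act ip_act w1 !mul1r.
- move=> k b b'; apply: lop_eq => x y.
  rewrite [RHS]lopD lopZ !locE !ip_act.
  by rewrite mulrDl mulrDr -cscaleAl -cscaleAr.
- by move=> k t t'; rewrite [LHS]lopD lopZ.
- split=> [|b|t]; first exact: w1.
    by rewrite locE [LHS]ip_act w1 mulr1 mul1r.
  rewrite -[LHS]/(lop_mul (lop_mul (loc _) t) (loc _) w w) lop_mul_locr lop_mul_locl.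
  by rewrite lop_actr lop_actl w1 uadj1 !mul1r uadj1 mul1r mulr1.
- move=> n x /(vector_state_cp w)[c xc]; apply: (@gram_mx_positive _ _ n n c) => i j.
  by rewrite mxE xc.
Qed.

End Stinespring.

(** * The slice system *)

Lemma closure_nrm (R : realType) (A : cstarAlgType R) (D : set A) (x : A) :
  closure D x <-> (forall e, 0 < e -> exists2 y, D y & nrm (x - y) < e).
Proof.
split=> [Dx e e0|Dx V /nbhs_ballP[_ /gtc0P[e e0 ->] eV]].
  have e0' : 0 < e%:C :> R[i] by rewrite ltcR.
  have [y [Dy xy]] := Dx _ (nbhsx_ballx x _ e0'); exists y => //.
  by move: xy; rewrite -ball_normE /ball_ /= nrmE ltcR.
have [y Dy xy] := Dx e e0; exists y; split=> //; apply: eV.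
by rewrite -ball_normE /ball_ /= nrmE ltcR.
Qed.

(** * Boundedness of unital completely positive maps on operator systems *)

Section UcpBound.
Variables (R : realType) (A B : unitalCStarAlgType R).
Local Notation C := (ualg A).
Local Notation D := (ualg B).

Lemma gram_le1 (y z : D) : adj y * y + adj z * z = 1 -> nrm y <= 1.
Proof.
move=> yz; rewrite -(@expr_le1 _ 2) // ?nrm_ge0 // -unrm_cstar.
apply: npos_le_nrm => //; first exact: npos_gram.
by rewrite scale1r -yz addrC addKr; exact: npos_gram.
Qed.

(** For |s| <= 1 the matrix with rows (1, s) and (s^*, 1) is positive, with factor of rows (1, s)
    and (0, g), g^2 = 1 - s^* s. Its image has unit diagonal, so the factor of the image has entries
    of norm at most 1, and [psi s] is a sum of two products of such entries; hence the constant
    2. *)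
Lemma ucp_bounded (S : set A) (psi : A -> B) : ucp_on S psi -> S cone ->
  (forall k x y, S x -> S y -> S (k *: x + y)) -> (forall x, S x -> S (adj x)) ->
  forall s, S s -> nrm (psi s) <= 2 * nrm s.
Proof.
move=> [psiL psi1 psiP] S1 SL SA.
have S0 : S 0 by rewrite -(addNr cone) -scaleN1r; exact: SL.
have psi0 : psi 0 = 0.
  by have := psiL 1 0 0 S0 S0; rewrite !scale1r addr0 => /eqP; rewrite -subr_eq0 opprD addNKr oppr_eq0 => /eqP.
have psiZ k x : S x -> psi (k *: x) = k *: psi x.
  by move=> Sx; have := psiL k x 0 Sx S0; rewrite psi0 !addr0.
have small s : S s -> nrm s <= 1 -> nrm (psi s) <= 2.
  move=> Ss s1; pose f (i j : 'I_2) : A :=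
    if i == ord0 then (if j == ord0 then cone else s) else (if j == ord0 then adj s else cone).
  have /npos_sqrt[g [/npos_sa ga gg _]] := npos_gram_le s1.
  pose c (i j : 'I_2) : C :=
    if i == ord0 then (if j == ord0 then 1 else (s : C)) else (if j == ord0 then 0 else g).
  have fS i j : S (f i j) by rewrite /f; do 2 case: ifP => _ //; exact: SA.
  have fc i j : f i j = \sum_l adj (c l i) * c l j.
    rewrite !big_ord_recl big_ord0 /f /c /= addr0.
    do 2 case: ifP => _; rewrite ?uadj1 ?adj0 ?mul0r ?mulr0 ?mul1r ?mulr1 ?addr0 //.
    by rewrite ga gg expr1n scale1r addrC subrK.
  have [||y yP] := psiP 2%N (\matrix_(i, j) f i j).
  - by move=> i j; rewrite mxE.
  - by apply: (@gram_mx_positive _ _ 2 2 c) => i j; rewrite mxE.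
  have yE i j : psi (f i j) = (adj (y ord0 i) : D) * y ord0 j + (adj (y (lift ord0 ord0) i) : D) * y (lift ord0 ord0) j.
    by have := yP i j; rewrite !mxE => ->; rewrite !big_ord_recl big_ord0 addr0.
  have y0 := yE ord0 ord0; have y1 := yE (lift ord0 ord0) (lift ord0 ord0).
  have y2 := yE ord0 (lift ord0 ord0).
  rewrite /f /= psi1 in y0 y1; rewrite /f /= in y2.
  have n0 := gram_le1 (esym y0); have n1 := gram_le1 (esym y1).
  have n2 := gram_le1 (etrans (addrC _ _) (esym y0)); have n3 := gram_le1 (etrans (addrC _ _) (esym y1)).
  rewrite y2 (le_trans (nrmD _ _)) // -[2]/(1 + 1) lerD // (le_trans (unrmM _ _)) // nrm_adj -(mulr1 1);
    by rewrite ler_pM ?nrm_ge0.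
move=> s Ss; have := nrm_ge0 s; rewrite le_eqVlt => /orP[/eqP s0|s0].
  by rewrite -s0 mulr0 (nrm0_eq0 (esym s0)) psi0 nrm0.
have := small ((nrm s)^-1%:C *: s); rewrite psiZ // !nrmZr gtr0_norm ?invr_gt0 //.
rewrite mulVf ?gt_eqF // mulrC ler_pdivrMr // => ->//.
by rewrite -[_ *: s]addr0; exact: SL.
Qed.
End UcpBound.

(** * The slice system and the matrix coefficients of Phi *)

Section Slices.
Variables (R : realType) (P O M T : unitalCStarAlgType R) (F : frame P).
Variables (tau : P -> M -> T) (Phi : O -> T).
Hypothesis Phi_hom : unital_star_hom Phi.
Local Notation d := (fdim F).
Local Notation u := (@fu R P F).
Local Notation cf := (@fcf R P F).
Variable G : T -> {ffun 'I_d -> M}.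
Hypothesis G_hom : @star_hom R T (tensor M F) G.
Hypothesis G_cont : forall l, continuous (fun t => G t l).
Hypothesis G_tau : forall p m, G (tau p m) = ttau F p m.
Hypothesis GK : forall t, t = \sum_l tau (u l) (G t l).
Local Notation S := (slice_system tau Phi).
Local Notation phi a l := (G (Phi a) l).

Lemma slices_phi a l : slices tau Phi (phi a l).
Proof.
have [GL _ _] := G_hom.
exists (fun p => cf l p), (fun t => G t l), a; split=> //.
- by move=> k x y; exact: fcf_lin.
- have [K K0 HK] := fcf_bnd F.
  apply: (@linear_dominated_continuous R _ _ ((fun p => cf l p) : P -> R[i]^o) K) => //.
    by move=> k x y; exact: fcf_lin.
  by move=> p; rewrite nrmE -rmorphM /= -[`|_|]/((Normc.normc (cf l p))%:C) lecR HK.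
- split=> //; first by move=> k x y; rewrite GL !ffunE.
  by move=> p m; rewrite G_tau ffunE.
Qed.

Lemma lin_span_gen (V : lmodType R[i]) (D : set V) x : D x -> lin_span D x.
Proof.
by move=> Dx; exists 1%N, (fun=> 1), (fun=> x); rewrite big_ord1 scale1r.
Qed.

Lemma lin_span_lin (V : lmodType R[i]) (D : set V) k x y :
  lin_span D x -> lin_span D y -> lin_span D (k *: x + y).
Proof.
move=> [n [c [s [sD ->]]]] [n' [c' [s' [sD' ->]]]].
exists (n + n')%N, (fun i => match fintype.split i with inl j => k * c j | inr j => c' j end),
  (fun i => match fintype.split i with inl j => s j | inr j => s' j end); split.
  by move=> i; case: (fintype.split i).
rewrite big_split_ord scaler_sumr /=; congr (_ + _); apply: eq_bigr => i _.
  by rewrite (unsplitK (inl i)) scalerA.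
by rewrite (unsplitK (inr i)).
Qed.

Lemma slice_phi a l : S (phi a l).
Proof. by apply: subset_closure; apply: lin_span_gen; exact: slices_phi. Qed.

Lemma slice_lin k x y : S x -> S y -> S (k *: x + y).
Proof.
move=> /closure_nrm Sx /closure_nrm Sy; apply/closure_nrm => e e0.
have n0 : 0 < Normc.normc k + 1 by rewrite ltr_wpDl // normc_ge0.
have e2 := divr_gt0 e0 (ltr0Sn R 1).
have [x' Dx xx] := Sx _ (divr_gt0 e2 n0); have [y' Dy yy] := Sy _ e2.
exists (k *: x' + y'); first exact: lin_span_lin.
rewrite opprD addrACA -scalerBr (le_lt_trans (nrmD _ _)) // [ltRHS]splitr ler_ltD // nrmZ.
apply: (@le_trans _ _ ((Normc.normc k + 1) * nrm (x - x'))).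
  by rewrite ler_wpM2r ?nrm_ge0 // lerDl.
by rewrite mulrC -ler_pdivlMr // ltW.
Qed.

(** By linearity the slice of Phi(a) along omega is \sum_l omega(u_l) phi_l(a), so the closed span
    of the coordinates of Phi is all of the slice system. *)
Lemma slice_ind (Z : set M) : Z 0 -> (forall k x y, Z x -> Z y -> Z (k *: x + y)) ->
  (forall a l, Z (phi a l)) ->
  (forall x, S x -> (forall e, 0 < e -> exists2 y, Z y & nrm (x - y) < e) -> Z x) ->
  forall x, S x -> Z x.
Proof.
move=> Z0 ZL Zphi Zcl.
have Zsum n (c : 'I_n -> R[i]) (s : 'I_n -> M) : (forall i, Z (s i)) -> Z (\sum_i c i *: s i).
  by move=> Zs; elim/big_rec: _ => // i x _; exact: ZL.
have Zsl x : slices tau Phi x -> Z x.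
  move=> [w [f [a [_ _ [fL _ fT] ->]]]].
  rewrite (GK (Phi a)) (lin_sum fL); under eq_bigr => l _ do rewrite fT.
  exact: Zsum.
move=> x Sx; apply: Zcl => // e e0; have [y [n [c [s [sD ->]]]] xy] := (closure_nrm _ _).1 Sx e e0.
by exists (\sum_i c i *: s i) => //; apply: Zsum => i; exact: Zsl.
Qed.

Lemma slice0 : S 0.
Proof.
apply: subset_closure; exists 0%N, (fun=> 0), (fun=> 0); rewrite big_ord0; by split=> [[]|].
Qed.

Lemma slice_sum n (c : 'I_n -> R[i]) (s : 'I_n -> M) : (forall i, S (s i)) -> S (\sum_i c i *: s i).
Proof. by move=> Ss; elim/big_rec: _ => [|i x _]; [exact: slice0 | exact: slice_lin]. Qed.

Lemma slice_closed x : (forall e, 0 < e -> exists2 y, S y & nrm (x - y) < e) -> S x.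
Proof.
move=> Sx; apply/closure_nrm => e e0; have e2 := divr_gt0 e0 (ltr0Sn R 1).
have [y /closure_nrm Sy xy] := Sx _ e2; have [z Dz yz] := Sy _ e2; exists z => //.
by rewrite -(subrK y x) -addrA (le_lt_trans (nrmD _ _)) // [ltRHS]splitr ltrD.
Qed.

Lemma phi_adj a : G (Phi (adj a)) = tadj (G (Phi a)).
Proof. by have [[_ _ PA] _] := Phi_hom; have [_ _ GA] := G_hom; rewrite PA GA. Qed.

Lemma phi_mul a b : G (Phi (a ** b)) = tmul (G (Phi a)) (G (Phi b)).
Proof. by have [[_ PM _] _] := Phi_hom; have [_ GM _] := G_hom; rewrite PM GM. Qed.

(** [G] is only known to be a *-homomorphism; it is onto, with right inverse h, so [G cone] acts as
    a unit and equals it. *)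
Lemma phi_one : G (Phi cone) = tone M F.
Proof.
have [_ ->] := Phi_hom; have [_ GM _] := G_hom.
pose h t := \sum_l tau (u l) ((t : {ffun 'I_d -> M}) l).
have Gh t : G (h t) = t.
  have [GL _ _] := G_hom.
  rewrite /h (lin_sum GL) [RHS](ttau_sum (t : tensor M F)); apply: eq_bigr => l _.
  exact: G_tau.
transitivity ((G cone : tensor M F) ** (G (h (tone M F)) : tensor M F)).
  by rewrite Gh; exact: (esym (@cmulx1 _ (tensor M F) (G cone))).
by rewrite -GM cmul1x Gh.
Qed.

Lemma slice_adj x : S x -> S (adj x).
Proof.
move: x; apply: slice_ind.
- by rewrite adj0; exact: slice0.
- by move=> k x y Sx Sy; rewrite adjD cadjZ; exact: slice_lin.
- move=> a l; rewrite -[a]adjK phi_adj ffunE adj_sum.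
  under eq_bigr => n _ do rewrite cadjZ adjK.
  by apply: slice_sum => n; exact: slice_phi.
- move=> x _ cl; apply: slice_closed => e /cl[y Sy xy]; exists (adj y) => //.
  by rewrite -adjB nrm_adj.
Qed.

(** Phi seen as a unital *-homomorphism from O to d by d matrices over M, with entries in the slice
    system. *)
Definition Phi_mx (a : O) (i j : 'I_d) : ualg M :=
  tmx (fun l => G (Phi a) l : ualg M) i j.

Lemma Phi_mx_entry a i j : Phi_mx a i j = temb (G (Phi a)) (ecol M i) (ecol M j).
Proof. by rewrite tembE. Qed.

Lemma slice_Phi_mx a i j : S (Phi_mx a i j).
Proof. by apply: slice_sum => l; exact: slice_phi. Qed.

Lemma Phi_mx_mul a b i j : Phi_mx (a ** b) i j = \sum_l Phi_mx a i l * Phi_mx b l j.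
Proof.
rewrite Phi_mx_entry phi_mul temb_mul lop_mul_entry.
by apply: eq_bigr => l _; rewrite -!Phi_mx_entry.
Qed.

Lemma Phi_mx_adj a i j : Phi_mx (adj a) i j = adj (Phi_mx a j i).
Proof. by rewrite !Phi_mx_entry phi_adj temb_adj. Qed.

Lemma Phi_mx1 i j : Phi_mx cone i j = (i == j)%:R.
Proof. by rewrite Phi_mx_entry phi_one temb_one -loc_mx1 loc_mx_entry. Qed.

Lemma Phi_mx_lin k a b i j : Phi_mx (k *: a + b) i j = k *: Phi_mx a i j + Phi_mx b i j.
Proof.
have [[PL _ _] _] := Phi_hom; have [GL _ _] := G_hom.
by rewrite !Phi_mx_entry PL GL temb_lin lopD lopZ.
Qed.

Lemma phi_of_Phi_mx a l : phi a l = \sum_i \sum_j cf l (u i * adj (u j)) *: Phi_mx a i j.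
Proof. exact: (tmxK (fun l => G (Phi a) l : ualg M)). Qed.

Lemma slice_cone : 'I_d -> S cone.
Proof.
by move=> i; have := @slice_Phi_mx cone i i; rewrite Phi_mx1 eqxx.
Qed.

(** * Complete positivity of psi applied entrywise to Phi *)

Section Compression.
Variables (B : unitalCStarAlgType R) (psi : M -> B).
Hypothesis psi_ucp : ucp_on S psi.
Local Notation D := (ualg B).
Let beta (i j : 'I_d) (a : ualg O) : D := psi (Phi_mx a i j).

Lemma psi0 : psi 0 = 0.
Proof.
have [psiL _ _] := psi_ucp; have := psiL 1 0 0 slice0 slice0.
by rewrite !scale1r addr0 => /eqP; rewrite -subr_eq0 opprD addNKr oppr_eq0 => /eqP.
Qed.

Lemma psi_sum n (c : 'I_n -> R[i]) (s : 'I_n -> M) : (forall i, S (s i)) ->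
  psi (\sum_i c i *: s i) = \sum_i c i *: psi (s i).
Proof.
have [psiL _ _] := psi_ucp.
elim: n c s => [|n IH] c s Ss; first by rewrite !big_ord0 psi0.
rewrite !big_ord_recl psiL // ?IH //.
exact: slice_sum.
Qed.

Lemma beta_lin i j k a a' : beta i j (k *: a + a') = k *: beta i j a + beta i j a'.
Proof.
by have [psiL _ _] := psi_ucp; rewrite /beta Phi_mx_lin psiL //; exact: slice_Phi_mx.
Qed.

Lemma beta_unit i j : beta i j 1 = (i == j)%:R.
Proof.
have [_ psi1 _] := psi_ucp; rewrite /beta (Phi_mx1 i j).
by case: (i == j); rewrite ?psi1 ?psi0.
Qed.

(** The matrix fed to [psi] has the d by n factor with entries [Phi_mx (a r) l (i r)], because
    [Phi_mx] is multiplicative and preserves adjoints. The indices vary with the points, as the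
    list-based inner product requires. *)
Lemma beta_cp n (a : 'I_n -> ualg O) (i : 'I_n -> 'I_d) :
  exists m (c : 'I_m -> 'I_n -> D), forall r s,
  beta (i r) (i s) (adj (a r) * a s) = \sum_l adj (c l r) * c l s.
Proof.
have [_ _ psiP] := psi_ucp.
pose x : 'M[M]_n := \matrix_(r, s) Phi_mx (adj (a r) * a s) (i r) (i s).
have xp : mx_positive x.
  apply: (@gram_mx_positive _ _ d n (fun l r => Phi_mx (a r) l (i r))) => r s.
  rewrite mxE [LHS]Phi_mx_mul; apply: eq_bigr => l _.
  by rewrite Phi_mx_adj.
have [|y yP] := psiP n x _ xp; first by move=> r s; rewrite mxE; exact: slice_Phi_mx.
by exists n, (fun l r => y l r) => r s; have := yP r s; rewrite !mxE.
Qed.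

End Compression.
End Slices.

(** * The dilation *)

(* For a partial isometry [a] with adjoint [b] and [a^2 = 0], the unitary
   exchanging the initial and the final space of [a]. *)
Section Swap.
Variables (K : pzRingType) (a b : K).
Hypotheses (aa : a * a = 0) (bb : b * b = 0) (aba : a * b * a = a) (bab : b * a * b = b).

Definition swap := 1 - a * b - b * a + (a + b).

Lemma swap_sq : swap * swap = 1.
Proof.
pose p := a * b; pose q := b * a.
have pp : p * p = p by rewrite /p mulrA aba.
have qq : q * q = q by rewrite /q mulrA bab.
have pq : p * q = 0 by rewrite /p /q -mulrA (mulrA b) bb mul0r mulr0.
have qp : q * p = 0 by rewrite /p /q -mulrA (mulrA a) aa mul0r mulr0.
have pa : p * a = a by [].
have qb : q * b = b by [].
have pb : p * b = 0 by rewrite /p -mulrA bb mulr0.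
have qa : q * a = 0 by rewrite /q -mulrA aa mulr0.
have ap : a * p = 0 by rewrite /p mulrA aa mul0r.
have bq : b * q = 0 by rewrite /q mulrA bb mul0r.
have aq : a * q = a by rewrite /q mulrA.
have bp : b * p = b by rewrite /p mulrA.
have expand (x y : K) : (1 - x - y + (a + b)) * (1 - x - y + (a + b)) =
   1 - x - x - y - y + x * x + y * y + x * y + y * x
   + (a + b) + (a + b) - x * a - x * b - y * a - y * b - a * x - b * x - a * y - b * y
   + a * a + b * b + a * b + b * a by ncr.
rewrite /swap -/p -/q expand pp qq pq qp pa qb pb qa ap bq aq bp aa bb -/p -/q.
by ncr.
Qed.

Lemma swap_initial : swap * (b * a) = a.
Proof.
have -> : swap * (b * a) = b * a - a * (b * b) * a - b * a * b * a + a * b * a + b * b * a.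
  by rewrite /swap; ncr.
rewrite bab aba bb mulr0 !mul0r; ncr.
Qed.

Lemma swap_initialr : (b * a) * swap = b.
Proof.
have -> : (b * a) * swap = b * a - b * (a * a) * b - b * a * b * a + b * a * b + b * (a * a).
  by rewrite /swap; ncr.
rewrite bab aa mulr0 !mul0r; ncr.
Qed.
End Swap.

Lemma mul_linear (R : realType) (A : unitalCStarAlgType R) (x y v w : ualg A) (k : R[i]) :
  v * (k *: x + y) * w = k *: (v * x * w) + v * y * w.
Proof. by rewrite mulrDr mulrDl -cscaleAr -cscaleAl. Qed.

Section Dilation.
Variables (R : realType) (P O X : unitalCStarAlgType R) (F : frame P).
Local Notation d := (fdim F).
Local Notation u := (@fu R P F).
Local Notation cf := (@fcf R P F).
Local Notation TX := (ualg (tensor X F)).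
Variables (B : unitalCStarAlgType R) (beta : 'I_d -> 'I_d -> ualg O -> ualg B).
Variables (r : ualg O -> ualg X) (s : 'I_d -> ualg X) (iota : ualg B -> ualg X).
Hypothesis r_hom : @unital_star_hom R O X r.
Hypothesis srs : forall i j a, adj (s i) * r a * s j = iota (beta i j a).
Hypothesis ss : forall i j, s i * s j = 0.
Hypothesis s_iota : forall i, s i * iota 1 = s i.
Hypothesis iota_lin : linear iota.
Hypothesis beta1 : forall i j, beta i j 1 = (i == j)%:R.

Local Notation tt := (fun (p : ualg P) (x : ualg X) => (ttau F p x : TX)).

Lemma ttM p q x y : tt p x * tt q y = tt (p * q) (x * y).
Proof. by have [_ h _ _] := @ttau_star_tensor R P X F; exact: h. Qed.
Lemma tt_adj p x : adj (tt p x) = tt (adj p) (adj x).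
Proof. by have [_ _ h _] := @ttau_star_tensor R P X F; exact: h. Qed.
Lemma tt_linr p : linear (tt p).
Proof. by have [[_ h] _ _ _] := @ttau_star_tensor R P X F; exact: h. Qed.
Lemma tt_linl x : linear (fun p => tt p x).
Proof. by have [[h _] _ _ _] := @ttau_star_tensor R P X F; exact: h. Qed.
Lemma tt11 : tt 1 1 = 1. Proof. by []. Qed.

Lemma tt_coord x (t : TX) y k : ((tt 1 x * t * tt 1 y : TX) : {ffun 'I_d -> X}) k = x * ((t : {ffun 'I_d -> X}) k : ualg X) * y.
Proof.
have coordL : linear (fun z : TX => (z : {ffun 'I_d -> X}) k : ualg X).
  by move=> c z z'; rewrite !ffunE.
have E : tt 1 x * t * tt 1 y = \sum_l tt (u l) (x * ((t : {ffun 'I_d -> X}) l : ualg X) * y).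
  rewrite {1}(ttau_sum (t : tensor X F)) mulr_sumr mulr_suml; apply: eq_bigr => l _.
  by rewrite ttM ttM mul1r mulr1.
rewrite E [LHS](lin_sum coordL) (bigD1 k) //= ffunE fcf_u eqxx scale1r big1 ?addr0 // => l lk.
by rewrite ffunE fcf_u eq_sym (negPf lk) scale0r.
Qed.

(** The adjoints on the first leg make the compression of 1 (x) r by [S] carry the coefficients u_i
    u_j^*, those which recover an element of P from its matrix in [lamK]. *)
Let S : TX := \sum_i tt (adj (u i)) (s i).
Let E : TX := tt 1 (iota 1).

Lemma S_adj : adj S = \sum_i tt (u i) (adj (s i)).
Proof. by rewrite adj_sum; apply: eq_bigr => i _; rewrite tt_adj adjK. Qed.

Lemma S_sq : S * S = 0.
Proof.
rewrite mulr_suml big1 // => i _; rewrite mulr_sumr big1 // => j _.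
by rewrite ttM ss (lin0 (tt_linr _)).
Qed.

Lemma S_rho_S a : adj S * tt 1 (r a) * S = \sum_i \sum_j tt (u i * adj (u j)) (iota (beta i j a)).
Proof.
rewrite S_adj mulr_suml mulr_suml; apply: eq_bigr => i _; rewrite mulr_sumr.
by apply: eq_bigr => j _; rewrite !ttM mulr1 srs.
Qed.

Lemma S_adj_S : adj S * S = E.
Proof.
have [_ r1] := r_hom; have := S_rho_S 1; rewrite [r 1]r1 tt11 mulr1 => ->.
rewrite /E -[in RHS](fu_sum F) (lin_sum (tt_linl _)); apply: eq_bigr => i _.
rewrite (bigD1 i) //= beta1 eqxx big1 ?addr0 // => j; rewrite eq_sym => /negPf ij.
by rewrite beta1 ij (lin0 iota_lin) (lin0 (tt_linr _)).
Qed.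

Lemma S_E : S * E = S.
Proof. by rewrite mulr_suml; apply: eq_bigr => i _; rewrite ttM mulr1 s_iota. Qed.

Lemma S_partial : S * adj S * S = S. Proof. by rewrite -mulrA S_adj_S S_E. Qed.
Lemma S_partial_adj : adj S * S * adj S = adj S.
Proof. by rewrite -[in RHS]S_partial !uadjM adjK mulrA. Qed.
Lemma S_adj_sq : adj S * adj S = 0. Proof. by rewrite -uadjM S_sq adj0. Qed.

Let U := swap S (adj S).
Let UU : U * U = 1 := swap_sq S_sq S_adj_sq S_partial S_partial_adj.
Lemma U_adj : adj U = U.
Proof. by rewrite /U /swap !adjD !adjN uadj1 !uadjM !adjK [adj S + S]addrC. Qed.

Definition dilation (a : ualg O) : TX := U * tt 1 (r a) * U.

Lemma dilation_hom : @unital_star_hom R O (tensor X F) dilation.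
Proof.
have [[rL rM rA] r1] := r_hom.
split; last first.
  by rewrite /dilation [r _]r1 tt11 mulr1.
split.
- move=> k a b; rewrite /dilation.
  have -> : tt 1 (r (k *: a + b)) = k *: tt 1 (r a) + tt 1 (r b).
    by rewrite [r _]rL; exact: tt_linr.
  exact: mul_linear.
- move=> a b; rewrite /dilation [r _]rM.
  have -> : tt 1 (r a ** r b) = tt 1 (r a) * tt 1 (r b) by rewrite ttM mulr1.
  rewrite -[RHS]/(U * tt 1 (r a) * U * (U * tt 1 (r b) * U)).
  by rewrite -!mulrA (mulrA U U) UU mul1r.
- move=> a; rewrite /dilation [r _]rA.
  by rewrite !uadjM U_adj tt_adj uadj1 mulrA.
Qed.

(** The unitary carries the initial projection E to [S], that is U E = S and E U = adj S, so
    compressing the dilation by E gives back [S_rho_S]. *)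
Lemma dilation_coord a k : iota 1 * ((dilation a : {ffun 'I_d -> X}) k : ualg X) * iota 1 =
  \sum_i \sum_j cf k (u i * adj (u j)) *: iota (beta i j a).
Proof.
have coordL : linear (fun z : TX => (z : {ffun 'I_d -> X}) k : ualg X).
  by move=> c z z'; rewrite !ffunE.
rewrite -tt_coord -/E.
have -> : E * dilation a * E = \sum_i \sum_j tt (u i * adj (u j)) (iota (beta i j a)).
  have h1 : U * (adj S * S) = S := swap_initial S_adj_sq S_partial S_partial_adj.
  have h2 : adj S * S * U = adj S := swap_initialr S_sq S_partial_adj.
  rewrite -S_rho_S /dilation -S_adj_S.
  transitivity ((adj S * S * U) * tt 1 (r a) * (U * (adj S * S))); first by rewrite !mulrA.
  by rewrite h1 h2.
rewrite (lin_sum coordL); apply: eq_bigr => i _; rewrite (lin_sum coordL).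
by apply: eq_bigr => j _; rewrite ffunE.
Qed.
End Dilation.

(** * Multipliers and the extension *)

Section Multipliers.
Variables (R : realType) (X : unitalCStarAlgType R).

Lemma mult_eq (m m' : multiplier X) : lmult m =1 lmult m' -> rmult m =1 rmult m' -> m = m'.
Proof.
case: m m' => l r p [l' r' p'] /= ll rr.
have El : l = l' by exact: functional_extensionality_dep.
have Er : r = r' by exact: functional_extensionality_dep.
by subst l' r'; congr Multiplier; exact: Prop_irrelevance.
Qed.

Definition mult_of (x : X) : multiplier X :=
  Multiplier (fun a b : X => cmulA a x b).

Lemma hom_is_mor (A : unitalCStarAlgType R) (f : A -> X) :
  unital_star_hom f -> is_mor (fun a => mult_of (f a)).
Proof.
move=> [[fL fM fA] f1]; split.
- move=> k x y; apply: mult_eq => z /=; first by rewrite fL cmul_linearl.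
  by rewrite fL cmul_linearr.
- by move=> x y; apply: mult_eq => z /=; rewrite fM cmulA.
- by move=> x; apply: mult_eq => z /=; rewrite fA adjM adjK.
- move=> V [x Vx] _; exists x; split=> //; apply: lin_span_gen; exists cone, x.
  by rewrite /= f1 cmul1x.
Qed.

Lemma lmult_one (m : multiplier X) x : lmult m x = lmult m cone ** x.
Proof.
by rewrite -[LHS]cmul1x multP -[lmult m cone]cmul1x multP cmulx1.
Qed.
Lemma rmult_one (m : multiplier X) : rmult m cone = lmult m cone.
Proof. by rewrite -[LHS]cmulx1 -multP cmul1x. Qed.

(** For unital [X] a multiplier is multiplication by its value at 1. Preservation of the unit is
    non-degeneracy: the image e of 1 fixes a dense subspace pointwise, hence an element close to
    1. *)
Lemma mor_hom (A : unitalCStarAlgType R) (f : A -> multiplier X) :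
  is_mor f -> unital_star_hom (fun a => lmult (f a) cone).
Proof.
move=> [fL fM fA fdense].
have hM x y : lmult (f (x ** y)) cone = lmult (f x) cone ** lmult (f y) cone.
  by rewrite fM /= lmult_one.
split; first split=> //.
- by move=> k x y; rewrite fL.
- move=> x; rewrite fA /= -[in RHS]rmult_one; congr adj; congr rmult.
  exact: (@uadj1 R X).
set e := lmult (f cone) cone.
have e_span b : lin_span [set b : X | exists x y, b = lmult (f x) y] b -> e ** b = b.
  move=> [n [c [s [sP ->]]]]; rewrite cmul_sumr; apply: eq_bigr => i _.
  have [x [y ->]] := sP i; rewrite cmulZr lmult_one cmulA -hM cmul1x //.
apply/eqP; rewrite -subr_eq0; apply/eqP/nrm_small => d d0.
have K0 : 0 < nrm e + 2 by rewrite ltr_wpDl // nrm_ge0.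
have [b /e_span eb bd] := dense_approx cone fdense (divr_gt0 d0 K0).
have -> : e - cone = e ** (cone - b) - (cone - b).
  by rewrite cmulBr eb cmulx1 opprB addrA subrK.
rewrite (le_trans (nrmB _ _)) //.
apply: (@le_trans _ _ (nrm e * (d / (nrm e + 2)) + d / (nrm e + 2))).
  apply: lerD; last exact: ltW.
  by rewrite (le_trans (nrmM _ _)) // ler_wpM2l ?nrm_ge0 // ltW.
have -> : nrm e * (d / (nrm e + 2)) + d / (nrm e + 2) = d * (nrm e + 1) / (nrm e + 2) by ring.
by rewrite ler_pdivrMr // ler_pM2l // lerD2l ler1n.
Qed.
End Multipliers.

Section Extension.
Variables (R : realType) (P O M T : unitalCStarAlgType R) (F : frame P).
Variables (tau : P -> M -> T) (Phi : O -> T).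
Local Notation d := (fdim F).
Local Notation u := (@fu R P F).

(* The universal property in coordinates: a unital *-homomorphism
   [O -> P (x) X] is given by the images of the coordinates of [Phi]. *)
Lemma universal_hom (X : unitalCStarAlgType R) (Pi : O -> tensor X F)
    (G : T -> {ffun 'I_d -> M}) :
  universal_quantum_maps tau Phi -> (forall t, t = \sum_l tau (u l) (G t l)) ->
  unital_star_hom Pi ->
  exists2 L : M -> X, unital_star_hom L &
    forall a l, (Pi a : {ffun 'I_d -> X}) l = L (G (Phi a) l).
Proof.
move=> [_ _ univ] GK Pi_hom.
have [Lam [[Lam_mor [idL [[idL_lin _ _ _] idLP] PsiE]] _]] :=
  univ _ _ _ (ttau_min_tensor X F) _ (hom_is_mor Pi_hom).
exists (fun m => lmult (Lam m) cone); first exact: mor_hom.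
pose J (t : T) : tensor X F := lmult (idL t) cone.
have JL : linear J by move=> k x y; rewrite /J idL_lin.
have Jtau p m : J (tau p m) = ttau F p (lmult (Lam m) cone).
  by rewrite -[p in RHS]cmulx1 -idLP.
move=> a l.
have -> : Pi a = J (Phi a).
  have := congr1 (fun f : O -> multiplier (tensor X F) => lmult (f a) cone) PsiE.
  by rewrite /= cmulx1.
rewrite {1}(GK (Phi a)) (lin_sum JL).
rewrite sum_ffunE (bigD1 l) //= Jtau ffunE fcf_u eqxx scale1r big1 ?addr0 // => n nl.
by rewrite Jtau ffunE fcf_u eq_sym (negPf nl) scale0r.
Qed.

Lemma mx_positive_hom (X : unitalCStarAlgType R) (L : M -> X) n (x : 'M[M]_n) :
  star_hom L -> mx_positive x -> mx_positive (map_mx L x).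
Proof.
move=> [LL LM LA] [y xy]; exists (map_mx L y) => i j.
rewrite mxE xy (lin_sum LL); apply: eq_bigr => k _.
by rewrite LM LA !mxE.
Qed.
End Extension.

Theorem theorem3p9 (R : realType) (P O M T : unitalCStarAlgType R)
    (tau : P -> M -> T) (Phi : O -> T)
    (finP : finite_dimensional P) (sepO : separable O)
    (univ : universal_quantum_maps tau Phi) :
  strong_extension_property (slice_system tau Phi).
Proof.
move=> B psi psi_ucp.
have [tau_min Phi_hom _] := univ.
have [d [u [cf [cfL cfB cfu cfP [cfA uu]]]]] := fd_frame finP.
pose F := @Frame R P d u cf cfL cfB cfu cfP cfA uu.
have [G [G_hom G_cont G_tau GK]] := tensor_coordinates F tau_min.
have [GL _ _] := G_hom.
suff [X [Pi [kappa [Pi_hom kL k1 [kP kPi]]]]] : exists (X : unitalCStarAlgType R)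
    (Pi : O -> tensor X F) (kappa : X -> B),
  [/\ unital_star_hom Pi, linear kappa, kappa cone = cone &
   (forall n (x : 'M[X]_n), mx_positive x -> mx_positive (map_mx kappa x)) /\
   forall a l, kappa ((Pi a : {ffun 'I_d -> X}) l) = psi (G (Phi a) l)].
  have [L L_hom PiL] := universal_hom univ GK Pi_hom.
  have [[LL LM LA] L1] := L_hom.
  have eta_ucp : ucp_on setT (kappa \o L).
    split=> [k x y _ _||n x _ xp] /=; first by rewrite LL kL.
      by rewrite L1 k1.
    have := kP n _ (mx_positive_hom (And3 LL LM LA) xp).
    by congr mx_positive; apply/matrixP => i j; rewrite !mxE.
  exists (kappa \o L); split=> //.
  have psi00 := psi0 psi_ucp.
  have [psiL psi1 psiP] := psi_ucp.
  have eta_lin : linear (kappa \o L) by move=> k x y; rewrite /= LL kL.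
  have ind := slice_ind GK.
  (* An empty frame means P = 0: Phi has no coordinates and the slice system is 0. Otherwise the
     index [i] puts [cone] in the slice system, as [ucp_bounded] requires. *)
  case: (pickP (@predT 'I_d)) => [i _|no]; last first.
    suff S0 x : slice_system tau Phi x -> x = 0.
      by move=> x /S0 ->; rewrite psi00 (lin0 eta_lin).
    move: x; apply: ind => // [k x y -> ->|a l|x _ xcl].
    - by rewrite scaler0 addr0.
    - by have := no l.
    - by apply/nrm_small => e /xcl[y ->]; rewrite subr0 => /ltW.
  have S1 : slice_system tau Phi cone := slice_cone Phi_hom G_hom G_cont G_tau i.
  have SL := @slice_lin _ _ _ _ _ tau Phi.
  have psi_bnd := ucp_bounded psi_ucp S1 (fun k x y => @SL k x y)
    (slice_adj Phi_hom G_hom G_cont G_tau GK).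
  have eta_bnd := ucp_bounded eta_ucp I (fun _ _ _ _ _ => I) (fun _ _ => I).
  suff H x : slice_system tau Phi x ->
      slice_system tau Phi x /\ (kappa \o L) x = psi x by move=> x /H[].
  move: x; apply: ind.
  - by rewrite (lin0 eta_lin) psi00; split=> //; exact: slice0.
  - move=> k x y [Sx ex] [Sy ey]; split; first exact: SL.
    by rewrite eta_lin ex ey psiL.
  - move=> a l; split; first exact: (slice_phi G_hom G_cont G_tau).
    by rewrite /= -PiL kPi.
  - move=> x Sx xcl; split=> //; apply/eqP; rewrite -subr_eq0; apply/eqP/nrm_small => e e0.
    (* Both maps are bounded with constant 2, so a distance of e/4 to [y], where they agree,
       suffices. *)
    have [y [Sy ey] xy] := xcl _ (divr_gt0 e0 (ltr0Sn R 3)).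
    have Sxy : slice_system tau Phi (x - y) by rewrite addrC -scaleN1r; exact: SL.
    have -> : (kappa \o L) x - psi x = (kappa \o L) (x - y) - psi (x - y).
      have -> : psi (x - y) = psi x - psi y.
        by rewrite [x - y]addrC -scaleN1r psiL // scaleN1r addrC.
      by rewrite (linB eta_lin) ey opprB addrA subrK.
    rewrite (le_trans (nrmB _ _)) //.
    apply: (le_trans (lerD (eta_bnd _ I) (psi_bnd _ Sxy))).
    by rewrite -mulrDl -natrD mulrC -ler_pdivlMr // ltW.
(* The vector w of the dilation needs an index. For P = 0 the tensor product is the zero algebra,
   where the zero map is unital, and [kappa] may be the identity of [B]. *)
case: (pickP (@predT 'I_d)) => [i0 _|no]; last first.
  have T0 (x y : tensor B F) : x = y by apply/ffunP => l; have := no l.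
  exists B, (fun=> 0), id; split=> //.
    by split; first (split=> [k x y|x y|x]); exact: T0.
  split=> [n x|a l]; last by have := no l.
  by congr mx_positive; apply/matrixP => i j; rewrite mxE.
have [X [r [s [iota [kappa [r_hom srs ss [s_iota iL kL [k1 kiota kE] kP]]]]]]] :=
  stinespring (beta_lin Phi_hom G_hom G_cont G_tau psi_ucp)
    (beta_cp Phi_hom G_hom G_cont G_tau psi_ucp)
    (beta_unit Phi_hom G_hom G_tau psi_ucp) i0.
have beta1 := beta_unit Phi_hom G_hom G_tau psi_ucp.
exists X, (@dilation _ _ _ _ F r s), kappa; split=> //.
  exact: (dilation_hom r_hom srs ss s_iota iL beta1).
split=> // a l.
rewrite -kE (dilation_coord r_hom srs ss s_iota iL beta1) (lin_sum kL).
rewrite (phi_of_Phi_mx Phi G).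
have SP i j : slice_system tau Phi (Phi_mx Phi G a i j).
  exact: (slice_Phi_mx G_hom G_cont G_tau).
have psiL1 := psi_sum psi_ucp.
(* [psi] is linear on the slice system only, so each of the two sums is moved through it separately,
   with membership of the inner sums checked for the outer one. *)
transitivity (\sum_i psi (\sum_j @fcf _ _ F l (u i * adj (u j)) *: Phi_mx Phi G a i j)).
  apply: eq_bigr => i _; rewrite (lin_sum kL) psiL1 //.
  by apply: eq_bigr => j _; rewrite (linZ kL) kiota.
under eq_bigr => i _ do rewrite -[psi _]scale1r.
rewrite -psiL1 => [|i]; first by under eq_bigr => i _ do rewrite scale1r.
exact: slice_sum.
Qed.
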